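(* Let $(\mathsf X,\mathcal X)$ and $(\Theta,\mathcal T)$ be measurable spaces and let $\{P_\theta,\theta\in\Theta\}$ be a family of Markov transition kernels on $(\mathsf X,\mathcal X)$ such that for every $A\in\mathcal X$ the map $(x,\theta)\mapsto P_\theta(x,A)$ is measurable. Let $\theta_\star\in\Theta$ and let $\{(X_n,\theta_n)\}_{n\ge 0}$ be an $\mathsf X\times\Theta$-valued process on a probability space. Assume: (A2) There is a function $V:\mathsf X\to[1,+\infty)$ such that, for every $\theta\in\Theta$, $P_\theta$ is phi-irreducible and aperiodic, there exist constants $b_\theta\in(1,+\infty)$ and $\lambda_\theta\in(0,1)$ with $P_\theta V\le\lambda_\theta V+b_\theta$, and for every $d\ge1$ the level set $\{V\le d\}$ is $1$-small for $P_\theta$. (A3) There exist $\alpha\in(0,1/2)$ and a subset $\mathcal M_{V^\alpha}\subseteq\mathcal L_{V^\alpha}$ such that (a) for every $f\in\mathcal M_{V^\alpha}$, $$n^{-1/2}\sum_{k=1}^n\big|P_{\theta_k}\Lambda_{\theta_k}f-P_{\theta_{k-1}}\Lambda_{\theta_{k-1}}f\big|_{V^\alpha}\,V^\alpha(X_k)\to0\quad\text{in probability};$$ (b) $n^{-1/(2\alpha)}\sum_{k=0}^{n-1}L_{\theta_k}^{2/\alpha}\,P_{\theta_k}V(X_k)\to0$ in probability, where $L_\theta=C_\theta\vee(1-\rho_\theta)^{-1}$. (A4) For every $f\in\mathcal M_{V^\alpha}$, $n^{-1}\sum_{k=0}^{n-1}F_{\theta_k}(X_k)\to\sigma^2(f)$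 in probability, where $F_\theta= P_\theta(\Lambda_\theta f)^2-[P_\theta\Lambda_\theta f]^2$ and $\sigma^2(f)$ is a deterministic constant. (A5) There is a probability distribution $\nu$ on $\mathsf X$ such that for every $n$ and every bounded measurable $h:\mathsf X^{n+1}\to\mathbb R$, $$\mathbb E[h(X_0,\dots,X_n)\mid\theta_0,\dots,\theta_n]=\int\cdots\int\nu(dx_0)\,h(x_0,\dots,x_n)\prod_{j=1}^nP_{\theta_{j-1}}(x_{j-1},dx_j).$$ (A6) For every $f\in\mathcal M_{V^\alpha}$, (a) there is a positive constant $\gamma^2(f)$ such that $n^{-1/2}\sum_{k=1}^n\pi_{\theta_\star}(P_{\theta_k}-P_{\theta_\star})\Lambda_{\theta_\star}f$ converges in distribution to $\mathcal N(0,\gamma^2(f))$; (b) $n^{-1/2}\sum_{k=1}^n\pi_{\theta_k}(P_{\theta_k}-P_{\theta_\star})\Lambda_{\theta_\star}(P_{\theta_k}-P_{\theta_\star})\Lambda_{\theta_\star}f\to0$ in probability. Then for every $f\in\mathcal M_{V^\alpha}$, $$\frac1{\sqrt n}\sum_{k=1}^n\{f(X_k)-\pi_{\theta_\star}(f)\}$$ converges in distribution, as $n\to\infty$, to $\mathcal N\big(0,\sigma^2(f)+\gamma^2(f)\big)$.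
   Context: Notation. $Pf(x)=\int P(x,dy)f(y)$. For $W:\mathsf X\to[1,\infty)$ and $f:\mathsf X\to\mathbb R$, $|f|_W=\sup_x|f(x)|/W(x)$; $\mathcal L_W$ is the set of measurable $f$ with $|f|_W<\infty$. For a signed measure $\mu$, $\|\mu\|_W=\sup\{|\mu(f)|: |f|_W\le1\}$; for kernels $P_1,P_2$, $\|P_1-P_2\|_W=\sup_x W(x)^{-1}\|P_1(x,\cdot)-P_2(x,\cdot)\|_W$ (a probability measure $\pi$ being viewed as the kernel $x\mapsto\pi$). A set $C\in\mathcal X$ is $1$-small for $P$ if there are $\delta>0$ and a probability measure $\nu$ with $P(x,A)\ge\delta\nu(A)$ for all $x\in C$, $A\in\mathcal X$. Under (A2), every $P_\theta$ has a unique invariant probability measure $\pi_\theta$, $\pi_\theta(V)<\infty$, and for each $\alpha\in(0,1]$ the following property P[$\alpha$] holds: for every $\theta\in\Theta$ there exist $C_\theta<\infty$ and $\rho_\theta\in(0,1)$ such that $\|P_\theta^n-\pi_\theta\|_{V^\gamma}\le C_\theta\rho_\theta^n$ for all $n\ge 0$ and all $\gamma\in[\alpha,1]$. In (A3), $C_\theta,\rho_\theta$ are constants as in P[$\alpha$] for the $\alpha$ of (A3). It is implicit that the quantities in (A3) and (A6) are random variables. For $f\in\mathcal L_{V^\alpha}$, $\Lambda_\theta f=\sum_{n\ge0}\big(P_\theta^nf-\pi_\theta(f)\big)\in\mathcal L_{V^\alpha}$; it solves the Poisson equation $\Lambda_\theta f-P_\theta\Lambda_\theta f=f-\pi_\theta(f)$.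 *)

(* Defs.v *)
From HB Require Import structures.
From mathcomp Require Import all_boot all_order all_algebra.
From mathcomp Require Import all_classical all_reals all_analysis.
From mathcomp Require Import measurable_realfun.

Set Implicit Arguments.
Unset Strict Implicit.
Unset Printing Implicit Defensive.

Import Order.TTheory GRing.Theory Num.Theory.
Import numFieldNormedType.Exports.

Local Open Scope classical_set_scope.
Local Open Scope ring_scope.

Section weighted_norms.
Context {d : measure_display} {X : measurableType d} {R : realType}.
Implicit Types (W f : X -> R).

Definition wpow W (a : R) : X -> R := fun x => W x `^ a.

(* |f|_W, a priori infinite *)
Definition wnorm W f : \bar R := ereal_sup [set (`|f x| / W x)%:E | x in setT].

(* the space L_W *)
Definition Lweight W : set (X -> R) :=
  [set f | measurable_fun setT f /\ (wnorm W f < +oo)%E].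

(* || m1 - m2 ||_W. The integrals are extended-real valued: a test function that
   is not integrable for m1 or m2 cannot make the supremum smaller. *)
Definition wdist W (m1 m2 : {measure set X -> \bar R}) : \bar R :=
  ereal_sup [set `|(\int[m1]_x (f x)%:E) - (\int[m2]_x (f x)%:E)|%E
            | f in [set f | measurable_fun setT f /\ (wnorm W f <= 1)%E]].

(* || K1 - K2 ||_W *)
Definition kdist W (K1 K2 : X -> {measure set X -> \bar R}) : \bar R :=
  ereal_sup [set ((W x)^-1%:E * wdist W (K1 x) (K2 x))%E | x in setT].

End weighted_norms.

Section markov_kernels.
Context {d : measure_display} {X : measurableType d} {R : realType}.

(* K f (x) = \int K(x, dy) f(y); it is 0 where the integral is not finite *)
Definition kop (K : X -> {measure set X -> \bar R}) (f : X -> R) : X -> R :=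
  fun x => \int[K x]_y f y.

Definition kop_sub (K1 K2 : X -> {measure set X -> \bar R}) (f : X -> R) :
    X -> R :=
  fun x => kop K1 f x - kop K2 f x.

Fixpoint kpow (K : R.-pker X ~> X) (n : nat) : R.-spker X ~> X :=
  match n with
  | 0 => kdirac (@measurable_id _ X setT)
  | m.+1 => mkcomp_noparam K (kpow K m)
  end.

Definition invariant_probability (K : R.-pker X ~> X) (pi_ : probability X R) : Prop :=
  forall A : set X, measurable A -> (\int[pi_]_x K x A)%E = pi_ A.

Definition small1 (K : R.-pker X ~> X) (C : set X) : Prop :=
  measurable C /\
  exists (delta : R) (nu : probability X R), 0 < delta /\
    forall x A, C x -> measurable A -> (delta%:E * nu A <= K x A)%E.

Definition irreducibility_measure (K : R.-pker X ~> X)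
    (phi : {sigma_finite_measure set X -> \bar R}) : Prop :=
  (0 < phi setT)%E /\
  forall A, measurable A -> (0 < phi A)%E ->
    forall x, exists n, (0 < n)%N /\ (0 < kpow K n x A)%E.

Definition phi_irreducible (K : R.-pker X ~> X) : Prop :=
  exists phi, irreducibility_measure K phi.

Definition maximal_irreducibility_measure (K : R.-pker X ~> X)
    (psi : {sigma_finite_measure set X -> \bar R}) : Prop :=
  irreducibility_measure K psi /\
  forall phi, irreducibility_measure K phi ->
    forall A, measurable A -> psi A = 0%E -> phi A = 0%E.

(* a p-cycle D_0, ..., D_{p-1} in the sense of Meyn and Tweedie, Thm 5.4.4 *)
Definition is_cycle (K : R.-pker X ~> X)
    (psi : {sigma_finite_measure set X -> \bar R}) (p : nat)
    (D : nat -> set X) : Prop :=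
  [/\ (0 < p)%N,
      forall i, (i < p)%N -> measurable (D i),
      trivIset [set i | (i < p)%N] D,
      forall i x, (i < p)%N -> D i x -> K x (D (i.+1 %% p)%N) = 1%E &
      psi (~` \bigcup_(i in [set i | (i < p)%N]) D i) = 0%E].

(* the period, i.e. the largest length of a cycle, is 1; this does not depend on
   the choice of psi, as all maximal irreducibility measures are equivalent *)
Definition aperiodic (K : R.-pker X ~> X) : Prop :=
  forall psi, maximal_irreducibility_measure K psi ->
    forall p D, is_cycle K psi p D -> p = 1%N.

(* Lambda f = sum_{n >= 0} (K^n f - pi_(f)), pointwise *)
Definition Lambda (K : R.-pker X ~> X) (pi_ : probability X R) (f : X -> R) :
    X -> R :=
  fun x => limn (series (fun n => kop (kpow K n) f x - \int[pi_]_y f y)).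

End markov_kernels.

Section chain_law.
Context {d d' : measure_display} {X : measurableType d} {T : measurableType d'}
  {R : realType}.
Variable P : T -> R.-pker X ~> X.

(* chain_int n th x h =
     \int P_{th 0}(x, dx_1) ... \int P_{th (n-1)}(x_{n-1}, dx_n) h(x_1, ..., x_n) *)
Fixpoint chain_int (n : nat) (th : nat -> T) (x : X) {struct n} :
    (n.-tuple X -> R) -> R :=
  match n with
  | 0 => fun h => h [tuple]
  | m.+1 => fun h => \int[P (th 0%N) x]_y
      chain_int (fun k => th k.+1) y (fun t : m.-tuple X => h [tuple of y :: t])
  end.

Definition path_int (nu : probability X R) (n : nat) (th : nat -> T)
    (h : n.+1.-tuple X -> R) : R :=
  \int[nu]_x chain_int th x (fun t : n.-tuple X => h [tuple of x :: t]).

End chain_law.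

Section convergence.
Context {d : measure_display} {Omega : measurableType d} {R : realType}.
Variable Pr : probability Omega R.

(* Z is a version of the conditional expectation of Y given the sigma-algebra G *)
Definition is_cond_expectation (G : set (set Omega)) (Y Z : Omega -> R) : Prop :=
  [/\ Pr.-integrable setT (EFin \o Z),
      forall B : set R, measurable B -> G (Z @^-1` B) &
      forall A, G A -> (\int[Pr]_(w in A) (Y w)%:E = \int[Pr]_(w in A) (Z w)%:E)%E].

(* Both modes of convergence include that the Y n are random variables. *)
Definition cvg_in_probability (Y : nat -> Omega -> R) (c : R) : Prop :=
  (forall n, measurable_fun setT (Y n)) /\
  forall eps : R, 0 < eps ->
    Pr [set w | eps <= `|Y n w - c|] @[n --> \oo] --> 0%E.

Definition cvg_in_distribution (Y : nat -> Omega -> R)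
    (mu : {measure set (measurableTypeR R) -> \bar R}) : Prop :=
  (forall n, measurable_fun setT (Y n)) /\
  forall g : R -> R, continuous g -> bounded_fun g ->
    'E_Pr[g \o Y n]%E @[n --> \oo] --> (\int[mu]_x (g x)%:E)%E.

End convergence.

(* Main.v *)
Require Import Defs.
From HB Require Import structures.
From mathcomp Require Import all_boot all_order all_algebra.
From mathcomp Require Import all_classical all_reals all_analysis.
From mathcomp Require Import measurable_realfun.
From mathcomp Require Import finmap ring lra zify.

Set Implicit Arguments.
Unset Strict Implicit.
Unset Printing Implicit Defensive.

Import Order.TTheory GRing.Theory Num.Theory.
Import numFieldNormedType.Exports.

Local Open Scope classical_set_scope.
Local Open Scope ring_scope.

(* With U_t = P_t (Lambda_t f), the Poisson equation writes the centred sum as a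
   sum of the increments D_t(x, y) = Lambda_t f(y) - U_t(x), taken at
   (th_k, X_k, X_k+1), plus a telescoping error, plus the drift terms
   pi_t(f) - pi_star(f). As pi_t is invariant, the latter expand exactly into the
   summands of (A6a) and (A6b). Given the parameter path, (A5) makes the D-terms a
   martingale difference array, while the (A6a) term tau is a function of the
   parameters only. Along a fixed parameter path, Lindeberg's method replaces the
   increments one by one by Gaussian ones: for a test function g and h_r = heat g r,
   E h_r(s + D) is close to h_(r + v)(s), where v is the conditional variance of D.
   Starting from r slightly above sigma^2 and stopping when the variance budget or
   the moment budget (controlled by (A3b), as |D|^(1/alpha) is of order
   L^(2/alpha) P_t V in mean) is spent, one finds E g(S_n + tau) close to
   E h_(sigma^2)(tau), which tends to E g of the Gaussian sum by (A6a). *)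

(** * Integration against kernels *)

(** The convergences in (A3) and (A4) hold in probability for the joint law of chain and parameters,
    not along a given parameter path, so a martingale limit theorem cannot simply be applied path by
    path. The stopped replacement avoids this: its error [eps * r + K * b] is deterministic, the
    same for all paths and all starting values, so it can be integrated over the paths, and (A3b)
    and (A4) enter only through the unconditional probability that neither budget runs out. As tau
    is frozen along a path, it can serve as starting value of the sum; this is why the two Gaussian
    variances add as if the parts were independent. The exponent q = 1/alpha exceeds 2 because alpha
    < 1/2: a q-th moment bound then takes the place of the Lindeberg condition, and (1/sqrt n)^q is
    exactly the normalisation of (A3b). Test functions are described by a second order expansion
    with a uniform remainder, a property that Gaussian averaging preserves. *)

Section finite_mass.
Context d (T : measurableType d) (R : realType) (mu : {measure set T -> \bar R}).
Hypothesis mu1 : mu setT = 1%E.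

Lemma integrable_bounded (f : T -> R) (B : R) : measurable_fun setT f ->
  (forall x, `|f x| <= B) -> mu.-integrable setT (EFin \o f).
Proof.
move=> mf fB; apply: measurable_bounded_integrable => //; first by rewrite mu1 ltry.
exists B; split; first exact: num_real.
by move=> M BM x _ /=; rewrite (le_trans (fB x))// ltW.
Qed.

Lemma Rintegral_cst1 (r : R) : \int[mu]_x r = r.
Proof. by rewrite Rintegral_cst// mu1 mulr1. Qed.

Lemma Rintegral_le_bound (f g : T -> R) (e : R) :
  mu.-integrable setT (EFin \o f) -> mu.-integrable setT (EFin \o g) ->
  (forall x, `|f x - g x| <= e) -> `|\int[mu]_x f x - \int[mu]_x g x| <= e.
Proof.
move=> mf mg fe; rewrite -RintegralB//.
have mfg : mu.-integrable setT (EFin \o (fun x => f x - g x)).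
  by apply: eq_integrable (integrableB measurableT mf mg) => // x _; rewrite /= EFinB.
rewrite (le_trans (le_normr_Rintegral measurableT mfg))//.
rewrite -[leRHS]Rintegral_cst1; apply: le_Rintegral => //.
  exact: integrable_norm.
apply: (@integrable_bounded _ `|e|) => //.
Qed.

Lemma Rintegral_bound (f : T -> R) (B : R) : mu.-integrable setT (EFin \o f) ->
  (forall x, `|f x| <= B) -> `|\int[mu]_x f x| <= B.
Proof.
move=> mf fB; have i0 : mu.-integrable setT (EFin \o (cst 0 : T -> R)).
  by apply: (@integrable_bounded _ 0) => // x; rewrite normr0.
have := @Rintegral_le_bound f (cst 0) B mf i0.
by rewrite Rintegral_cst1 subr0; apply => x; rewrite subr0.
Qed.

Lemma Rintegral_norm_le (f h : T -> R) :
  mu.-integrable setT (EFin \o f) -> mu.-integrable setT (EFin \o h) ->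
  (forall x, `|f x| <= h x) -> `|\int[mu]_x f x| <= \int[mu]_x h x.
Proof.
move=> mf mh fh; rewrite (le_trans (le_normr_Rintegral measurableT mf))//.
by apply: le_Rintegral => //; exact: integrable_norm.
Qed.

Lemma bounded_convergence (f_ : nat -> T -> R) (f : T -> R) (B : R) :
  (forall n, measurable_fun setT (f_ n)) -> (forall n x, `|f_ n x| <= B) ->
  (forall x, f_ n x @[n --> \oo] --> f x) ->
  \int[mu]_x f_ n x @[n --> \oo] --> \int[mu]_x f x.
Proof.
move=> mf fB ff.
have mfl : measurable_fun setT f by apply: measurable_fun_cvg mf _ => x _; exact: ff.
have [|||||intf _ cvf] := @dominated_convergence _ _ _ mu setT measurableT
  (fun n => EFin \o f_ n) (EFin \o f) (EFin \o cst B).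
- by move=> n; exact/measurable_EFinP.
- exact/measurable_EFinP.
- by apply: aeW => x _ /=; apply: cvg_EFin; [exact: nearW | exact: ff].
- by apply: (@integrable_bounded _ `|B|).
- by apply: aeW => x n _ /=; rewrite lee_fin.
rewrite /Rintegral; apply: fine_cvg.
by rewrite fineK //; exact: integrable_fin_num.
Qed.

End finite_mass.

Section signed_rintegral.
Context dZ dX (Z : measurableType dZ) (X : measurableType dX) (R : realType).

Lemma measurable_Rintegral_kernel (K : R.-fker Z ~> X) (k : Z * X -> R) :
  measurable_fun setT k ->
  measurable_fun setT (fun z => \int[K z]_y k (z, y)).
Proof.
move=> mk; rewrite /Rintegral.
have mp : measurable_fun setT (EFin \o k) by exact/measurable_EFinP.
rewrite [X in measurable_fun _ X](_ : _ = fun z =>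
    fine (\int[K z]_y (EFin \o k)^\+ (z, y) - \int[K z]_y (EFin \o k)^\- (z, y))%E).
  apply: (measurableT_comp (fine_measurable measurableT)).
  by apply: emeasurable_funB; apply: measurable_fun_integral_finite_kernel => //;
    [exact: measurable_funepos | exact: measurable_funeneg].
by apply/funext => z; rewrite [X in fine X]integralE; congr (fine (_ - _)%E);
  apply: eq_integral => y _; rewrite ?funeposE ?funenegE.
Qed.

End signed_rintegral.

Section joint_kernel.
Context dX dT (X : measurableType dX) (Theta : measurableType dT) (R : realType).
Variable P : Theta -> R.-pker X ~> X.
Hypothesis P_measurable : forall A : set X, measurable A ->
  measurable_fun [set: X * Theta] (fun z => P z.2 z.1 A).

Section at_parameter.
Context dZ (Z : measurableType dZ) (tau : Z -> Theta) (xi : Z -> X).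

(* The measurability proofs are arguments so that the kernel instances below can be inferred. *)
Definition param_kernel of measurable_fun setT tau & measurable_fun setT xi
  & (forall A : set X, measurable A ->
      measurable_fun [set: X * Theta] (fun z => P z.2 z.1 A)) :=
  fun z => (P (tau z) (xi z) : {measure set X -> \bar R}).

Hypotheses (mtau : measurable_fun setT tau) (mxi : measurable_fun setT xi).

Let K := param_kernel mtau mxi P_measurable.

Let measurable_param_kernel U : measurable U -> measurable_fun [set: Z] (K ^~ U).
Proof.
by move=> mU; exact: (measurableT_comp (P_measurable mU) (measurable_fun_pair mxi mtau)).
Qed.

Let param_kernel_setT z : K z setT = 1%E. Proof. exact: prob_kernel. Qed.

HB.instance Definition _ := isKernel.Build _ _ Z X R
  (param_kernel mtau mxi P_measurable) measurable_param_kernel.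
HB.instance Definition _ := Kernel_isProbability.Build _ _ Z X R
  (param_kernel mtau mxi P_measurable) param_kernel_setT.

Lemma measurable_Rintegral_param (k : Z * X -> R) : measurable_fun setT k ->
  measurable_fun setT (fun z => \int[P (tau z) (xi z)]_y k (z, y)).
Proof.
move=> mk.
exact: (@measurable_Rintegral_kernel _ _ Z X R (param_kernel mtau mxi P_measurable)).
Qed.

End at_parameter.
End joint_kernel.

(** * Disintegration of the chain over the parameter path *)

Section functional_monotone_class.
Context d (W : measurableType d) (R : realType).

Definition bmeasurable (f : W -> R) :=
  measurable_fun setT f /\ exists B : R, forall x, `|f x| <= B.

Lemma bmeasurable_indic (A : set W) : measurable A -> bmeasurable \1_A.
Proof.
move=> mA; split; first exact: measurable_indic.
by exists 1 => x; rewrite indicE; case: (_ \in _); rewrite ?normr1 ?normr0.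
Qed.

Lemma bmeasurable_cst (r : R) : bmeasurable (cst r).
Proof. by split => //; exists `|r|. Qed.

Lemma bmeasurableDZ (f g : W -> R) (a : R) :
  bmeasurable f -> bmeasurable g -> bmeasurable (fun x => f x + a * g x).
Proof.
move=> [mf [B fB]] [mg [C gC]]; split.
  by apply: measurable_funD => //; apply: measurable_funM.
exists (B + `|a| * C) => x; rewrite (le_trans (ler_normD _ _))// lerD//.
by rewrite normrM ler_wpM2l.
Qed.

Variable E : (W -> R) -> R.
Hypothesis E_linear : forall f g a, bmeasurable f -> bmeasurable g ->
  E (fun x => f x + a * g x) = E f + a * E g.
Hypothesis E_cvg : forall (f_ : nat -> W -> R) (f : W -> R) (B : R),
  (forall n, measurable_fun setT (f_ n)) -> (forall n x, `|f_ n x| <= B) ->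
  (forall x, f_ n x @[n --> \oo] --> f x) -> E (f_ n) @[n --> \oo] --> E f.

Let E_cst0 : E (cst 0) = 0.
Proof.
have := E_linear 1 (bmeasurable_cst 0) (bmeasurable_cst 0).
rewrite (_ : (fun _ => _) = cst 0); last by apply/funext => x /=; rewrite mulr0 addr0.
by move=> ?; lra.
Qed.

Lemma functional_sum (I : Type) (s : seq I) (c : I -> R) (g : I -> W -> R) :
  (forall i, bmeasurable (g i)) ->
  bmeasurable (fun x => \sum_(i <- s) c i * g i x) /\
  E (fun x => \sum_(i <- s) c i * g i x) = \sum_(i <- s) c i * E (g i).
Proof.
move=> mg; elim: s => [|i s [IHb IHE]].
  rewrite big_nil (_ : (fun _ => _) = cst 0).
    by split; [exact: bmeasurable_cst|].
  by apply/funext => x; rewrite big_nil.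
rewrite big_cons (_ : (fun _ => _) =
    (fun x => (\sum_(j <- s) c j * g j x) + c i * g i x)).
  by split; [exact: bmeasurableDZ | rewrite E_linear// IHE addrC].
by apply/funext => x; rewrite big_cons addrC.
Qed.

Variable G : set (set W).
Hypotheses (GE : @measurable _ W = <<s G >>) (GI : setI_closed G).
Hypothesis E_cst1 : E (cst 1) = 0.
Hypothesis E_indic : forall A, G A -> E \1_A = 0.

(** [E] will be the difference of two expectations, hence signed: linearity and bounded convergence
    take the place of monotonicity. The sets with [E \1_A = 0] form a Dynkin system: complements by
    linearity and [E 1 = 0], disjoint unions because the partial sums of the indicators stay below
    1. *)
Lemma functional_indic0 (A : set W) : measurable A -> E \1_A = 0.
Proof.
move=> mA; apply: (@dynkin_induction _ W G (fun A => E \1_A = 0)) => //.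
- by rewrite indicT.
- move=> S mS ES; rewrite (_ : \1_(~` S) = (fun x => cst 1 x + (-1) * \1_S x :> R)).
    by rewrite E_linear ?E_cst1 ?ES ?mulr0 ?addr0//;
      [exact: bmeasurable_cst | exact: bmeasurable_indic].
  by apply/funext => x; rewrite !indicE in_setC; case: (x \in S) => /=; ring.
- move=> F mF tF EF.
  pose S n x := \sum_(0 <= k < n) 1 * \1_(F k) x : R.
  have SE n x : (S n x)%:E = (\sum_(0 <= k < n) (\1_(F k) x)%:E)%E.
    by rewrite /S -sumEFin; under eq_bigr do rewrite mul1r.
  have S1 n x : `|S n x| <= 1.
    rewrite ger0_norm; last by apply: sumr_ge0 => k _; rewrite mul1r indicE.
    rewrite -lee_fin SE (@le_trans _ _ (\1_(\bigcup_k F k) x)%:E)//; last first.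
      by rewrite lee_fin indicE; case: (_ \in _).
    rewrite indic_bigcup//.
    by apply: nneseries_lim_ge => k _ _; rewrite lee_fin indicE.
  have cvF : E (S n) @[n --> \oo] --> E \1_(\bigcup_k F k).
    apply: (@E_cvg _ _ 1) => //.
    - move=> n; apply: measurable_sum => k.
      by apply: measurable_funM => //; exact: measurable_indic.
    - move=> x.
      have : (\sum_(0 <= k < n) (\1_(F k) x)%:E)%E @[n --> \oo] -->
          (\1_(\bigcup_k F k) x : R)%:E.
        rewrite indic_bigcup//; apply: is_cvg_nneseries => k _ _.
        by rewrite lee_fin indicE.
      under eq_fun do rewrite -SE.
      by move=> /fine_cvg.
  have : E (S n) @[n --> \oo] --> (0 : R).
    rewrite (_ : (fun n => _) = cst 0); first exact: cvg_cst.
    apply/funext => n /=.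
    have [_ ->] := @functional_sum nat (index_iota 0 n) (fun=> 1) (fun k => \1_(F k))
      (fun k => bmeasurable_indic (mF k)).
    by rewrite big1// => i _; rewrite EF mulr0.
  by move=> cv0; exact: (cvg_unique (@Rhausdorff R) cvF cv0).
- by rewrite -GE.
Qed.

Import HBNNSimple.

(** Adding the bound [B] makes the function nonnegative, hence an increasing limit of simple
    functions, on which [E] vanishes; [E 1 = 0] removes [B] again. *)
Lemma functional_bounded0 (f : W -> R) : bmeasurable f -> E f = 0.
Proof.
move=> [mf [B fB]].
pose g := (EFin \o (fun x => f x + B)).
have mg : measurable_fun setT g by apply/measurable_EFinP; exact: measurable_funD.
have g0 x : (0 <= g x)%E.
  by rewrite lee_fin; have := fB x; rewrite ler_norml => /andP[+ _]; rewrite -lerBlDr sub0r.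
pose h := nnsfun_approx measurableT mg.
have hg x n : h n x <= f x + B.
  by rewrite -lee_fin /h nnsfun_approxE; apply: le_approx.
have Eh n : E (h n) = 0.
  rewrite (_ : (h n : W -> R) = (fun x => \sum_(y <- fset_set (range (h n)))
      y * \1_(h n @^-1` [set y]) x)).
    have [|_ ->] := @functional_sum R (fset_set (range (h n))) id
        (fun y => \1_(h n @^-1` [set y])).
      by move=> y; exact: bmeasurable_indic.
    by rewrite big1// => y _; rewrite functional_indic0 ?mulr0.
  by apply/funext => x; rewrite fimfunE fsbig_finite.
have cvh : E (h n) @[n --> \oo] --> E (fun x => f x + B).
  apply: (@E_cvg _ _ (B + B)).
  - by move=> n; exact: measurable_funP.
  - move=> n x; rewrite ger0_norm// (le_trans (hg x n))// lerD2r.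
    by have := fB x; rewrite ler_norml => /andP[].
  - move=> x. have := @cvg_nnsfun_approx _ _ _ _ measurableT _ mg (fun x _ => g0 x) x Logic.I.
    by move=> /fine_cvg.
have Eh0 : E (fun x => f x + B) = 0.
  apply: (cvg_unique (@Rhausdorff R) cvh).
  by rewrite (_ : (fun n => _) = cst 0); [exact: cvg_cst | apply/funext => n; exact: Eh].
have := E_linear B (conj mf (ex_intro _ B fB)) (bmeasurable_cst 1).
rewrite (_ : (fun x => _) = (fun x => f x + B)); last first.
  by apply/funext => x; rewrite /= mulr1.
by rewrite Eh0 E_cst1 mulr0 addr0.
Qed.

End functional_monotone_class.

Section chain_integral.
Context dX dT (X : measurableType dX) (Theta : measurableType dT) (R : realType).
Variable P : Theta -> R.-pker X ~> X.
Hypothesis P_measurable : forall A : set X, measurable A ->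
  measurable_fun [set: X * Theta] (fun z => P z.2 z.1 A).

(** Parameters and starting point vary with [z] so that the induction closes: after one step the
    state just reached joins the old variable, and the hypothesis is applied on [Z * X]. *)
Lemma measurable_chain_int m dZ (Z : measurableType dZ) (tau : nat -> Z -> Theta)
    (xi : Z -> X) (Phi : Z * m.-tuple X -> R) :
  (forall i, measurable_fun setT (tau i)) -> measurable_fun setT xi ->
  measurable_fun setT Phi ->
  measurable_fun setT (fun z =>
    chain_int P (fun k => tau k z) (xi z) (fun t => Phi (z, t))).
Proof.
elim: m => [|m IH] in dZ Z tau xi Phi *; move=> mtau mxi mPhi /=.
  exact: measurableT_comp.
apply: (measurable_Rintegral_param P_measurable (mtau 0%N) mxi (k := fun w : Z * X =>
  chain_int P (fun k => tau k.+1 w.1) w.2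
    (fun t : m.-tuple X => Phi (w.1, [tuple of w.2 :: t])))).
apply: (IH _ (Z * X)%type (fun k w => tau k.+1 w.1) snd
  (fun u => Phi (u.1.1, [tuple of u.1.2 :: u.2]))) => //.
- by move=> i; exact: measurableT_comp.
- apply: measurableT_comp => //; apply: measurable_fun_pair.
    exact: measurableT_comp.
  apply: measurable_cons => //; exact: measurableT_comp.
Qed.

Lemma measurable_chain_int_cons m (th : nat -> Theta) (h : m.+1.-tuple X -> R) :
  measurable_fun setT h ->
  measurable_fun setT (fun y => chain_int P th y (fun t : m.-tuple X => h [tuple of y :: t])).
Proof.
move=> mh.
apply: (measurable_chain_int (tau := fun k _ => th k) (xi := id)
  (Phi := fun w => h [tuple of w.1 :: w.2])) => //.
apply: measurableT_comp => //; apply: measurable_cons => //.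
Qed.

Lemma measurable_tuple_cons m (y : X) (h : m.+1.-tuple X -> R) :
  measurable_fun setT h -> measurable_fun setT (fun t : m.-tuple X => h [tuple of y :: t]).
Proof.
by move=> mh; apply: measurableT_comp => //; apply: measurable_cons.
Qed.

Lemma chain_int_bound m th x (h : m.-tuple X -> R) (B : R) :
  measurable_fun setT h -> (forall t, `|h t| <= B) -> `|chain_int P th x h| <= B.
Proof.
elim: m => [|m IH] in th x h *; move=> mh hB //=.
have hb y : `|chain_int P (fun k => th k.+1) y (fun t : m.-tuple X => h [tuple of y :: t])| <= B.
  by apply: IH => //; exact: measurable_tuple_cons.
apply: Rintegral_bound => //; first exact: prob_kernel.
apply: (integrable_bounded (prob_kernel x)) => //.
exact: measurable_chain_int_cons.
Qed.

Lemma chain_int_linear m th x (f g : m.-tuple X -> R) (a : R) :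
  bmeasurable f -> bmeasurable g ->
  chain_int P th x (fun t => f t + a * g t) = chain_int P th x f + a * chain_int P th x g.
Proof.
elim: m => [|m IH] in th x f g *; move=> [mf [B fB]] [mg [C gC]] //=.
under eq_Rintegral => y _.
  rewrite IH; last 2 first.
  - by split; [exact: measurable_tuple_cons | exists B].
  - by split; [exact: measurable_tuple_cons | exists C].
  over.
have intC (h : m.+1.-tuple X -> R) D : measurable_fun setT h -> (forall t, `|h t| <= D) ->
    (P (th 0%N) x).-integrable setT (EFin \o (fun y => chain_int P (fun k => th k.+1) y
       (fun t : m.-tuple X => h [tuple of y :: t]))).
  move=> mh hD; apply: (integrable_bounded (prob_kernel x)) => //.
    exact: measurable_chain_int_cons.
  by move=> y; apply: chain_int_bound; [exact: measurable_tuple_cons | move=> t; exact: hD].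
have intf := intC _ _ mf fB; have intg := intC _ _ mg gC.
rewrite RintegralD// ?RintegralZl//.
by apply: eq_integrable (integrableZl measurableT a intg).
Qed.

Lemma chain_int_cst m th x (r : R) : chain_int P th x (fun=> r : R) (n := m) = r.
Proof.
elim: m => [|m IH] //= in th x *.
under eq_Rintegral => y _ do rewrite IH.
by apply: Rintegral_cst1; exact: prob_kernel.
Qed.

Lemma chain_int_cvg m th x (f_ : nat -> m.-tuple X -> R) (f : m.-tuple X -> R) (B : R) :
  (forall n, measurable_fun setT (f_ n)) -> (forall n t, `|f_ n t| <= B) ->
  (forall t, f_ n t @[n --> \oo] --> f t) ->
  chain_int P th x (f_ n) @[n --> \oo] --> chain_int P th x f.
Proof.
elim: m => [|m IH] in th x f_ f *; move=> mf fB ff /=; first exact: ff.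
apply: (@bounded_convergence _ _ _ (P (th 0%N) x) (prob_kernel x) _ _ B).
- by move=> n; exact: measurable_chain_int_cons.
- by move=> n y; apply: chain_int_bound => //; exact: measurable_tuple_cons.
- move=> y; apply: IH => // n; exact: measurable_tuple_cons.
Qed.

End chain_integral.

Lemma bounded_fun_ex (T : Type) (R : realType) (f : T -> R) :
  (exists B : R, forall x, `|f x| <= B) <-> bounded_fun f.
Proof.
split=> [[B fB]|[M [_ fM]]]; last first.
  by exists (M + 1) => x; apply: (fM (M + 1)) => //; rewrite ltrDl.
exists B; split; first exact: num_real.
by move=> M BM x _ /=; rewrite (le_trans (fB x))// ltW.
Qed.

Section path_integral.
Context dX dT dZ (X : measurableType dX) (Theta : measurableType dT)
  (Z : measurableType dZ) (R : realType).
Variables (P : Theta -> R.-pker X ~> X) (nu : probability X R).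
Hypothesis P_measurable : forall A : set X, measurable A ->
  measurable_fun [set: X * Theta] (fun z => P z.2 z.1 A).

Lemma measurable_path_int n (tau : nat -> Z -> Theta) (Phi : Z * n.+1.-tuple X -> R) :
  (forall i, measurable_fun setT (tau i)) -> measurable_fun setT Phi ->
  measurable_fun setT (fun z => path_int P nu (fun k => tau k z) (fun t => Phi (z, t))).
Proof.
move=> mtau mPhi; rewrite /path_int.
apply: (@measurable_Rintegral_kernel _ _ _ _ _
  (kprobability (@measurable_cst _ _ Z _ setT (nu : pprobability X R)))
  (fun w : Z * X => chain_int P (fun k => tau k w.1) w.2
    (fun t : n.-tuple X => Phi (w.1, [tuple of w.2 :: t])))).
apply: (measurable_chain_int P_measurable (Z := (Z * X)%type)
  (tau := fun k w => tau k w.1) (xi := snd)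
  (Phi := fun u => Phi (u.1.1, [tuple of u.1.2 :: u.2]))) => //.
- by move=> i; exact: measurableT_comp.
- apply: measurableT_comp => //; apply: measurable_fun_pair.
    exact: measurableT_comp.
  by apply: measurable_cons => //; exact: measurableT_comp.
Qed.

Lemma integrable_path_step n (th : nat -> Theta) (h : n.+1.-tuple X -> R) : bmeasurable h ->
  nu.-integrable setT (EFin \o (fun x => chain_int P th x
    (fun t : n.-tuple X => h [tuple of x :: t]))).
Proof.
move=> [mh [B hB]]; apply: (integrable_bounded (probability_setT _) (B := B)).
  exact: measurable_chain_int_cons.
move=> x; apply: chain_int_bound => //; exact: measurable_tuple_cons.
Qed.

Lemma path_int_bound n (th : nat -> Theta) (h : n.+1.-tuple X -> R) (B : R) :
  measurable_fun setT h -> (forall t, `|h t| <= B) -> `|path_int P nu th h| <= B.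
Proof.
move=> mh hB; apply: Rintegral_bound; first exact: probability_setT.
  by apply: integrable_path_step; split => //; exists B.
by move=> x; apply: chain_int_bound => //; exact: measurable_tuple_cons.
Qed.

Lemma path_int_linear n th (f g : n.+1.-tuple X -> R) (a : R) :
  bmeasurable f -> bmeasurable g ->
  path_int P nu th (fun t => f t + a * g t) = path_int P nu th f + a * path_int P nu th g.
Proof.
move=> bf bg; have := bf => -[mf [B fB]]; have := bg => -[mg [C gC]].
rewrite /path_int.
under eq_Rintegral => x _.
  rewrite (chain_int_linear P_measurable); last 2 first.
  - by split; [exact: measurable_tuple_cons | exists B].
  - by split; [exact: measurable_tuple_cons | exists C].
  over.
have intf := integrable_path_step th bf; have intg := integrable_path_step th bg.
rewrite RintegralD// ?RintegralZl//.
by apply: eq_integrable (integrableZl measurableT a intg).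
Qed.

Lemma path_int_cst n th (r : R) : path_int P nu th (fun=> r : R) (n := n) = r.
Proof.
rewrite /path_int; under eq_Rintegral => x _ do rewrite chain_int_cst.
by apply: Rintegral_cst1; exact: probability_setT.
Qed.

Lemma path_int_cvg n th (f_ : nat -> n.+1.-tuple X -> R) (f : n.+1.-tuple X -> R) (B : R) :
  (forall k, measurable_fun setT (f_ k)) -> (forall k t, `|f_ k t| <= B) ->
  (forall t, f_ k t @[k --> \oo] --> f t) ->
  path_int P nu th (f_ k) @[k --> \oo] --> path_int P nu th f.
Proof.
move=> mf fB ff; apply: (bounded_convergence (probability_setT nu) (B := B)).
- by move=> k; exact: measurable_chain_int_cons.
- by move=> k y; apply: chain_int_bound => //; exact: measurable_tuple_cons.
- by move=> y; apply: (chain_int_cvg P_measurable (B := B)) => // k;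
    exact: measurable_tuple_cons.
Qed.

End path_integral.

Section disintegration.
Context dX dT dO (X : measurableType dX) (Theta : measurableType dT)
  (Omega : measurableType dO) (R : realType) (Pr : probability Omega R).
Variables (P : Theta -> R.-pker X ~> X) (nu : probability X R).
Hypothesis P_measurable : forall A : set X, measurable A ->
  measurable_fun [set: X * Theta] (fun z => P z.2 z.1 A).
Variables (Xn : nat -> {RV Pr >-> X}) (th : nat -> {RV Pr >-> Theta}).
Hypothesis A5 : forall (n : nat) (h : n.+1.-tuple X -> R),
  measurable_fun setT h -> bounded_fun h ->
  is_cond_expectation Pr (g_sigma_preimage (fun i : 'I_n.+1 => th i))
    (fun w => h [tuple Xn i w | i < n.+1])
    (fun w => path_int P nu (fun k => th k w) h).

Definition tupleRV d (T : measurableType d) (Y : nat -> {RV Pr >-> T}) n (w : Omega) :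
  n.+1.-tuple T := [tuple Y i w | i < n.+1].

Lemma measurable_tupleRV d (T : measurableType d) (Y : nat -> {RV Pr >-> T}) n :
  measurable_fun setT (tupleRV Y n).
Proof.
apply/measurable_fun_tnthP => i.
rewrite (_ : _ \o _ = Y i); first exact: measurable_funP.
by apply/funext => w /=; rewrite tnth_mktuple.
Qed.

Lemma g_sigma_preimage_tupleRV n (A : set (n.+1.-tuple Theta)) : measurable A ->
  g_sigma_preimage (fun i : 'I_n.+1 => th i : Omega -> Theta) (tupleRV th n @^-1` A).
Proof.
move=> mA; rewrite (_ : (fun i : 'I_n.+1 => _) =
    (fun i : 'I_n.+1 => (fun t : n.+1.-tuple Theta => tnth t i) \o tupleRV th n)).
  by rewrite g_sigma_preimage_comp; exists A => //; rewrite setTI.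
by apply/funext => i; apply/funext => w /=; rewrite tnth_mktuple.
Qed.

(** (A5) concerns functions of the chain alone. For the indicator of a rectangle, integrating (A5)
    over the event that the parameters lie in the first side gives the identity; the monotone class
    argument carries it to joint functions, the parameters being frozen inside the path integral. *)
Lemma disintegration n (Phi : n.+1.-tuple Theta * n.+1.-tuple X -> R) : bmeasurable Phi ->
  \int[Pr]_w Phi (tupleRV th n w, tupleRV Xn n w) =
  \int[Pr]_w path_int P nu (fun k => th k w) (fun t => Phi (tupleRV th n w, t)).
Proof.
pose E1 (Phi : n.+1.-tuple Theta * n.+1.-tuple X -> R) :=
  \int[Pr]_w Phi (tupleRV th n w, tupleRV Xn n w).
pose E2 (Phi : n.+1.-tuple Theta * n.+1.-tuple X -> R) :=
  \int[Pr]_w path_int P nu (fun k => th k w) (fun t => Phi (tupleRV th n w, t)).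
have mT := @measurable_tupleRV _ _ th n; have mX := @measurable_tupleRV _ _ Xn n.
have m1 (f : n.+1.-tuple Theta * n.+1.-tuple X -> R) : measurable_fun setT f ->
    measurable_fun setT (fun w => f (tupleRV th n w, tupleRV Xn n w) : R).
  by move=> mf; apply: measurableT_comp => //; exact: measurable_fun_pair.
have m2 (f : n.+1.-tuple Theta * n.+1.-tuple X -> R) : measurable_fun setT f -> measurable_fun setT (fun w =>
    path_int P nu (fun k => th k w) (fun t => f (tupleRV th n w, t)) : R).
  move=> mf; apply: (measurable_path_int nu P_measurable (tau := fun k w => th k w)
    (Phi := fun u => f (tupleRV th n u.1, u.2))) => //.
  apply: measurableT_comp => //; apply: measurable_fun_pair => //.
  exact: measurableT_comp.
have msec (f : n.+1.-tuple Theta * n.+1.-tuple X -> R) t :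
    measurable_fun setT f -> measurable_fun setT (fun u => f (t, u)).
  by move=> mf; apply: measurableT_comp => //; exact: measurable_fun_pair.
have i1 (f : n.+1.-tuple Theta * n.+1.-tuple X -> R) : bmeasurable f -> Pr.-integrable setT
    (EFin \o (fun w => f (tupleRV th n w, tupleRV Xn n w))).
  move=> [mf [B fB]]; apply: (integrable_bounded (probability_setT _) (B := B)) => //.
  exact: m1.
have i2 (f : n.+1.-tuple Theta * n.+1.-tuple X -> R) : bmeasurable f -> Pr.-integrable setT (EFin \o (fun w =>
    path_int P nu (fun k => th k w) (fun t => f (tupleRV th n w, t)))).
  move=> [mf [B fB]]; apply: (integrable_bounded (probability_setT _) (B := B)) => //.
    exact: m2.
  by move=> w; apply: (path_int_bound nu P_measurable) => //; exact: (msec f _ mf).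
pose E Phi := E1 Phi - E2 Phi.
suff E0 : forall Phi, bmeasurable Phi -> E Phi = 0.
  by move=> /E0 /eqP; rewrite subr_eq0 => /eqP.
apply: (@functional_bounded0 _ _ _ E _ _ [set A `*` B | A in measurable & B in measurable]).
- move=> f g a bf bg; rewrite /E.
  have -> : E1 (fun x => f x + a * g x) = E1 f + a * E1 g.
    rewrite /E1 RintegralD//; last 2 first.
    - exact: i1.
    - by apply: eq_integrable (integrableZl measurableT a (i1 _ bg)).
    by rewrite RintegralZl//; exact: i1.
  have -> : E2 (fun x => f x + a * g x) = E2 f + a * E2 g.
    rewrite /E2; under eq_Rintegral => w _.
      rewrite (path_int_linear nu P_measurable); last 2 first.
      - by case: bf => mf [B fB]; split; [exact: msec|exists B].
      - by case: bg => mg [B gB]; split; [exact: msec|exists B].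
      over.
    rewrite RintegralD//; last 2 first.
    - exact: i2.
    - by apply: eq_integrable (integrableZl measurableT a (i2 _ bg)).
    by rewrite RintegralZl//; exact: i2.
  by ring.
- move=> f_ f B mf fB ff; apply: cvgB.
    apply: (bounded_convergence (probability_setT Pr) (B := B));
      [by move=> k; exact: m1 | by move=> k w; exact: fB | by move=> w; exact: ff].
  apply: (bounded_convergence (probability_setT Pr) (B := B)) => //.
  - by move=> k; exact: m2.
  - by move=> k w; apply: (path_int_bound nu P_measurable) => //; exact: (msec (f_ k) _ (mf k)).
  - move=> w.
    have := (@path_int_cvg _ _ _ _ _ _ nu P_measurable _ (fun k => th k w)
      (fun k t => f_ k (tupleRV th n w, t))
      (fun t => f (tupleRV th n w, t)) B).
    by apply => //; move=> k; exact: (msec (f_ k) _ (mf k)).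
- exact: measurable_prod_measurableType.
- move=> _ _ [A1 mA1 [B1 mB1 <-]] [A2 mA2 [B2 mB2 <-]].
  exists (A1 `&` A2); first exact: measurableI.
  exists (B1 `&` B2); first exact: measurableI.
  by rewrite setXI.
- rewrite /E; have -> : E1 (cst 1) = 1 by exact: (Rintegral_cst1 (probability_setT Pr)).
  have -> : E2 (cst 1) = 1.
    rewrite /E2 -[RHS](Rintegral_cst1 (probability_setT Pr)).
    by apply: eq_Rintegral => w _; exact: path_int_cst.
  by rewrite subrr.
- move=> _ [A mA [B mB <-]].
  have bB : bmeasurable (\1_B : _ -> R) by exact: bmeasurable_indic.
  have bdB : bounded_fun (\1_B : n.+1.-tuple X -> R).
    by case: bB => _ BD; apply/bounded_fun_ex.
  have mI : measurable_fun setT (\1_B : n.+1.-tuple X -> R) by exact: measurable_indic.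
  have [_ _ /(_ _ (g_sigma_preimage_tupleRV mA)) condE] := A5 mI bdB.
  have indE (D : set Omega) (g : Omega -> R) :
      \int[Pr]_(w in D) g w = \int[Pr]_w (\1_D w * g w).
    rewrite Rintegral_mkcond; apply: eq_Rintegral => w _.
    by rewrite patchE indicE; case: (_ \in _); rewrite ?mul1r ?mul0r.
  pose D := tupleRV th n @^-1` A.
  have DE w : (w \in D) = (tupleRV th n w \in A) by apply/idP/idP => /set_mem ?; apply/mem_set.
  have {}condE : \int[Pr]_(w in D) (\1_B (tupleRV Xn n w) : R) =
    \int[Pr]_(w in D) path_int P nu (fun k => th k w) \1_B := congr1 fine condE.
  rewrite (indE D (fun w => \1_B (tupleRV Xn n w))) in condE.
  rewrite (indE D (fun w => path_int P nu (fun k => th k w) \1_B)) in condE.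
  apply/eqP; rewrite subr_eq0; apply/eqP.
  rewrite /E1 /E2; etransitivity; last first.
    etransitivity; first exact: condE.
    apply: eq_Rintegral => w _.
    (* Linearity with zero as first function: the indicator of the parameter event, a constant for
       fixed [w], moves inside the path integral. *)
    have := path_int_linear nu P_measurable (fun k => th k w)
      (\1_(tupleRV th n @^-1` A) w) (bmeasurable_cst _ 0) bB.
    rewrite path_int_cst add0r => <-; congr (path_int _ _ _ _).
    apply/funext => t /=; rewrite add0r !indicE in_setX DE /=.
    by case: (_ \in A); case: (_ \in B); rewrite /= ?mulr1 ?mulr0 ?mul0r.
  apply: eq_Rintegral => w _; rewrite !indicE in_setX DE /=.
  by case: (_ \in A); case: (_ \in B); rewrite /= ?mulr1 ?mulr0 ?mul0r.
Qed.

End disintegration.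

(** * Gaussian integrals and the heat semigroup *)

Section normal_integral.
Context {R : realType}.
Notation mu := (@lebesgue_measure R).
Local Open Scope ereal_scope.
Import HBNNSimple.

Let integral_normal_indic (m s : R) (E : set (measurableTypeR R)) : measurable E ->
  \int[normal_prob m s]_x (\1_E x)%:E = \int[mu]_x ((\1_E x)%:E * (normal_pdf m s x)%:E).
Proof.
move=> mE; rewrite integral_indic//= setIT /normal_prob integral_mkcond.
apply: eq_integral => x _; rewrite patchE indicE.
by case: ifPn => _; rewrite ?mul1e ?mul0e.
Qed.

Let integral_normal_nnsfun (m s : R) (f : {nnsfun measurableTypeR R >-> R}) :
  \int[normal_prob m s]_x (f x)%:E = \int[mu]_x ((f x)%:E * (normal_pdf m s x)%:E).
Proof.
have mpdf : measurable_fun setT (EFin \o normal_pdf m s).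
  by apply/measurable_EFinP; exact: measurable_normal_pdf.
under [LHS]eq_integral do rewrite fimfunE -fsumEFin//.
rewrite [LHS]ge0_integral_fsum//; last 2 first.
  - by move=> r; exact/measurable_EFinP/measurableT_comp.
  - by move=> n x _; rewrite EFinM nnfun_muleindic_ge0.
under [RHS]eq_integral.
  move=> x xD; rewrite fimfunE -fsumEFin// muleC ge0_mule_fsumr; last first.
    by move=> r; rewrite EFinM nnfun_muleindic_ge0.
  over.
rewrite [RHS]ge0_integral_fsum//; last 2 first.
  - move=> r; apply: emeasurable_funM => //.
    by apply/measurable_EFinP; apply/measurableT_comp => //.
  - move=> n x _; apply: mule_ge0; first by rewrite lee_fin normal_pdf_ge0.
    by rewrite EFinM nnfun_muleindic_ge0.
apply: eq_fsbigr => r _.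
have [r0|r0] := leP 0%R r; last first.
  by rewrite !integral0_eq// => x _; rewrite preimage_nnfun0// indic0 mulr0 ?mule0.
have mI : measurable_fun setT (fun x => (\1_(f @^-1` [set r]) x : R)%:E).
  by apply/measurable_EFinP; exact: measurable_indic.
transitivity (r%:E * \int[normal_prob m s]_x (\1_(f @^-1` [set r]) x)%:E).
  under eq_integral do rewrite EFinM.
  by apply: ge0_integralZl => // t _; rewrite lee_fin.
rewrite integral_normal_indic// -ge0_integralZl//.
- by apply: eq_integral => x _; rewrite [RHS]muleC EFinM -muleA.
- exact: emeasurable_funM.
- by move=> x _; rewrite mule_ge0// lee_fin ?normal_pdf_ge0.
Qed.

(** [normal_prob] is given on sets, as the integral of the density; the identity passes from
    indicators to simple functions and to their increasing limits. *)
Lemma ge0_integral_normal_prob (m s : R) (f : measurableTypeR R -> \bar R) : measurable_fun setT f ->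
  (forall x, 0 <= f x) ->
  \int[normal_prob m s]_x f x = \int[mu]_x (f x * (normal_pdf m s x)%:E).
Proof.
move=> mf f0.
have mpdf : measurable_fun setT (EFin \o normal_pdf m s).
  by apply/measurable_EFinP; exact: measurable_normal_pdf.
pose f_ := nnsfun_approx measurableT mf.
have cf x : (f_ n x)%:E @[n --> \oo] --> f x by exact: cvg_nnsfun_approx.
transitivity (lim (\int[normal_prob m s]_x (f_ n x)%:E @[n --> \oo])).
  rewrite -monotone_convergence//=.
  - by apply: eq_integral => x _; apply/esym/cvg_lim => //.
  - by move=> n; exact/measurable_EFinP/measurable_funTS.
  - by move=> n ? _; rewrite lee_fin.
  - by move=> ? _ ? ? mn; rewrite lee_fin; exact/lefP/nd_nnsfun_approx.
under [X in lim (X @ _)]funext => n do rewrite integral_normal_nnsfun.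
rewrite -monotone_convergence//=.
- apply: eq_integral => x _; apply/cvg_lim => //.
  by apply: cvgeZr.
- move=> n; apply: emeasurable_funM => //; exact/measurable_EFinP/measurable_funTS.
- by move=> n x _; rewrite mule_ge0// lee_fin ?normal_pdf_ge0.
- move=> x _ a b ab; rewrite lee_wpmul2r// lee_fin ?normal_pdf_ge0//.
  exact/lefP/nd_nnsfun_approx.
Qed.

End normal_integral.

Section normal_convolution.
Context {R : realType}.
Notation mu := (@lebesgue_measure R).

(** Bayes' formula for a Gaussian pair, by completing the square: if [y] has variance u^2 and
    [w - y] is independent of variance v^2, the joint density is also the marginal of [w] times the
    conditional density of [y] given [w], of mean w u^2 / (u^2 + v^2) and variance u^2 v^2 / (u^2 +
    v^2). *)
Lemma normal_pdfM (u v y w : R) : 0 < u -> 0 < v ->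
  normal_pdf 0 u y * normal_pdf y v w =
  normal_pdf 0 (Num.sqrt (u ^+ 2 + v ^+ 2)) w *
  normal_pdf (w * u ^+ 2 / (u ^+ 2 + v ^+ 2)) (u * v / Num.sqrt (u ^+ 2 + v ^+ 2)) y.
Proof.
move=> u0 v0; set s := Num.sqrt _.
have s2 : s ^+ 2 = u ^+ 2 + v ^+ 2 by rewrite sqr_sqrtr// addr_ge0// sqr_ge0.
have s0 : 0 < s by rewrite sqrtr_gt0 addr_gt0// exprn_gt0.
have un0 := lt0r_neq0 u0; have vn0 := lt0r_neq0 v0; have sn0 := lt0r_neq0 s0.
have uvs0 : u * v / s != 0 by rewrite !mulf_neq0// invr_neq0.
rewrite !normal_pdfE// /normal_peak /normal_fun.
rewrite [LHS]mulrACA [RHS]mulrACA -!expRD -!invfM -!sqrtrM; last 2 first.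
- by rewrite mulrn_wge0// mulr_ge0 ?sqr_ge0 ?pi_ge0.
- by rewrite mulrn_wge0// mulr_ge0 ?sqr_ge0 ?pi_ge0.
rewrite -s2; congr ((Num.sqrt _)^-1 * expR _).
  by field.
have -> : (u * v / s) ^+ 2 = u ^+ 2 * v ^+ 2 / s ^+ 2 by rewrite !exprMn exprVn.
have uv0 : u ^+ 2 + v ^+ 2 != 0 by rewrite -s2 expf_neq0.
by rewrite s2; field; rewrite ?un0 ?vn0 ?uv0.
Qed.

Lemma measurable_normal_pdf2 (v : R) : v != 0 ->
  measurable_fun setT (fun z : measurableTypeR R * measurableTypeR R => normal_pdf z.1 v z.2).
Proof.
move=> v0; under eq_fun do rewrite normal_pdfE//.
apply: measurable_funM => //; apply: measurableT_comp => //.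
apply: measurable_funM => //; apply: measurableT_comp => //.
by apply: measurable_funX; apply: measurable_funB.
Qed.

(** Tonelli lets [y] be integrated first, and by [normal_pdfM] the conditional density of [y] given
    [w] has mass one. *)
Lemma ge0_normal_convolution (u v : R) (g : measurableTypeR R -> R) : 0 < u -> 0 < v ->
  measurable_fun setT g -> (forall x, 0 <= g x) ->
  (\int[normal_prob 0 u]_y \int[normal_prob y v]_w (g w)%:E =
   \int[normal_prob 0 (Num.sqrt (u ^+ 2 + v ^+ 2))]_w (g w)%:E)%E.
Proof.
move=> u0 v0 mg g0.
have mgE : measurable_fun setT (EFin \o g) by exact/measurable_EFinP.
have g0E x : (0 <= (EFin \o g) x)%E by rewrite lee_fin.
rewrite (ge0_integral_normal_prob _ _ mgE g0E).
under eq_integral do rewrite (ge0_integral_normal_prob _ _ mgE g0E).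
pose k (z : measurableTypeR R * measurableTypeR R) :=
  (g z.2 * normal_pdf z.1 v z.2 * normal_pdf 0 u z.1)%:E.
have mk1 : measurable_fun setT (fun z : measurableTypeR R * measurableTypeR R =>
    g z.2 * normal_pdf z.1 v z.2).
  apply: measurable_funM; first exact: measurableT_comp.
  by apply: measurable_normal_pdf2; rewrite gt_eqF.
have mk : measurable_fun setT k.
  apply/measurable_EFinP; apply: measurable_funM => //.
  by apply: measurableT_comp => //; exact: measurable_normal_pdf.
have k0 z : (0 <= k z)%E by rewrite lee_fin !mulr_ge0// normal_pdf_ge0.
rewrite ge0_integral_normal_prob; last 2 first.
- have := @measurable_fun_fubini_tonelli_F _ _ _ _ _ mu
    (fun z : measurableTypeR R * measurableTypeR R => (g z.2 * normal_pdf z.1 v z.2)%:E).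
  apply; first exact/measurable_EFinP.
  by move=> z; rewrite lee_fin mulr_ge0// normal_pdf_ge0.
- by move=> x; apply: integral_ge0 => y _; apply: mule_ge0; rewrite lee_fin ?normal_pdf_ge0.
transitivity (\int[mu]_y \int[mu]_w k (y, w))%E.
  apply: eq_integral => y _; rewrite -ge0_integralZr//.
  - apply: emeasurable_funM => //; apply/measurable_EFinP; exact: measurable_normal_pdf.
  - by move=> w _; apply: mule_ge0; rewrite lee_fin ?normal_pdf_ge0.
  - by rewrite lee_fin normal_pdf_ge0.
rewrite fubini_tonelli//; apply: eq_integral => w _.
transitivity (\int[mu]_y (((g w)%:E * (normal_pdf 0 (Num.sqrt (u ^+ 2 + v ^+ 2)) w)%:E) *
   (normal_pdf (w * u ^+ 2 / (u ^+ 2 + v ^+ 2)) (u * v / Num.sqrt (u ^+ 2 + v ^+ 2)) y)%:E))%E.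
  by apply: eq_integral => y _; rewrite /k/= -!EFinM -mulrA (mulrC (normal_pdf y v w))
    normal_pdfM// mulrA.
rewrite ge0_integralZl//; last 3 first.
- apply/measurable_EFinP; exact: measurable_normal_pdf.
- by move=> y _; rewrite lee_fin normal_pdf_ge0.
- by apply: mule_ge0; rewrite lee_fin ?normal_pdf_ge0.
by rewrite integral_normal_pdf mule1.
Qed.

Lemma ge0_normal_affine (m s : R) (g : R -> R) : 0 < s -> continuous g ->
  (forall x, 0 <= g x) ->
  (\int[normal_prob 0 1]_z (g (m + s * z)%R)%:E = \int[normal_prob m s]_w (g w)%:E)%E.
Proof.
move=> s0 cg g0; have mg := continuous_measurable_fun cg.
have mgE : measurable_fun setT (EFin \o g) by exact/measurable_EFinP.
rewrite (ge0_integral_normal_prob _ _ mgE) => [|x]; last by rewrite lee_fin.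
pose F (z : R) : R := m + s * z.
have dF (z : R) : is_derive z 1 F s.
  by apply: is_derive_eq; rewrite add0r mul1r; exact: mulr1.
have F'E : F^`()%classic = cst s.
  by apply/funext => z; rewrite derive1E (@derive_val _ _ _ _ _ _ _ (dF z)).
have cF : continuous F.
  by move=> z; apply: differentiable_continuous; apply/derivable1_diffP; exact: (@ex_derive _ _ _ _ _ _ _ (dF z)).
rewrite ge0_integral_normal_prob => [||z]; last 2 first.
- apply/measurable_EFinP; apply: (measurableT_comp mg) => //.
  exact: continuous_measurable_fun.
- by rewrite lee_fin.
under [RHS]eq_integral do rewrite -EFinM.
rewrite [RHS](@increasing_ge0_integration_by_substitutionT _ F); first last.
- by move=> x; rewrite mulr_ge0// normal_pdf_ge0.
- by move=> x; apply: cvgM; [exact: cg | apply: continuous_normal_pdf; rewrite gt_eqF].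
- apply: (@cvg_comp _ _ _ (fun z => s * z) (fun r => m + r) _ +oo%R +oo%R); last exact: cvg_addrl.
  by apply: (gt0_cvgMry s0); exact: cvg_id.
- apply: (@cvg_comp _ _ _ (fun z => s * z) (fun r => m + r) _ -oo%R -oo%R); last exact: cvg_addrl_Ny.
  by apply: (gt0_cvgMrNy s0); exact: cvg_id.
- by move=> z; exact: (@ex_derive _ _ _ _ _ _ _ (dF z)).
- by rewrite F'E; exact: is_cvg_cst.
- by rewrite F'E; exact: is_cvg_cst.
- by rewrite F'E => ?; exact: cvg_cst.
- by move=> x y xy; rewrite /F ltrD2l ltr_pM2l.
apply: eq_integral => z _; rewrite -EFinM F'E /= -mulrA; congr (_ * _)%:E.
rewrite !normal_pdfE ?gt_eqF// /normal_peak /normal_fun expr1n mul1r.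
have -> : Num.sqrt (s ^+ 2 * pi *+ 2) = s * Num.sqrt (pi *+ 2).
  by rewrite -mulrnAr sqrtrM ?sqr_ge0// sqrtr_sqr gtr0_norm.
transitivity ((s * Num.sqrt (pi *+ 2))^-1 * expR (- (F z - m) ^+ 2 / (s ^+ 2 *+ 2)) * s) => //.
have -> : - (F z - m) ^+ 2 / (s ^+ 2 *+ 2) = - (z - 0) ^+ 2 / (1 *+ 2).
  by rewrite /F; field; rewrite gt_eqF.
by rewrite invfM; field; rewrite !gt_eqF// sqrtr_gt0 mulrn_wgt0// pi_gt0.
Qed.

End normal_convolution.

Section normal_expectation.
Context {R : realType}.
Notation mu := (@lebesgue_measure R).
Local Notation N01 := (normal_prob (0 : R) 1).

Lemma normal_prob_setT (m s : R) : normal_prob m s setT = 1%E.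
Proof. exact: probability_setT. Qed.

Lemma integral_normal_prob (m s : R) (f : measurableTypeR R -> R) : measurable_fun setT f ->
  (\int[normal_prob m s]_x (f x)%:E = \int[mu]_x (f x * normal_pdf m s x)%:E)%E.
Proof.
move=> mf; have mfE : measurable_fun setT (EFin \o f) by exact/measurable_EFinP.
rewrite [LHS]integralE [RHS]integralE; congr (_ - _)%E.
- rewrite ge0_integral_normal_prob//; last exact: measurable_funepos.
  apply: eq_integral => x _; rewrite !funeposE -EFin_max -EFinM -EFin_max; congr EFin.
  by rewrite maxr_pMl ?normal_pdf_ge0// mul0r.
- rewrite ge0_integral_normal_prob//; last exact: measurable_funeneg.
  apply: eq_integral => x _; rewrite !funenegE -!EFinN -EFin_max -EFinM -EFin_max; congr EFin.
  by rewrite maxr_pMl ?normal_pdf_ge0// mul0r mulNr.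
Qed.

(** Transfers identities known for nonnegative functions to bounded ones: they are applied to
    [g + B], and [B] cancels because the measures have mass one. *)
Lemma Rintegral_normal_shift d (T : measurableType d) (m : {measure set T -> \bar R})
    (g : T -> R) (B : R) :
  m setT = 1%E -> measurable_fun setT g -> (forall x, `|g x| <= B) ->
  (\int[m]_x (g x + B)%:E = (\int[m]_x g x + B)%:E)%E.
Proof.
move=> m1 mg gB; have ig := integrable_bounded m1 mg gB.
have iB : m.-integrable setT (EFin \o (cst B)) by apply: (integrable_bounded m1 (B := `|B|)).
under eq_integral do rewrite EFinD.
rewrite integralD//= integral_cst// m1 mule1 EFinD fineK//.
exact: integrable_fin_num.
Qed.

Lemma Rintegral_normal_affine (m s : R) (g : R -> R) (B : R) : 0 < s -> continuous g ->
  (forall x, `|g x| <= B) ->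
  \int[N01]_z g (m + s * z) = \int[normal_prob m s]_w g w.
Proof.
move=> s0 cg gB.
have g0 x : 0 <= g x + B.
  by have := gB x; rewrite ler_norml => /andP[+ _]; rewrite -lerBlDr sub0r.
have cgB : continuous (fun x => g x + B) by move=> x; apply: cvgD; [exact: cg|exact: cvg_cst].
have mg : measurable_fun (setT : set (measurableTypeR R)) g by exact: continuous_measurable_fun.
have maff : measurable_fun (setT : set (measurableTypeR R)) (fun z => g (m + s * z)).
  by apply: (measurableT_comp mg); apply: measurable_funD => //; exact: measurable_funM.
have h1 := Rintegral_normal_shift (normal_prob_setT 0 1) maff (fun z => gB (m + s * z)).
have h2 := Rintegral_normal_shift (normal_prob_setT m s) mg gB.
have h3 := etrans (esym h1) (ge0_normal_affine m s0 cgB g0).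
have h4 := EFin_inj (etrans h3 h2).
exact: (addIr B h4).
Qed.

Lemma integrable_expR_normal (t : R) : N01.-integrable setT (EFin \o (fun z => expR (t * z))).
Proof.
have me : measurable_fun (setT : set (measurableTypeR R)) (fun z => expR (t * z)).
  by apply: measurableT_comp => //; exact: measurable_funM.
apply/integrableP; split; first exact/measurable_EFinP.
under eq_integral do rewrite /= ger0_norm ?expR_ge0//.
rewrite integral_normal_prob//.
(* Completing the square: e^(t x) times the standard density is e^(t^2 / 2) times the density
   centred at [t]. *)
rewrite (_ : (fun x => _) = (fun x => (expR (t ^+ 2 / 2))%:E * (normal_pdf t 1 x)%:E)%E).
  have mp : measurable_fun setT (EFin \o normal_pdf t 1).
    by apply/measurable_EFinP; exact: measurable_normal_pdf.
  rewrite ge0_integralZl//.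
    by rewrite integral_normal_pdf mule1 ltry.
  by move=> x _; rewrite lee_fin normal_pdf_ge0.
apply/funext => x; rewrite -EFinM; congr EFin.
rewrite !normal_pdfE ?oner_eq0// /normal_fun [LHS]mulrCA [RHS]mulrCA; congr (_ * _).
by rewrite -!expRD; congr expR; field.
Qed.

(** The fourth order term of the exponential series gives z^4 <= 24 (e^z + e^-z), with 24 = 4!, and
    Gaussian exponential moments are finite. *)
Lemma integrable_normal_exprn4 : N01.-integrable setT (EFin \o (fun z => z ^+ 4)).
Proof.
have i2 := integrableD measurableT (integrable_expR_normal 1) (integrable_expR_normal (-1)).
have i3 := integrableZl measurableT 24%R i2.
apply: le_integrable i3 => //.
- by apply/measurable_EFinP; exact: measurable_funX.
- move=> z _; rewrite /= lee_fin.
  rewrite ger0_norm ?exprn_even_ge0// ger0_norm; last first.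
    by rewrite mulr_ge0// addr_ge0// expR_ge0.
  rewrite mul1r mulN1r.
  have key (x : R) : 0 <= x -> x ^+ 4 <= 24 * expR x.
    move=> x0; have := expR_ge1Dxn 3 x0.
    rewrite (_ : 4`!%:R = 24 :> R)// => h.
    have : x ^+ 4 / 24 <= expR x by apply: le_trans h; rewrite lerDr.
    by rewrite ler_pdivrMr// mulrC.
  have [z0|z0] := leP 0 z.
    by rewrite (le_trans (key _ z0))// ler_pM2l// lerDl expR_ge0.
  have := key (- z); rewrite oppr_ge0 (ltW z0) => /(_ isT).
  rewrite exprNn (_ : (-1) ^+ 4 = 1 :> R); last by rewrite -signr_odd.
  by rewrite mul1r => /le_trans; apply; rewrite ler_pM2l// lerDr expR_ge0.
Qed.

Lemma integrable_normal_le4 (f : measurableTypeR R -> R) (c : R) : measurable_fun setT f ->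
  (forall z, `|f z| <= c * (1 + z ^+ 4)) -> N01.-integrable setT (EFin \o f).
Proof.
move=> mf fc.
have i1 : N01.-integrable setT (EFin \o (fun z => 1 + z ^+ 4)).
  apply: eq_integrable (integrableD measurableT _ integrable_normal_exprn4) => //; last first.
    by apply: (integrable_bounded (normal_prob_setT 0 1) (f := cst 1) (B := `|1|)).
  by move=> z _ /=; rewrite EFinD.
have i2 := integrableZl measurableT c i1.
apply: le_integrable i2 => //; first exact/measurable_EFinP.
move=> z _; rewrite /= lee_fin.
by rewrite (le_trans (fc z))// ler_norm.
Qed.

(** Stein's identity for affine functions: the integrand times the density is the derivative of (a +
    b z) times the density, which vanishes at both ends. The pair (-1, 0) yields the mean, (0, 1)
    the variance. *)
Lemma normal_integral_by_parts (a b : R) :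
  \int[N01]_z (b - (a + b * z) * z) = 0.
Proof.
pose p := @normal_pdf R 0 1.
have pE z : p z = normal_peak 1 * expR (- z ^+ 2 / 2).
  by rewrite /p normal_pdfE ?oner_eq0// /normal_fun subr0 expr1n.
pose h z := (b - (a + b * z) * z) * p z.
pose H z := (a + b * z) * p z.
have dp (z : R) : is_derive z 1 p (- z * p z).
  rewrite (_ : p = fun z => normal_peak 1 * expR (- z ^+ 2 / 2)); last exact/funext.
  by apply: is_derive_eq; rewrite /GRing.scale /=; field.
have dH (z : R) : is_derive z 1 H (h z).
  by apply: is_derive_eq; rewrite /h /GRing.scale /=; ring.
have cH : continuous H.
  move=> z; apply: differentiable_continuous; apply/derivable1_diffP.
  exact: (@ex_derive _ _ _ _ _ _ _ (dH z)).
have dh (z : R) : is_derive z 1 h ((- a - b * z *+ 2) * p z - (b - (a + b * z) * z) * z * p z).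
  by apply: is_derive_eq; rewrite /GRing.scale /=; ring.
have ch : continuous h.
  move=> z; apply: differentiable_continuous; apply/derivable1_diffP.
  exact: (@ex_derive _ _ _ _ _ _ _ (dh z)).
have mh : measurable_fun (setT : set (measurableTypeR R)) h by exact: continuous_measurable_fun.
have FTC (n : nat) : (\int[mu]_(x in `[(- n.+1%:R)%R, n.+1%:R]) (h x)%:E =
    (H n.+1%:R - H (- n.+1%:R))%:E)%E.
  rewrite (@continuous_FTC2 _ h H) ?EFinB//.
  - by rewrite (@lt_trans _ _ 0) ?oppr_lt0.
  - exact: continuous_subspaceT.
  - split.
    + by move=> z _; exact: (@ex_derive _ _ _ _ _ _ _ (dH z)).
    + exact/cvg_at_right_filter/cH.
    + exact/cvg_at_left_filter/cH.
  - by move=> z _; rewrite derive1E (@derive_val _ _ _ _ _ _ _ (dH z)).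
have H0 : H n.+1%:R - H (- n.+1%:R) @[n --> \oo] --> (0 : R).
  have HE (x : R) : H x - H (- x) = 2 * b * (x * p x).
    by rewrite /H !pE sqrrN; ring.
  (* By e^(x^2 / 2) >= x^2 / 2 the boundary terms are of order 1 / x. *)
  have xp (x : R) : 0 < x -> `|x * p x| <= normal_peak 1 * 2 / x.
    move=> x0; rewrite pE ger0_norm; last first.
      by rewrite !mulr_ge0 ?normal_peak_ge0 ?expR_ge0 ?ltW.
    rewrite mulrCA -mulrA; apply: ler_wpM2l; first exact: normal_peak_ge0.
    rewrite mulNr expRN ler_pdivlMr// -mulrA mulrC -mulrA ler_pdivrMl ?expR_gt0//.
    have := expR_ge1Dx (x ^+ 2 / 2); rewrite expr2 => h1.
    by rewrite -ler_pdivrMr// (le_trans _ h1)// lerDr.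
  apply: norm_cvg0; apply: (@squeeze_cvgr _ _ _ _ (cst 0)
    (fun n : nat => (`|2 * b| * (normal_peak 1 * 2)) * n.+1%:R^-1)).
  - apply: nearW => n; rewrite /= normr_ge0 /= HE normrM -mulrA.
    by apply: ler_wpM2l => //; exact: xp.
  - exact: cvg_cst.
  - rewrite -[X in _ --> X](mulr0 (`|2 * b| * (normal_peak 1 * 2))).
    by apply: cvgMl_tmp; exact: cvg_harmonic.
have mf : measurable_fun (setT : set (measurableTypeR R)) (fun z : R => b - (a + b * z) * z).
  apply: measurable_funB => //; apply: measurable_funM => //.
  by apply: measurable_funD => //; exact: measurable_funM.
have iN : N01.-integrable setT (EFin \o (fun z => b - (a + b * z) * z)).
  apply: (@integrable_normal_le4 _ (2 * `|b| + `|a|)) => // z.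
  have z4 : 0 <= z ^+ 4 by rewrite exprn_even_ge0.
  have z1 : `|z| <= 1 + z ^+ 4.
    have [z1|z1] := leP `|z| 1; first by rewrite (le_trans z1)// lerDl.
    rewrite (@le_trans _ _ (`|z| ^+ 4))//; first by rewrite ler_eXnr// ltW.
    by rewrite -normrX ger0_norm ?lerDr.
  have z2 : z ^+ 2 <= 1 + z ^+ 4.
    rewrite (_ : z ^+ 4 = (z ^+ 2) ^+ 2) -?exprM//.
    by have := sqr_ge0 (z ^+ 2 - 1); have := sqr_ge0 z; nra.
  have -> : b - (a + b * z) * z = b - a * z - b * z ^+ 2 by ring.
  rewrite (le_trans (ler_normB _ _))// (le_trans (lerD (ler_normB _ _) (lexx _)))//.
  rewrite (normrM a z) (normrM b (z ^+ 2)) (ger0_norm (sqr_ge0 z)).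
  by have := normr_ge0 a; have := normr_ge0 b; nra.
have ih : mu.-integrable setT (EFin \o h).
  apply/integrableP; split; first exact/measurable_EFinP.
  move/integrableP : iN => [_]; congr (_ < _)%E.
  rewrite ge0_integral_normal_prob//; last first.
    by apply: measurableT_comp => //; exact/measurable_EFinP.
  apply: eq_integral => z _ /=; rewrite -EFinM; congr EFin.
  by rewrite normrM (ger0_norm (normal_pdf_ge0 _ _ _)).
have [|||||_ _ cvI] := @dominated_convergence _ _ _ mu setT measurableT
  (fun n : nat => (EFin \o h) \_ `[(- n.+1%:R)%R, n.+1%:R]) (EFin \o h) (abse \o (EFin \o h)).
- by move=> n; apply/(measurable_restrictT _ _).1 => //; apply: measurable_funTS; exact/measurable_EFinP.
- exact/measurable_EFinP.
- apply: aeW => x _; apply: cvg_near_cst; exists (Num.bound `|x|) => // n /= nx.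
  rewrite patchE mem_set//= in_itv /= -ler_norml ltW//.
  rewrite (lt_le_trans (archi_boundP (normr_ge0 x)))// ler_nat.
  exact: leq_trans nx _.
- exact: integrable_abse.
- apply: aeW => x n _; rewrite patchE; case: ifP => // _.
  by rewrite abse0 abse_ge0.
rewrite /Rintegral integral_normal_prob//.
have : (\int[mu]_x (h x)%:E)%E = 0%E.
  apply: (cvg_unique _ cvI) => //.
  rewrite (_ : (fun n => _) = (fun n : nat => (H n.+1%:R - H (- n.+1%:R))%:E)).
    by apply: cvg_EFin; [exact: nearW | exact: H0].
  by apply/funext => n; rewrite -FTC [RHS]integral_mkcond.
by move=> ->.
Qed.

Lemma integrable_normal_id : N01.-integrable setT (EFin \o (fun z => z)).
Proof.
apply: (@integrable_normal_le4 _ 1) => // z; rewrite mul1r.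
have [z1|z1] := leP `|z| 1; first by rewrite (le_trans z1)// lerDl exprn_even_ge0.
rewrite (@le_trans _ _ (`|z| ^+ 4))//; first by rewrite ler_eXnr// ltW.
by rewrite -normrX ger0_norm ?lerDr// exprn_even_ge0.
Qed.

Lemma integrable_normal_sqr : N01.-integrable setT (EFin \o (fun z => z ^+ 2)).
Proof.
apply: (@integrable_normal_le4 _ 1); first exact: measurable_funX.
move=> z.
rewrite mul1r ger0_norm ?sqr_ge0//.
rewrite (_ : z ^+ 4 = (z ^+ 2) ^+ 2) -?exprM//.
by have := sqr_ge0 (z ^+ 2 - 1); have := sqr_ge0 z; nra.
Qed.

Lemma normal_mean0 : \int[N01]_z z = 0.
Proof.
have := normal_integral_by_parts (-1) 0.
rewrite (_ : (fun z => _) = id)//; apply/funext => z /=; ring.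
Qed.

Lemma normal_var1 : \int[N01]_z (z ^+ 2) = 1.
Proof.
have := normal_integral_by_parts 0 1.
under eq_Rintegral => z _ do rewrite add0r mul1r -expr2.
rewrite RintegralB//; last exact: integrable_normal_sqr.
  rewrite (Rintegral_cst1 (normal_prob_setT 0 1)) => /eqP.
  by rewrite subr_eq0 => /eqP /esym.
by apply: (integrable_bounded (normal_prob_setT 0 1) (f := cst 1) (B := `|1|)).
Qed.

End normal_expectation.

Section heat_semigroup.
Context {R : realType}.
Local Notation N01 := (normal_prob (0 : R) 1).

Definition bounded_by (g : R -> R) (B : R) := forall x, `|g x| <= B.

Definition unif_cont (g : R -> R) := forall eps : R, 0 < eps ->
  exists2 delta : R, 0 < delta & forall x d, `|d| <= delta -> `|g (x + d) - g x| <= eps.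

Lemma unif_cont_continuous (g : R -> R) : unif_cont g -> continuous g.
Proof.
move=> ug x; apply/cvgrPdist_le => e e0.
have [d d0 gd] := ug _ e0; near=> y.
have -> : g y = g (x + (y - x)) by congr g; ring.
rewrite distrC; apply: gd.
by rewrite distrC; near: y; exact: cvgr_dist_le.
Unshelve. all: by end_near. Qed.

(** Time is variance: for r >= 0 this is the mean of [g] under the Gaussian law of mean [x] and
    variance [r], the flow of u_r = u_xx / 2. *)
Definition heat (g : R -> R) (r x : R) : R := \int[N01]_z g (x + Num.sqrt r * z).

Lemma heat0 (g : R -> R) x : heat g 0 x = g x.
Proof.
rewrite /heat; under eq_Rintegral => z _ do rewrite sqrtr0 mul0r addr0.
exact: (Rintegral_cst1 (normal_prob_setT 0 1)).
Qed.

Lemma measurable_heat_integrand (g : R -> R) (r x : R) : continuous g ->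
  measurable_fun (setT : set (measurableTypeR R)) (fun z => g (x + Num.sqrt r * z)).
Proof.
move=> cg; have mg := continuous_measurable_fun cg.
by apply: (measurableT_comp mg); apply: measurable_funD => //; exact: measurable_funM.
Qed.

Lemma integrable_heat_integrand (g : R -> R) (B r x : R) : continuous g -> bounded_by g B ->
  N01.-integrable setT (EFin \o (fun z => g (x + Num.sqrt r * z))).
Proof.
move=> cg gB; apply: (integrable_bounded (normal_prob_setT 0 1) (B := B)) => //.
exact: measurable_heat_integrand.
Qed.

Lemma heat_bounded (g : R -> R) (B r : R) : continuous g -> bounded_by g B ->
  bounded_by (heat g r) B.
Proof.
move=> cg gB x; apply: (Rintegral_bound (normal_prob_setT 0 1)) => //.
exact: integrable_heat_integrand gB.
Qed.

Lemma heat_unif_cont (g : R -> R) (B r : R) : unif_cont g -> bounded_by g B ->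
  unif_cont (heat g r).
Proof.
move=> ug gB e e0; have [d d0 gd] := ug _ e0; exists d => // x h hd.
have cg := unif_cont_continuous ug.
apply: (Rintegral_le_bound (normal_prob_setT 0 1)).
- exact: integrable_heat_integrand gB.
- exact: integrable_heat_integrand gB.
- by move=> z; rewrite addrAC; exact: gd.
Qed.

(** The convolution identity needs positive variances, so zero times are treated apart. Uniform
    continuity passes from [g] to [heat g a], which can therefore be averaged again. *)
Lemma heat_semigroup (g : R -> R) (B a b x : R) : unif_cont g -> bounded_by g B ->
  0 <= a -> 0 <= b -> heat (heat g a) b x = heat g (a + b) x.
Proof.
move=> ug gB; rewrite le_eqVlt => /predU1P[<- b0|a0].
  rewrite add0r; apply: eq_Rintegral => z _; exact: heat0.
rewrite le_eqVlt => /predU1P[<-|b0]; first by rewrite heat0 addr0.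
have cg := unif_cont_continuous ug.
pose gx w := g (x + w).
have cgx : continuous gx.
  move=> w; apply: (@continuous_comp _ _ _ (fun y => x + y) g); last exact: cg.
  by apply: cvgD; [exact: cvg_cst|exact: cvg_id].
have gxB : bounded_by gx B by move=> w; exact: gB.
pose k y := heat g a (x + y).
have ck : continuous k.
  move=> w; apply: (@continuous_comp _ _ _ (fun y => x + y) (heat g a));
    last exact: (unif_cont_continuous (heat_unif_cont a ug gB)).
  by apply: cvgD; [exact: cvg_cst|exact: cvg_id].
have kB : bounded_by k B by move=> w; exact: heat_bounded.
have sa0 : 0 < Num.sqrt a by rewrite sqrtr_gt0.
have sb0 : 0 < Num.sqrt b by rewrite sqrtr_gt0.
have kE y : k y = \int[normal_prob y (Num.sqrt a)]_w gx w.
  rewrite -(Rintegral_normal_affine y sa0 cgx gxB); apply: eq_Rintegral => z _.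
  by rewrite /gx addrA.
have -> : heat (heat g a) b x = \int[normal_prob 0 (Num.sqrt b)]_y k y.
  rewrite -(Rintegral_normal_affine 0 sb0 ck kB); apply: eq_Rintegral => z _.
  by rewrite /k add0r.
have sab : Num.sqrt (a + b) = Num.sqrt (Num.sqrt b ^+ 2 + Num.sqrt a ^+ 2).
  by rewrite !sqr_sqrtr ?ltW// addrC.
have -> : heat g (a + b) x = \int[normal_prob 0 (Num.sqrt (a + b))]_y gx y.
  rewrite -(Rintegral_normal_affine 0 _ cgx gxB); last by rewrite sqrtr_gt0 addr_gt0.
  by apply: eq_Rintegral => z _; rewrite /gx add0r.
have mgx : measurable_fun (setT : set (measurableTypeR R)) gx by exact: continuous_measurable_fun.
have mk : measurable_fun (setT : set (measurableTypeR R)) k by exact: continuous_measurable_fun.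
have h1 := Rintegral_normal_shift (normal_prob_setT 0 (Num.sqrt b)) mk kB.
have h2 := Rintegral_normal_shift (normal_prob_setT 0 (Num.sqrt (a + b))) mgx gxB.
have mgB : measurable_fun (setT : set (measurableTypeR R)) (fun w => gx w + B).
  exact: measurable_funD.
have gB0 w : 0 <= gx w + B.
  by have := gxB w; rewrite ler_norml => /andP[+ _]; rewrite -lerBlDr sub0r.
have := ge0_normal_convolution sb0 sa0 mgB gB0.
rewrite -sab => h3.
have h4 : (\int[normal_prob 0 (Num.sqrt b)]_y (k y + B)%:E =
    \int[normal_prob 0 (Num.sqrt b)]_y \int[normal_prob y (Num.sqrt a)]_w (gx w + B)%:E)%E.
  apply: eq_integral => y _; rewrite kE.
  exact: (esym (Rintegral_normal_shift (normal_prob_setT y (Num.sqrt a)) mgx gxB)).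
exact: (addIr B (EFin_inj (etrans (esym h1) (etrans h4 (etrans h3 h2))))).
Qed.

Lemma measurable_heat (g : R -> R) : continuous g ->
  measurable_fun setT (fun z : R * R => heat g z.1 z.2).
Proof.
move=> cg; have mg := continuous_measurable_fun cg; rewrite /heat.
pose k := (kprobability (@measurable_cst _ _ (R * R)%type _ setT
  (normal_prob 0 1 : pprobability (measurableTypeR R) R))).
have := @measurable_Rintegral_kernel _ _ (R * R)%type (measurableTypeR R) R k
  (fun w => g (w.1.2 + Num.sqrt w.1.1 * w.2)).
apply; apply: (measurableT_comp mg).
apply: measurable_funD; first exact: measurableT_comp.
apply: measurable_funM => //.
apply: (measurableT_comp (continuous_measurable_fun (@sqrt_continuous R))).
exact: measurableT_comp.
Qed.

End heat_semigroup.

(** * The Lindeberg replacement *)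

Section test_functions.
Context {R : realType}.
Local Notation N01 := (normal_prob (0 : R) 1).

(** [g1] and [g2] stand for the first two derivatives, but what is recorded is the uniform second
    order expansion: it survives averaging over Gaussian shifts, so [heat g r] inherits it with
    [heat g1 r] and [heat g2 r], without differentiation under the integral. *)
Record test_fun (g g1 g2 : R -> R) (B : R) : Prop := TestFun {
  test_uc : unif_cont g; test_uc1 : unif_cont g1; test_uc2 : unif_cont g2;
  test_bound : bounded_by g B; test_bound1 : bounded_by g1 B; test_bound2 : bounded_by g2 B;
  test_taylor : forall eps : R, 0 < eps -> exists2 delta : R, 0 < delta &
    forall x d, `|d| <= delta ->
      `|g (x + d) - (g x + g1 x * d + g2 x * d ^+ 2 / 2)| <= eps * d ^+ 2 }.

Lemma powR_gt2 (q d delta : R) : 2 < q -> 0 < delta -> delta < `|d| ->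
  d ^+ 2 <= delta `^ (2 - q) * `|d| `^ q.
Proof.
move=> q2 d0 dd; have nd0 : 0 < `|d| by rewrite (lt_trans d0).
have -> : `|d| `^ q = `|d| `^ (q - 2) * d ^+ 2.
  rewrite -[q in LHS](subrK 2) [LHS]powRD; last by rewrite (gt_eqF nd0) implybT.
  by rewrite powR_mulrn// -normrX (ger0_norm (sqr_ge0 d)).
rewrite mulrA -[leLHS]mul1r ler_wpM2r ?sqr_ge0//.
rewrite -(opprB q 2) powRN mulrC ler_pdivlMr ?powR_gt0// mul1r.
by rewrite ge0_ler_powR ?nnegrE// ?subr_ge0 ?ltW// (ltW dd).
Qed.

(** The cases split at |d| = sqrt eps. Integrated, it bounds a variance by a small constant plus a
    multiple of the q-th moment, which makes the square of a variance negligible. *)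
Lemma sqr_le_powR (q eps : R) : 2 < q -> 0 < eps ->
  exists2 K : R, 0 <= K & forall d : R, d ^+ 2 <= eps + K * `|d| `^ q.
Proof.
move=> q2 e0; have s0 : 0 < Num.sqrt eps by rewrite sqrtr_gt0.
exists (Num.sqrt eps `^ (2 - q)); first exact: powR_ge0.
move=> d; have [dd|dd] := leP `|d| (Num.sqrt eps).
  rewrite (@le_trans _ _ eps)//; last by rewrite lerDl mulr_ge0 ?powR_ge0.
  rewrite -[leRHS](sqr_sqrtr (ltW e0)) -[leLHS](ger0_norm (sqr_ge0 d)) normrX.
  by rewrite lerXn2r ?nnegrE// ltW.
by rewrite (le_trans (powR_gt2 q2 s0 dd))// lerDr ltW.
Qed.

Variables (g g1 g2 : R -> R) (B : R).
Hypothesis tg : test_fun g g1 g2 B.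

Let B0 : 0 <= B. Proof. by rewrite (le_trans _ (test_bound tg 0)). Qed.

(** Near zero the uniform expansion suffices; beyond [dl] every term is crudely of order d^2, which
    the q-th power dominates since q > 2. *)
Lemma test_fun_taylor_powR (q eps : R) : 2 < q -> 0 < eps -> exists2 K : R, 0 <= K &
  forall x d, `|g (x + d) - (g x + g1 x * d + g2 x * d ^+ 2 / 2)| <=
    eps * d ^+ 2 + K * `|d| `^ q.
Proof.
move=> q2 e0; have [dl d0 td] := test_taylor tg e0.
(* Two values of [g], one term in [g1] and one in [g2], each turned into a multiple of d^2 by |d| >
   dl. *)
pose C := 2 * B / dl ^+ 2 + B / dl + B / 2.
have C0 : 0 <= C.
  by rewrite !addr_ge0// divr_ge0// ?mulr_ge0// ?sqr_ge0// ltW.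
exists (C * dl `^ (2 - q)); first by rewrite mulr_ge0// powR_ge0.
move=> x d; have [dd|dd] := leP `|d| dl.
  by rewrite (le_trans (td x d dd))// lerDl !mulr_ge0// powR_ge0.
apply: (@le_trans _ _ (C * d ^+ 2)); last first.
  rewrite (@le_trans _ _ (C * dl `^ (2 - q) * `|d| `^ q))//.
    by rewrite -mulrA ler_wpM2l//; exact: powR_gt2.
  by rewrite lerDr mulr_ge0 ?sqr_ge0// ltW.
have b0 := test_bound tg (x + d); have b1 := test_bound tg x.
have b2 := test_bound1 tg x; have b3 := test_bound2 tg x.
have dn0 : 0 < `|d| by rewrite (lt_trans d0).
have i1 : 1 <= d ^+ 2 / dl ^+ 2.
  rewrite ler_pdivlMr ?exprn_gt0// mul1r -[leRHS](ger0_norm (sqr_ge0 d)) normrX.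
  by rewrite lerXn2r ?nnegrE// ?ltW.
have i2 : `|d| <= d ^+ 2 / dl.
  rewrite ler_pdivlMr// -[leRHS](ger0_norm (sqr_ge0 d)) normrX expr2.
  by rewrite ler_pM2l// ltW.
rewrite (le_trans (ler_normB _ _))// (le_trans (lerD (lexx _) (ler_normD _ _)))//.
rewrite (le_trans (lerD (lexx _) (lerD (ler_normD _ _) (lexx _))))//.
have -> : C * d ^+ 2 = B * (d ^+ 2 / dl ^+ 2) + ((B * (d ^+ 2 / dl ^+ 2) +
    B * (d ^+ 2 / dl)) + B * d ^+ 2 / 2).
  rewrite /C; field; exact: lt0r_neq0.
have Ble y : `|y| <= B -> `|y| <= B * (d ^+ 2 / dl ^+ 2).
  by move=> /le_trans; apply; rewrite ler_peMr.
rewrite lerD ?Ble// lerD ?lerD ?Ble//.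
  by rewrite normrM ler_pM.
rewrite normrM (@ger0_norm _ 2^-1)// ler_wpM2r// normrM (ger0_norm (sqr_ge0 d)).
by rewrite ler_wpM2r// sqr_ge0.
Qed.

(** The expansion of [g] is averaged over the Gaussian shift, so one [K] serves for all [r]. *)
Lemma heat_taylor_powR (q eps : R) : 2 < q -> 0 < eps -> exists2 K : R, 0 <= K &
  forall r x d, `|heat g r (x + d) -
    (heat g r x + heat g1 r x * d + heat g2 r x * d ^+ 2 / 2)| <=
    eps * d ^+ 2 + K * `|d| `^ q.
Proof.
move=> q2 e0; have [K K0 tK] := test_fun_taylor_powR q2 e0; exists K => // r x d.
have cg := unif_cont_continuous (test_uc tg).
have cg1 := unif_cont_continuous (test_uc1 tg).
have cg2 := unif_cont_continuous (test_uc2 tg).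
have i0 := integrable_heat_integrand r x cg (test_bound tg).
have id := integrable_heat_integrand r (x + d) cg (test_bound tg).
have i1 := integrable_heat_integrand r x cg1 (test_bound1 tg).
have i2 := integrable_heat_integrand r x cg2 (test_bound2 tg).
have i1d := integrableZr measurableT d i1.
have i2d := integrableZr measurableT (d ^+ 2 / 2) i2.
have -> : heat g r x + heat g1 r x * d + heat g2 r x * d ^+ 2 / 2 =
    \int[N01]_z (g (x + Num.sqrt r * z) + g1 (x + Num.sqrt r * z) * d +
      g2 (x + Num.sqrt r * z) * (d ^+ 2 / 2)).
  have i01 := integrableD measurableT i0 i1d.
  by rewrite -(mulrA (heat g2 r x)) RintegralD// RintegralD// RintegralZr// RintegralZr.
apply: (Rintegral_le_bound (normal_prob_setT 0 1)) => //.
  exact: (integrableD measurableT (integrableD measurableT i0 i1d) i2d).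
by move=> z; rewrite addrAC mulrA; exact: tK.
Qed.

(** By the semigroup law [heat g (r + v)] averages [heat g r] over a Gaussian step of variance [v].
    In its expansion the linear term has mean zero, and the choice q = 4 turns the remainder into a
    fourth Gaussian moment, of order v^2. *)
Lemma heat_increment (eps : R) : 0 < eps -> exists2 K : R, 0 <= K &
  forall r v x, 0 <= r -> 0 <= v ->
    `|heat g (r + v) x - (heat g r x + heat g2 r x * v / 2)| <= eps * v + K * v ^+ 2.
Proof.
have q4 : (2 : R) < 4%:R by rewrite ltr_nat.
move=> e0; have [K K0 tK] := heat_taylor_powR q4 e0.
pose m4 := \int[N01]_z (z ^+ 4).
exists (K * m4).
  by rewrite mulr_ge0// Rintegral_ge0// => z _; rewrite exprn_even_ge0.
move=> r v x r0 v0.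
set s := Num.sqrt v; have s2 : s ^+ 2 = v by rewrite sqr_sqrtr.
have s4 : s ^+ 4 = v ^+ 2 by rewrite -s2 -exprM.
have cg := unif_cont_continuous (test_uc tg).
pose u := heat g r; pose c1 := heat g1 r x * s; pose c2 := heat g2 r x * v / 2.
have iu : N01.-integrable setT (EFin \o (fun z => u (x + s * z))).
  apply: (@integrable_heat_integrand _ _ B).
    exact: (unif_cont_continuous (heat_unif_cont r (test_uc tg) (test_bound tg))).
  exact: (heat_bounded r cg (test_bound tg)).
have ic : N01.-integrable setT (EFin \o (fun=> u x)).
  by apply: (integrable_bounded (normal_prob_setT 0 1) (f := cst (u x)) (B := `|u x|)).
have i1 := integrableZl measurableT c1 integrable_normal_id.
have i2 := integrableZl measurableT c2 integrable_normal_sqr.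
have i2' := integrableZl measurableT (eps * v) integrable_normal_sqr.
have i4 := integrableZl measurableT (K * v ^+ 2) integrable_normal_exprn4.
have i12 := integrableD measurableT i1 i2.
have ic12 := integrableD measurableT ic i12.
have -> : heat g (r + v) x - (heat g r x + heat g2 r x * v / 2) =
    \int[N01]_z (u (x + s * z) - (u x + (c1 * z + c2 * z ^+ 2))).
  rewrite RintegralB// RintegralD// RintegralD//.
  rewrite (RintegralZl _ measurableT integrable_normal_id).
  rewrite (RintegralZl _ measurableT integrable_normal_sqr).
  rewrite normal_mean0 normal_var1 mulr0 mulr1 add0r.
  rewrite (Rintegral_cst1 (normal_prob_setT 0 1)).
  by rewrite -(heat_semigroup x (test_uc tg) (test_bound tg) r0 v0).
have -> : eps * v + K * m4 * v ^+ 2 =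
    \int[N01]_z (eps * v * z ^+ 2 + K * v ^+ 2 * z ^+ 4).
  rewrite RintegralD//.
  rewrite (RintegralZl _ measurableT integrable_normal_exprn4).
  rewrite (RintegralZl _ measurableT integrable_normal_sqr).
  by rewrite normal_var1 mulr1 mulrAC.
apply: Rintegral_norm_le.
- exact: (integrableB measurableT iu ic12).
- exact: (integrableD measurableT i2' i4).
move=> z; have := tK r x (s * z).
rewrite powR_mulrn// -normrX (@ger0_norm _ (_ ^+ 4)) ?exprn_even_ge0//.
rewrite !exprMn s2 s4 !mulrA; apply: le_trans.
rewrite le_eqVlt; apply/orP; left; apply/eqP; congr (`|_|); rewrite /u /c1 /c2; field. by [].
Qed.


(** Both terms are compared with [heat g r s + heat g2 r s * v / 2], where [v] is the variance of
    [D]: the Taylor expansion covers the first, the heat increment the second. [K] is fixed before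
    the measure and [D], hence uniform over states, parameters and scalings. *)
Lemma heat_step (q V0 eps : R) : 2 < q -> 0 <= V0 -> 0 < eps -> exists2 K : R, 0 <= K &
  forall d (T : measurableType d) (mu : {measure set T -> \bar R}) (D : T -> R),
    mu setT = 1%E -> measurable_fun setT D ->
    mu.-integrable setT (EFin \o D) ->
    mu.-integrable setT (EFin \o (fun y => D y ^+ 2)) ->
    mu.-integrable setT (EFin \o (fun y => `|D y| `^ q)) ->
    \int[mu]_y D y = 0 -> \int[mu]_y (D y ^+ 2) <= V0 ->
    forall r s, 0 <= r ->
    `|\int[mu]_y heat g r (s + D y) - heat g (r + \int[mu]_y (D y ^+ 2)) s| <=
      eps * \int[mu]_y (D y ^+ 2) + K * \int[mu]_y (`|D y| `^ q).
Proof.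
move=> q2 V00 e0; have e3 : 0 < eps / 3 by rewrite divr_gt0.
have [K1 K10 tK1] := heat_taylor_powR q2 e3.
have [K2 K20 tK2] := heat_increment e3.
have K21 : 0 < K2 + 1 by lra.
(* Chosen so that [K2] times it is at most [eps / 3]; the added 1 covers [K2 = 0]. *)
have e4 : 0 < eps / 3 / (K2 + 1) by exact: divr_gt0.
have [K3 K30 tK3] := sqr_le_powR q2 e4.
exists (K1 + K2 * V0 * K3); first by rewrite addr_ge0// !mulr_ge0.
move=> d T mu D mu1 mD iD iD2 iDq meanD vV0 r s r0.
set v := \int[mu]_y (D y ^+ 2) in vV0 *; set l := \int[mu]_y (`|D y| `^ q).
have v0 : 0 <= v by apply: Rintegral_ge0 => y _; rewrite sqr_ge0.
have l0 : 0 <= l by apply: Rintegral_ge0 => y _; rewrite powR_ge0.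
have cg := unif_cont_continuous (test_uc tg).
pose u := heat g r; pose c1 := heat g1 r s; pose c2 := heat g2 r s / 2.
have cu : continuous u.
  exact: (unif_cont_continuous (heat_unif_cont r (test_uc tg) (test_bound tg))).
have uB : bounded_by u B by exact: (heat_bounded r cg (test_bound tg)).
have iu : mu.-integrable setT (EFin \o (fun y => u (s + D y))).
  apply: (integrable_bounded mu1 (B := B)) => //.
  apply: (measurableT_comp (continuous_measurable_fun cu)).
  exact: measurable_funD.
have ic : mu.-integrable setT (EFin \o (fun=> u s)).
  by apply: (integrable_bounded mu1 (f := cst (u s)) (B := `|u s|)).
have i1 := integrableZl measurableT c1 iD.
have i2 := integrableZl measurableT c2 iD2.
have i2' := integrableZl measurableT (eps / 3) iD2.
have iq' := integrableZl measurableT K1 iDq.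
have i12 := integrableD measurableT i1 i2.
have ic12 := integrableD measurableT ic i12.
have h1 : `|\int[mu]_y u (s + D y) - (u s + c2 * v)| <= eps / 3 * v + K1 * l.
  have -> : \int[mu]_y u (s + D y) - (u s + c2 * v) =
      \int[mu]_y (u (s + D y) - (u s + (c1 * D y + c2 * D y ^+ 2))).
    rewrite RintegralB// RintegralD// RintegralD//.
    rewrite (RintegralZl _ measurableT iD) (RintegralZl _ measurableT iD2).
    by rewrite meanD mulr0 add0r (Rintegral_cst1 mu1).
  have -> : eps / 3 * v + K1 * l =
      \int[mu]_y (eps / 3 * D y ^+ 2 + K1 * `|D y| `^ q).
    rewrite RintegralD//.
    by rewrite (RintegralZl _ measurableT iD2) (RintegralZl _ measurableT iDq).
  apply: Rintegral_norm_le.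
  - exact: (integrableB measurableT iu ic12).
  - exact: (integrableD measurableT i2' iq').
  move=> y; have := tK1 r s (D y); apply: le_trans.
  rewrite le_eqVlt; apply/orP; left; apply/eqP; congr (`|_|).
  by rewrite /u /c1 /c2; field.
have h2 := tK2 r v s r0 v0.
have v3 : v <= eps / 3 / (K2 + 1) + K3 * l.
  have ice : mu.-integrable setT (EFin \o (fun=> eps / 3 / (K2 + 1))).
    apply: (integrable_bounded mu1 (f := cst (eps / 3 / (K2 + 1)))
      (B := `|eps / 3 / (K2 + 1)|)) => //.
  have iq3 := integrableZl measurableT K3 iDq.
  have -> : eps / 3 / (K2 + 1) + K3 * l =
      \int[mu]_y (eps / 3 / (K2 + 1) + K3 * `|D y| `^ q).
    by rewrite RintegralD// (RintegralZl _ measurableT iDq) (Rintegral_cst1 mu1).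
  apply: le_Rintegral => //.
  exact: (integrableD measurableT ice iq3).
(* One factor of v^2 is replaced by its bound [v3]; in the moment term the other factor is at most
   [V0]. *)
have h3 : K2 * v ^+ 2 <= eps / 3 * v + K2 * V0 * K3 * l.
  have k1 : K2 * (eps / 3 / (K2 + 1)) <= eps / 3.
    by rewrite mulrCA ler_piMr ?(ltW e3)// ler_pdivrMr// mul1r lerDl.
  rewrite (@le_trans _ _ (K2 * v * (eps / 3 / (K2 + 1) + K3 * l)))//.
    by rewrite expr2 mulrA ler_wpM2l// mulr_ge0.
  have k2 : K2 * (eps / 3 / (K2 + 1)) * v <= eps / 3 * v by rewrite ler_wpM2r.
  have k3 : v * (K2 * K3 * l) <= V0 * (K2 * K3 * l) by rewrite ler_wpM2r// !mulr_ge0.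
  by move: k2 k3; set w := eps / 3 / (K2 + 1); lra.
have -> : \int[mu]_y heat g r (s + D y) - heat g (r + v) s =
    (\int[mu]_y u (s + D y) - (u s + c2 * v)) -
    (heat g (r + v) s - (heat g r s + heat g2 r s * v / 2)).
  by rewrite /u /c2; field.
rewrite (le_trans (ler_normB _ _))// (le_trans (lerD h1 h2))//.
have -> : eps = eps / 3 + eps / 3 + eps / 3 by field.
by move: h3; set w := eps / 3; lra.
Qed.

End test_functions.

Section lindeberg_functional.
Context dX dT (X : measurableType dX) (Theta : measurableType dT) (R : realType).
Variable P : Theta -> R.-pker X ~> X.
Hypothesis P_measurable : forall A : set X, measurable A ->
  measurable_fun [set: X * Theta] (fun z => P z.2 z.1 A).
Variables (D : Theta -> X -> X -> R) (q : R) (u : R -> R -> R).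

Definition step_var t x := \int[P t x]_y (D t x y ^+ 2).
Definition step_mom t x := \int[P t x]_y (`|D t x y| `^ q).

(* State of the recursion: the variance r still to be replaced, the remaining
   budget b for the q-th moments and the sum s of the increments so far; the
   replacement stops before either budget is exceeded. *)
Fixpoint lindeberg m (th : nat -> Theta) (x : X) (r b s : R) : m.-tuple X -> R :=
  match m with
  | 0 => fun _ => u r s
  | m'.+1 => fun tp =>
      if (step_var (th 0%N) x <= r) && (step_mom (th 0%N) x <= b) then
        lindeberg (fun k => th k.+1) (thead tp) (r - step_var (th 0%N) x)
          (b - step_mom (th 0%N) x) (s + D (th 0%N) x (thead tp)) [tuple of behead tp]
      else u r s
  end.

(** Variances and moments are nonnegative, so totals within the budgets keep all partial sums within
    them and the recursion never stops early. The tuple holds the states after the initial one,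
    hence [xs i.+1]. *)
Lemma lindeberg_good m (th : nat -> Theta) (xs : nat -> X) (r b s : R) (tp : m.-tuple X) :
  (forall i : 'I_m, tnth tp i = xs i.+1) ->
  \sum_(j < m) step_var (th j) (xs j) <= r ->
  \sum_(j < m) step_mom (th j) (xs j) <= b ->
  lindeberg th (xs 0%N) r b s tp =
  u (r - \sum_(j < m) step_var (th j) (xs j)) (s + \sum_(j < m) D (th j) (xs j) (xs j.+1)).
Proof.
elim: m => [|m IH] in th xs r b s tp *; move=> tpE hv hl /=.
  by rewrite !big_ord0 subr0 addr0.
have v0 t x : 0 <= step_var t x by apply: Rintegral_ge0 => y _; rewrite sqr_ge0.
have l0 t x : 0 <= step_mom t x by apply: Rintegral_ge0 => y _; rewrite powR_ge0.
rewrite !big_ord_recl /= in hv hl *.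
have sv : 0 <= \sum_(i < m) step_var (th (bump 0 i)) (xs (bump 0 i)) by exact: sumr_ge0.
have sl : 0 <= \sum_(i < m) step_mom (th (bump 0 i)) (xs (bump 0 i)) by exact: sumr_ge0.
rewrite ifT; last by apply/andP; split; lra.
have -> : thead tp = xs 1%N by rewrite /thead tpE.
rewrite (IH (fun k => th k.+1) (fun k => xs k.+1)).
- by rewrite !opprD !addrA; congr (u (_ - _) (_ + _)).
- move=> i; rewrite tnth_behead tpE; congr (xs _.+1).
  by rewrite inordK // ltnS.
- by rewrite lerBrDl.
- by rewrite lerBrDl.
Qed.

Hypothesis uB : exists B : R, forall r s, `|u r s| <= B.
Hypothesis mu : measurable_fun setT (fun z : R * R => u z.1 z.2).
Hypothesis mD : measurable_fun setT (fun z : Theta * X * X => D z.1.1 z.1.2 z.2).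

Lemma lindeberg_bounded (B : R) : (forall r s, `|u r s| <= B) ->
  forall m th x r b s (tp : m.-tuple X), `|lindeberg th x r b s tp| <= B.
Proof. by move=> HB; elim=> [|m IH] th x r b s tp //=; case: ifP. Qed.

Let mDc dZ (Z : measurableType dZ) (tau : Z -> Theta) (xi : Z -> X) :
  measurable_fun setT tau -> measurable_fun setT xi ->
  measurable_fun setT (fun w : Z * X => D (tau w.1) (xi w.1) w.2).
Proof.
move=> mt mx; have m1 : measurable_fun setT (fun w : Z * X => tau w.1).
  exact: measurableT_comp.
have m2 : measurable_fun setT (fun w : Z * X => xi w.1) by exact: measurableT_comp.
exact: (measurableT_comp mD (measurable_fun_pair (measurable_fun_pair m1 m2) measurable_snd)).
Qed.

Lemma measurable_step_var dZ (Z : measurableType dZ) (tau : Z -> Theta) (xi : Z -> X) :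
  measurable_fun setT tau -> measurable_fun setT xi ->
  measurable_fun setT (fun z => step_var (tau z) (xi z)).
Proof.
move=> mt mx; apply: (measurable_Rintegral_param P_measurable mt mx
  (k := fun w => D (tau w.1) (xi w.1) w.2 ^+ 2)).
by apply: measurable_funX; exact: mDc.
Qed.

Lemma measurable_step_mom dZ (Z : measurableType dZ) (tau : Z -> Theta) (xi : Z -> X) :
  measurable_fun setT tau -> measurable_fun setT xi ->
  measurable_fun setT (fun z => step_mom (tau z) (xi z)).
Proof.
move=> mt mx; apply: (measurable_Rintegral_param P_measurable mt mx
  (k := fun w => `|D (tau w.1) (xi w.1) w.2| `^ q)).
apply: (measurableT_comp (measurable_powR q)).
by apply: measurableT_comp => //; exact: mDc.
Qed.

Lemma measurable_lindeberg m dZ (Z : measurableType dZ) (tau : nat -> Z -> Theta)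
    (xi : Z -> X) (r b s : Z -> R) (tp : Z -> m.-tuple X) :
  (forall i, measurable_fun setT (tau i)) -> measurable_fun setT xi ->
  measurable_fun setT r -> measurable_fun setT b -> measurable_fun setT s ->
  measurable_fun setT tp ->
  measurable_fun setT (fun z => lindeberg (fun k => tau k z) (xi z) (r z) (b z) (s z) (tp z)).
Proof.
elim: m => [|m IH] in tau xi r b s tp *; move=> mt mx mr mb ms mtp /=.
  exact: (measurableT_comp mu (measurable_fun_pair mr ms)).
have mv := measurable_step_var (mt 0%N) mx.
have ml := measurable_step_mom (mt 0%N) mx.
have mh : measurable_fun setT (fun z => thead (tp z)).
  exact: (measurableT_comp (measurable_tnth ord0) mtp).
apply: measurable_fun_ifT.
- by apply: measurable_and; exact: measurable_fun_ler.
- apply: (IH (fun k => tau k.+1)) => //.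
  + exact: measurable_funB.
  + exact: measurable_funB.
  + apply: measurable_funD => //.
    apply: (measurableT_comp mD (measurable_fun_pair (measurable_fun_pair (mt 0%N) mx) mh)).
  + exact: (measurableT_comp (@measurable_behead _ X m) mtp).
- exact: (measurableT_comp mu (measurable_fun_pair mr ms)).
Qed.

Variables (V0 eps K : R).
Hypotheses (eps0 : 0 <= eps) (K0 : 0 <= K).
Hypothesis u_step : forall t x r s, 0 <= r -> step_var t x <= V0 ->
  `|\int[P t x]_y u r (s + D t x y) - u (r + step_var t x) s| <=
    eps * step_var t x + K * step_mom t x.

(** Each replacement costs [eps] times the variance plus [K] times the moment just deducted from the
    budgets, so the total cost is at most that of the initial budgets; a stopped recursion costs
    nothing. The kernels follow [th] while the functional reads its parameters from [th'], a copy
    required to agree only on the first [m] indices. *)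
Lemma lindeberg_chain m (th th' : nat -> Theta) x r b s :
  (forall k, (k < m)%N -> th k = th' k) -> 0 <= r -> r <= V0 -> 0 <= b ->
  `|chain_int P th x (lindeberg th' x r b s : m.-tuple X -> R) - u r s| <= eps * r + K * b.
Proof.
elim: m => [|m IH] in th th' x r b s *; move=> thE r0 rV b0 /=.
  by rewrite subrr normr0 addr_ge0// mulr_ge0.
rewrite -(thE 0%N)//.
have [/andP[hv hl]|_] := boolP (_ && _); last first.
  under eq_Rintegral => y _ do rewrite chain_int_cst.
  rewrite (Rintegral_cst1 (prob_kernel x)) subrr normr0.
  by rewrite addr_ge0// mulr_ge0.
have v0 : 0 <= step_var (th 0%N) x by apply: Rintegral_ge0 => y _; rewrite sqr_ge0.
have l0 : 0 <= step_mom (th 0%N) x by apply: Rintegral_ge0 => y _; rewrite powR_ge0.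
set v := step_var (th 0%N) x in hv v0 *; set l := step_mom (th 0%N) x in hl l0 *.
have [B HuB] := uB; have HB := lindeberg_bounded HuB.
pose F y (t : m.-tuple X) := lindeberg (fun k => th' k.+1) y (r - v) (b - l)
  (s + D (th 0%N) x y) t.
have mDx : measurable_fun setT (fun y => D (th 0%N) x y).
  have mc : measurable_fun setT (fun _ : X => (th 0%N, x)) by [].
  exact: (measurableT_comp mD (measurable_fun_pair mc (@measurable_id _ X setT))).
have mF : measurable_fun setT (fun w : X * m.-tuple X => F w.1 w.2).
  apply: (measurable_lindeberg (tau := fun k _ => th' k.+1) (xi := fst)
    (r := fun=> r - v) (b := fun=> b - l) (s := fun w => s + D (th 0%N) x w.1)
    (tp := snd)) => //.
  by apply: measurable_funD => //; exact: measurableT_comp.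
have mFy y : measurable_fun setT (F y).
  have mc : measurable_fun setT (fun _ : m.-tuple X => y) by [].
  exact: (measurableT_comp mF (measurable_fun_pair mc (@measurable_id _ _ setT))).
have cF : \int[P (th 0%N) x]_y chain_int P (fun k => th k.+1) y (F y) =
    \int[P (th 0%N) x]_y chain_int P (fun k => th k.+1) y (fun t : m.-tuple X =>
      lindeberg (fun k => th' k.+1) (thead [tuple of y :: t]) (r - v) (b - l)
        (s + D (th 0%N) x (thead [tuple of y :: t])) [tuple of behead [tuple of y :: t]]).
  apply: eq_Rintegral => y _; congr (chain_int _ _ _ _); apply/funext => t.
  rewrite /F theadE; congr (lindeberg _ _ _ _ _ _).
  exact/val_inj.
rewrite -cF.
have i1 : (P (th 0%N) x).-integrable setT (EFin \o
    (fun y => chain_int P (fun k => th k.+1) y (F y))).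
  apply: (integrable_bounded (prob_kernel x) (B := B)).
    exact: (measurable_chain_int P_measurable (tau := fun k _ => th k.+1)
      (xi := id) (Phi := fun w => F w.1 w.2)).
  by move=> y; apply: (chain_int_bound P_measurable) => // t; exact: HB.
have i2 : (P (th 0%N) x).-integrable setT (EFin \o
    (fun y => u (r - v) (s + D (th 0%N) x y))).
  apply: (integrable_bounded (prob_kernel x) (B := B)) => //.
  have mc : measurable_fun setT (fun _ : X => r - v) by [].
  have ms : measurable_fun setT (fun y : X => s + D (th 0%N) x y) by exact: measurable_funD.
  exact: (measurableT_comp mu (measurable_fun_pair mc ms)).
have rv0 : 0 <= r - v by rewrite subr_ge0.
have bl0 : 0 <= b - l by rewrite subr_ge0.
have rvV : r - v <= V0 by rewrite (le_trans _ rV)// lerBlDr lerDl.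
have s1 : `|\int[P (th 0%N) x]_y chain_int P (fun k => th k.+1) y (F y) -
    \int[P (th 0%N) x]_y u (r - v) (s + D (th 0%N) x y)| <= eps * (r - v) + K * (b - l).
  apply: (Rintegral_le_bound (prob_kernel x)) => // y.
  by apply: IH => // k km; exact: thE.
have s2 := @u_step (th 0%N) x (r - v) s rv0 (le_trans hv rV).
rewrite subrK in s2.
rewrite -(subrKA (\int[P (th 0%N) x]_y u (r - v) (s + D (th 0%N) x y))).
rewrite (le_trans (ler_normD _ _))// (le_trans (lerD s1 s2))//.
by rewrite -/v -/l; lra.
Qed.

End lindeberg_functional.

Section lindeberg_expectation.
Context dX dT dO (X : measurableType dX) (Theta : measurableType dT)
  (Omega : measurableType dO) (R : realType) (Pr : probability Omega R).
Variables (P : Theta -> R.-pker X ~> X) (nu : probability X R).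
Hypothesis P_measurable : forall A : set X, measurable A ->
  measurable_fun [set: X * Theta] (fun z => P z.2 z.1 A).
Variables (Xn : nat -> {RV Pr >-> X}) (th : nat -> {RV Pr >-> Theta}).
Hypothesis A5 : forall (n : nat) (h : n.+1.-tuple X -> R),
  measurable_fun setT h -> bounded_fun h ->
  is_cond_expectation Pr (g_sigma_preimage (fun i : 'I_n.+1 => th i))
    (fun w => h [tuple Xn i w | i < n.+1])
    (fun w => path_int P nu (fun k => th k w) h).

(** After disintegration the parameter path is fixed and [tau] is a constant starting value; the
    bound of [lindeberg_chain] depends on neither and so survives integration. [inord] reads the
    parameters of index at most [n] back from the tuple. *)
Lemma lindeberg_expectation (n : nat) (D : Theta -> X -> X -> R) (q : R) (u : R -> R -> R)
    (tau : n.+1.-tuple Theta -> R) (V0 eps K r b : R) :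
  measurable_fun setT tau ->
  (exists B : R, forall r s, `|u r s| <= B) ->
  measurable_fun setT (fun z : R * R => u z.1 z.2) ->
  measurable_fun setT (fun z : Theta * X * X => D z.1.1 z.1.2 z.2) ->
  0 <= eps -> 0 <= K ->
  (forall t x r s, 0 <= r -> step_var P D t x <= V0 ->
    `|\int[P t x]_y u r (s + D t x y) - u (r + step_var P D t x) s| <=
      eps * step_var P D t x + K * step_mom P D q t x) ->
  0 <= r -> r <= V0 -> 0 <= b ->
  `|\int[Pr]_w lindeberg P D q u (fun k => tnth (tupleRV th n w) (inord k)) (Xn 0%N w) r b
       (tau (tupleRV th n w)) [tuple of behead (tupleRV Xn n w)] -
    \int[Pr]_w u r (tau (tupleRV th n w))| <= eps * r + K * b.
Proof.
move=> mtau uB mu mD e0 K0 ustep r0 rV b0.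
have [B HuB] := uB; have HB := lindeberg_bounded P D q HuB.
pose Phi (z : n.+1.-tuple Theta * n.+1.-tuple X) : R :=
  lindeberg P D q u (fun k => tnth z.1 (inord k)) (thead z.2) r b
       (tau z.1) [tuple of behead z.2].
have mPhi : measurable_fun setT Phi.
  apply: (measurable_lindeberg P_measurable q mu mD
    (tau := fun k (z : n.+1.-tuple Theta * n.+1.-tuple X) => tnth z.1 (inord k))
    (xi := fun z => thead z.2) (r := fun=> r) (b := fun=> b) (s := fun z => tau z.1)
    (tp := fun z => [tuple of behead z.2])) => //.
  - move=> i; apply: (measurableT_comp (measurable_tnth _)); exact: measurable_fst.
  - apply: (measurableT_comp (measurable_tnth ord0)); exact: measurable_snd.
  - exact: (measurableT_comp mtau measurable_fst).
  - exact: (measurableT_comp (@measurable_behead _ X n) measurable_snd).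
have mPw w : measurable_fun setT (fun t => Phi (tupleRV th n w, t)).
  have mc : measurable_fun setT (fun _ : n.+1.-tuple X => tupleRV th n w) by [].
  exact: (measurableT_comp mPhi (measurable_fun_pair mc (@measurable_id _ _ setT))).
have bPhi : bmeasurable Phi by split => //; exists B => z; exact: HB.
have -> : \int[Pr]_w lindeberg P D q u (fun k => tnth (tupleRV th n w) (inord k)) (Xn 0%N w) r b
       (tau (tupleRV th n w)) [tuple of behead (tupleRV Xn n w)] =
   \int[Pr]_w Phi (tupleRV th n w, tupleRV Xn n w).
  apply: eq_Rintegral => w _; rewrite /Phi /=; congr (lindeberg _ _ _ _ _ _ _ _ _ _).
  by rewrite /thead tnth_mktuple.
rewrite (disintegration P_measurable A5 bPhi).
have mth := @measurable_tupleRV _ _ _ _ _ _ th n.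
apply: (Rintegral_le_bound (probability_setT Pr)).
- apply: (integrable_bounded (probability_setT Pr) (B := B)).
    apply: (measurable_path_int nu P_measurable (tau := fun k w => th k w)
      (Phi := fun v => Phi (tupleRV th n v.1, v.2))) => //.
    apply: (measurableT_comp mPhi).
    exact: (measurable_fun_pair (measurableT_comp mth measurable_fst) measurable_snd).
  move=> w; apply: (path_int_bound nu P_measurable) => [|t]; last exact: HB.
  exact: mPw.
- apply: (integrable_bounded (probability_setT Pr) (B := B)) => //.
  have mc : measurable_fun setT (fun _ : Omega => r) by [].
  exact: (measurableT_comp mu (measurable_fun_pair mc (measurableT_comp mtau mth))).
move=> w; rewrite /path_int.
have chE x : chain_int P (fun k => th k w) x
      (fun t : n.-tuple X => Phi (tupleRV th n w, [tuple of x :: t])) =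
    chain_int P (fun k => th k w) x (lindeberg P D q u
      (fun k => tnth (tupleRV th n w) (inord k)) x r b (tau (tupleRV th n w)) : n.-tuple X -> R).
  congr (chain_int _ _ _ _); apply/funext => t; rewrite /Phi /= theadE.
  by congr (lindeberg _ _ _ _ _ _ _ _ _ _); exact/val_inj.
rewrite -[X in _ - X](Rintegral_cst1 (probability_setT nu)).
have lc x := lindeberg_chain (P := P) P_measurable uB mu mD e0 K0 ustep
  (th := fun k => th k w) (th' := fun k => tnth (tupleRV th n w) (inord k))
  x (tau (tupleRV th n w)) (m := n).
apply: (Rintegral_le_bound (probability_setT nu)).
- apply: (integrable_path_step nu P_measurable (fun k => th k w)
    (h := fun t => Phi (tupleRV th n w, t))).
  split; last by exists B => t; exact: HB.
  exact: mPw.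
- apply: (integrable_bounded (probability_setT nu) (f := cst (u r (tau (tupleRV th n w))))
    (B := B)) => // x; exact: HuB.
- move=> x; rewrite chE; apply: lc => // k kn; rewrite tnth_mktuple inordK//.
  exact: ltnW.
Qed.

End lindeberg_expectation.

(** * Convergence in probability and the limit theorem for one test function *)

Section convergence_tools.
Context dO (Omega : measurableType dO) (R : realType) (Pr : probability Omega R).

Lemma measurable_deviation (Y : Omega -> R) (c eta : R) : measurable_fun setT Y ->
  measurable [set w | eta <= `|Y w - c|].
Proof.
move=> mY; rewrite -[X in measurable X]setTI.
apply: (measurable_fun_ler (f := fun=> eta) (g := fun w => `|Y w - c|) _ _ measurableT
  (Y := [set true])) => //.
by apply: measurableT_comp => //; exact: measurable_funB.
Qed.

Lemma cvg_in_probability_fine (Y : nat -> Omega -> R) (c eta delta : R) :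
  cvg_in_probability Pr Y c -> 0 < eta -> 0 < delta ->
  \forall n \near \oo, fine (Pr [set w | eta <= `|Y n w - c|]) <= delta.
Proof.
move=> [mY cY] e0 d0; have /fine_cvgP[_ /cvgrPdist_le/(_ _ d0)] := cY _ e0.
apply: filterS => n /=; rewrite sub0r normrN; apply: le_trans; exact: ler_norm.
Qed.

(** Otherwise every sample point would deviate from [c] by at least [- c], an event of probability
    one. *)
Lemma cvg_in_probability_ge0 (Y : nat -> Omega -> R) (c : R) :
  cvg_in_probability Pr Y c -> (forall n w, 0 <= Y n w) -> 0 <= c.
Proof.
move=> cY Y0; rewrite leNgt; apply/negP => c0.
have c2 : 0 < - c by rewrite oppr_gt0.
have h2 : (0 : R) < 1 / 2 by [].
have [N _ /(_ N (leqnn N))] := cvg_in_probability_fine cY c2 h2.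
rewrite /= (_ : [set w | _] = setT); first by rewrite probability_setT /=; lra.
apply/seteqP; split => // w _ /=; rewrite ger0_norm ?lerDr//.
by rewrite addr_ge0// oppr_ge0 ltW.
Qed.

Lemma expectation_close (U U' : Omega -> R) (A : set Omega) (B e : R) :
  measurable_fun setT U -> measurable_fun setT U' -> measurable A ->
  (forall w, `|U w| <= B) -> (forall w, `|U' w| <= B) -> 0 <= e ->
  (forall w, ~ A w -> `|U w - U' w| <= e) ->
  `|\int[Pr]_w U w - \int[Pr]_w U' w| <= e + 2 * B * fine (Pr A).
Proof.
move=> mU mU' mA UB UB' e0 UU'.
have iU := integrable_bounded (probability_setT Pr) mU UB.
have iU' := integrable_bounded (probability_setT Pr) mU' UB'.
have mI : measurable_fun setT (\1_A : Omega -> R) by exact: measurable_indic.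
have iA : Pr.-integrable setT (EFin \o (\1_A : Omega -> R)).
  apply: (integrable_bounded (probability_setT Pr) (B := 1)) => // w.
  by rewrite indicE; case: (_ \in _); rewrite ?normr1 ?normr0.
have iA2 := integrableZl measurableT (2 * B) iA.
have ie : Pr.-integrable setT (EFin \o (fun=> e)).
  by apply: (integrable_bounded (probability_setT Pr) (f := cst e) (B := `|e|)).
have -> : e + 2 * B * fine (Pr A) = \int[Pr]_w (e + 2 * B * \1_A w).
  rewrite RintegralD// (RintegralZl _ measurableT iA) (Rintegral_cst1 (probability_setT Pr)).
  by rewrite /Rintegral integral_indic// setIT.
rewrite -RintegralB//; apply: Rintegral_norm_le.
- exact: (integrableB measurableT iU iU').
- exact: (integrableD measurableT ie iA2).
move=> w; rewrite indicE; have [wA|wA] := boolP (w \in A).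
  rewrite mulr1 (le_trans (ler_normB _ _))// (le_trans (lerD (UB w) (UB' w)))//.
  by rewrite -[leLHS]add0r lerD// mulr_natl mulr2n.
rewrite mulr0 addr0; apply: UU' => Aw; move/negP: wA; apply; exact/mem_set.
Qed.

Lemma cvg_in_distribution_Rintegral (Y : nat -> Omega -> R)
    (m : probability (measurableTypeR R) R) (g : R -> R) (B : R) :
  cvg_in_distribution Pr Y m -> continuous g -> (forall x, `|g x| <= B) ->
  \int[Pr]_w g (Y n w) @[n --> \oo] --> \int[m]_x g x.
Proof.
move=> [mY cY] cg gB.
have bg : bounded_fun g := (bounded_fun_ex g).1 (ex_intro _ B gB).
have mg : measurable_fun (setT : set (measurableTypeR R)) g by exact: continuous_measurable_fun.
have ig := integrable_bounded (probability_setT m) mg gB.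
have := cY g cg bg; rewrite unlock => h; apply: fine_cvg.
rewrite fineK; last exact: integrable_fin_num.
exact: h.
Qed.

End convergence_tools.

Section heat_lipschitz.
Context {R : realType}.

(** [heat_increment] restricted to v <= 1, so that v^2 <= v. It absorbs the part of the variance
    budget left over at the end. *)
Lemma heat_time_lipschitz (g g1 g2 : R -> R) (B : R) : test_fun g g1 g2 B ->
  exists2 C : R, 0 <= C & forall r v x, 0 <= r -> 0 <= v -> v <= 1 ->
    `|heat g (r + v) x - heat g r x| <= C * v.
Proof.
move=> tg; have [K K0 hK] := heat_increment tg ltr01.
have B0 : 0 <= B by rewrite (le_trans _ (test_bound tg 0)).
exists (1 + K + B / 2); first by rewrite addr_ge0// ?addr_ge0// divr_ge0.
move=> r v x r0 v0 v1; have := hK r v x r0 v0.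
have h2 : `|heat g2 r x * v / 2| <= B / 2 * v.
  rewrite normrM (ger0_norm (_ : 0 <= 2^-1))// mulrAC normrM (ger0_norm v0) ler_wpM2r//.
  by rewrite ler_wpM2r//;
    exact: (heat_bounded r (unif_cont_continuous (test_uc2 tg)) (test_bound2 tg)).
have h3 : K * v ^+ 2 <= K * v by rewrite ler_wpM2l// expr2 ler_piMl.
move=> h1; rewrite (_ : heat g (r + v) x - heat g r x =
  (heat g (r + v) x - (heat g r x + heat g2 r x * v / 2)) + heat g2 r x * v / 2); last by ring.
rewrite (le_trans (ler_normD _ _))// (le_trans (lerD h1 h2))//.
by move: h3; lra.
Qed.

End heat_lipschitz.

Lemma ler_norm4 (R : realType) (a b c d : R) :
  `|- a + b - c + d| <= `|a| + `|b| + `|c| + `|d|.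
Proof.
rewrite (le_trans (ler_normD _ _))// lerD2r (le_trans (ler_normB _ _))// lerD2r.
by rewrite (le_trans (ler_normD _ _))// normrN.
Qed.

Section test_function_clt.
Context dX dT dO (X : measurableType dX) (Theta : measurableType dT)
  (Omega : measurableType dO) (R : realType) (Pr : probability Omega R).
Variables (P : Theta -> R.-pker X ~> X) (nu : probability X R).
Hypothesis P_measurable : forall A : set X, measurable A ->
  measurable_fun [set: X * Theta] (fun z => P z.2 z.1 A).
Variables (Xn : nat -> {RV Pr >-> X}) (th : nat -> {RV Pr >-> Theta}).
Hypothesis A5 : forall (n : nat) (h : n.+1.-tuple X -> R),
  measurable_fun setT h -> bounded_fun h ->
  is_cond_expectation Pr (g_sigma_preimage (fun i : 'I_n.+1 => th i))
    (fun w => h [tuple Xn i w | i < n.+1])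
    (fun w => path_int P nu (fun k => th k w) h).
Variables (D : Theta -> X -> X -> R) (q : R).
Hypothesis q2 : 2 < q.
Hypothesis mD : measurable_fun setT (fun z : Theta * X * X => D z.1.1 z.1.2 z.2).
Hypothesis iD : forall t x, (P t x).-integrable setT (EFin \o (D t x)).
Hypothesis iD2 : forall t x, (P t x).-integrable setT (EFin \o (fun y => D t x y ^+ 2)).
Hypothesis iDq : forall t x, (P t x).-integrable setT (EFin \o (fun y => `|D t x y| `^ q)).
Hypothesis meanD : forall t x, \int[P t x]_y D t x y = 0.

Let mDx t x : measurable_fun setT (D t x).
Proof.
have mc : measurable_fun setT (fun _ : X => (t, x)) by [].
exact: (measurableT_comp mD (measurable_fun_pair mc (@measurable_id _ X setT))).
Qed.

Let Da (a : R) t x y := a * D t x y.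

Let step_varZ a t x : step_var P (Da a) t x = a ^+ 2 * step_var P D t x.
Proof.
rewrite /step_var -(RintegralZl _ measurableT (iD2 t x)).
by apply: eq_Rintegral => y _; rewrite exprMn.
Qed.

Let step_momZ a t x : 0 <= a -> step_mom P (Da a) q t x = a `^ q * step_mom P D q t x.
Proof.
move=> a0; rewrite /step_mom -(RintegralZl _ measurableT (iDq t x)).
by apply: eq_Rintegral => y _; rewrite normrM powRM// (ger0_norm a0).
Qed.

(** [K] comes before the scale [a], so one constant serves for the factors 1 / sqrt n of all [n]. *)
Let heat_step_scaled g g1 g2 B V0 eps : test_fun g g1 g2 B -> 0 <= V0 -> 0 < eps ->
  exists2 K : R, 0 <= K & forall a, 0 <= a -> forall t x r s, 0 <= r ->
    step_var P (Da a) t x <= V0 ->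
    `|\int[P t x]_y heat g r (s + Da a t x y) - heat g (r + step_var P (Da a) t x) s| <=
      eps * step_var P (Da a) t x + K * step_mom P (Da a) q t x.
Proof.
move=> tg V00 e0; have [K K0 hK] := heat_step tg q2 V00 e0.
exists K => // a a0 t x r s r0 vV.
apply: (hK _ _ (P t x) (Da a t x) (prob_kernel x)) => //.
- exact: measurable_funM.
- exact: (integrableZl measurableT a (iD t x)).
- apply: eq_integrable (integrableZl measurableT (a ^+ 2) (iD2 t x)) => // y _.
  by rewrite /= -EFinM exprMn.
- apply: eq_integrable (integrableZl measurableT (a `^ q) (iDq t x)) => // y _.
  by rewrite /= -EFinM normrM powRM// (ger0_norm a0).
- by rewrite (RintegralZl _ measurableT (iD t x)) meanD mulr0.
Qed.

Variables (sigma2 s : R) (tau : forall n, n.+1.-tuple Theta -> R).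
Arguments tau : clear implicits.
Hypothesis s0 : 0 < s.
Hypothesis mtau : forall n, measurable_fun setT (tau n).
Let a_ n : R := (Num.sqrt n%:R)^-1.
Hypothesis cvg_var : cvg_in_probability Pr (fun n w =>
  n%:R^-1 * \sum_(0 <= k < n) step_var P D (th k w) (Xn k w)) sigma2.
Hypothesis cvg_mom : cvg_in_probability Pr (fun n w =>
  a_ n `^ q * \sum_(0 <= k < n) step_mom P D q (th k w) (Xn k w)) 0.
Hypothesis cvg_tau : cvg_in_distribution Pr (fun n w => tau n (tupleRV th n w))
  (normal_prob 0 s).

Let a0 n : 0 <= a_ n. Proof. by rewrite invr_ge0 sqrtr_ge0. Qed.

Let a2 n : a_ n ^+ 2 = n%:R^-1.
Proof. by rewrite exprVn sqr_sqrtr. Qed.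

Let Y n w := a_ n * \sum_(0 <= k < n) D (th k w) (Xn k w) (Xn k.+1 w) + tau n (tupleRV th n w).

Let sigma2_ge0 : 0 <= sigma2.
Proof.
apply: (cvg_in_probability_ge0 cvg_var) => n w.
rewrite mulr_ge0// sumr_ge0// => k _; apply: Rintegral_ge0 => y _; exact: sqr_ge0.
Qed.

Let mY n : measurable_fun setT (Y n).
Proof.
have m2 : measurable_fun setT (fun w => tau n (tupleRV th n w)).
  exact: (measurableT_comp (@mtau n) (@measurable_tupleRV _ _ _ _ _ _ th n)).
apply: measurable_funD => //.
apply: measurable_funM => //; apply: measurable_sum => k.
exact: (measurableT_comp mD (measurable_fun_pair (measurable_fun_pair
  (measurable_funP (th k)) (measurable_funP (Xn k))) (measurable_funP (Xn k.+1)))).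
Qed.

Let lind g n r b w := lindeberg P (Da (a_ n)) q (heat g)
  (fun k => tnth (tupleRV th n w) (inord k)) (Xn 0%N w) r b
  (tau n (tupleRV th n w)) [tuple of behead (tupleRV Xn n w)].

Let lind_good g n r b w :
  n%:R^-1 * \sum_(0 <= k < n) step_var P D (th k w) (Xn k w) <= r ->
  a_ n `^ q * \sum_(0 <= k < n) step_mom P D q (th k w) (Xn k w) <= b ->
  lind g n r b w =
    heat g (r - n%:R^-1 * \sum_(0 <= k < n) step_var P D (th k w) (Xn k w)) (Y n w).
Proof.
have thE (j : 'I_n) : tnth (tupleRV th n w) (inord j) = th j w.
  by rewrite tnth_mktuple inordK// ltnS ltnW.
have vE : \sum_(j < n) step_var P (Da (a_ n)) (tnth (tupleRV th n w) (inord j)) (Xn j w) =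
    n%:R^-1 * \sum_(0 <= k < n) step_var P D (th k w) (Xn k w).
  by rewrite big_mkord mulr_sumr; apply: eq_bigr => j _; rewrite step_varZ a2 thE.
have mE : \sum_(j < n) step_mom P (Da (a_ n)) q (tnth (tupleRV th n w) (inord j)) (Xn j w) =
    a_ n `^ q * \sum_(0 <= k < n) step_mom P D q (th k w) (Xn k w).
  by rewrite big_mkord mulr_sumr; apply: eq_bigr => j _; rewrite step_momZ// thE.
move=> hv hm; rewrite /lind (lindeberg_good (heat g) (xs := fun k => Xn k w)).
- rewrite vE; congr (heat _ _ _); rewrite /Y big_mkord mulr_sumr addrC; congr (_ + _).
  by apply: eq_bigr => j _; rewrite thE.
- move=> i; rewrite tnth_behead tnth_mktuple inordK// ltnS; exact: ltn_ord.
- by rewrite vE.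
- by rewrite mE.
Qed.

Let measurable_lind g B n r b : continuous g -> bounded_by g B ->
  measurable_fun setT (lind g n r b).
Proof.
move=> cg gB.
have mDa : measurable_fun setT (fun z : Theta * X * X => Da (a_ n) z.1.1 z.1.2 z.2).
  exact: measurable_funM.
have mT := @measurable_tupleRV _ _ _ _ _ _ th n.
have mX := @measurable_tupleRV _ _ _ _ _ _ Xn n.
apply: (measurable_lindeberg P_measurable q (measurable_heat cg) mDa
  (tau := fun k w => tnth (tupleRV th n w) (inord k)) (xi := fun w => Xn 0%N w)
  (r := fun=> r) (b := fun=> b) (s := fun w => tau n (tupleRV th n w))
  (tp := fun w => [tuple of behead (tupleRV Xn n w)])) => //.
- by move=> i; exact: (measurableT_comp (measurable_tnth _) mT).
- exact: (measurableT_comp (@mtau n) mT).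
- exact: (measurableT_comp (@measurable_behead _ X n) mX).
Qed.

(** The stopped functional [lind] stands between the two sides. On the event that both budgets
    suffice it is close to [g (Y n)]; in mean it is close to [heat g r0] at tau, which by [cvg_tau]
    tends in mean to [heat g (r0 + s ^+ 2) 0]. The constants are chosen in the order [eta], [r0],
    [K], [b], each depending on the earlier ones. *)
Lemma test_function_clt g g1 g2 B : test_fun g g1 g2 B ->
  \int[Pr]_w g (Y n w) @[n --> \oo] -->
  \int[normal_prob 0 (Num.sqrt (sigma2 + s ^+ 2))]_x g x.
Proof.
move=> tg; have cg := unif_cont_continuous (test_uc tg).
have gB := test_bound tg; have B0 : 0 <= B by rewrite (le_trans _ (gB 0)).
have normE (v : R) (h : R -> R) (C : R) : 0 < v -> continuous h -> bounded_by h C ->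
    \int[normal_prob 0 (Num.sqrt v)]_x h x = heat h v 0.
  by move=> v0 ch hC; rewrite -(Rintegral_normal_affine 0 _ ch hC) ?sqrtr_gt0.
have ss0 : 0 < s ^+ 2 by rewrite exprn_gt0.
rewrite (normE _ g B)//; last by rewrite ltr_wpDl.
have [C C0 hC] := heat_time_lipschitz tg.
apply/cvgrPdist_le => e e0.
(* Six shares: one for the extra variance [eta] in the limit, one for the convergence of tau, two
   for the replacement error, two for passing from [lind] to [g (Y n)]. *)
pose e6 := e / 6; have e60 : 0 < e6 by rewrite divr_gt0.
have eE : e = e6 + e6 + 2 * e6 + (e6 + e6) by rewrite /e6; field.
have C10 : 0 < C + 1 by lra.
(* Two exceptional events, each of probability at most [e6 / (4 * (B + 1))], together contribute at
   most [e6]. *)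
have Bk (p : R) : 0 <= p -> p <= e6 / (4 * (B + 1)) + e6 / (4 * (B + 1)) -> 2 * B * p <= e6.
  have -> : e6 / (4 * (B + 1)) + e6 / (4 * (B + 1)) = e6 / (2 * (B + 1)) by field; lra.
  move=> p0; rewrite ler_pdivlMr; last by lra.
  rewrite mulrC; apply: le_trans; apply: ler_wpM2r => //; lra.
(* The leftover variance is at most [2 * eta]: within the range v <= 1 of the Lipschitz bound, and
   at a cost of at most [e6]. *)
pose eta := Num.min 2^-1 (e6 / (2 * (C + 1))).
have eta0 : 0 < eta by rewrite lt_min invr_gt0 ltr0n /= divr_gt0// mulr_gt0.
have eta1 : 2 * eta <= 1.
  by rewrite -ler_pdivlMl// mulr1 ge_min lexx.
have Ceta : C * (2 * eta) <= e6.
  have : eta <= e6 / (2 * (C + 1)) by rewrite ge_min lexx orbT.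
  by rewrite ler_pdivlMr ?mulr_gt0//; lra.
pose r0 := sigma2 + eta; have r00 : 0 < r0 by rewrite ltr_wpDl.
have eps0 : 0 < e6 / r0 by rewrite divr_gt0.
have [K K0 hK] := heat_step_scaled tg (ltW r00) eps0.
have K10 : 0 < K + 1 by lra.
pose b := e6 / (K + 1); have b0 : 0 < b by rewrite divr_gt0.
have Kb : K * b <= e6 by rewrite /b mulrCA ler_piMr ?(ltW e60)// ler_pdivrMr// mul1r lerDl.
have d0 : 0 < e6 / (4 * (B + 1)) by rewrite divr_gt0// mulr_gt0//; lra.
have dk : e6 / r0 * r0 = e6 := divfK (lt0r_neq0 r00) e6.
have uc0 := heat_unif_cont r0 (test_uc tg) gB.
have hB0 := heat_bounded r0 cg gB.
have N3 : \int[normal_prob 0 s]_x heat g r0 x = heat g (r0 + s ^+ 2) 0.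
  rewrite -(heat_semigroup 0 (test_uc tg) gB (ltW r00) (ltW ss0)).
  rewrite -(normE _ _ B ss0 (unif_cont_continuous uc0) hB0).
  by rewrite sqrtr_sqr gtr0_norm.
have h4 : `|heat g (r0 + s ^+ 2) 0 - heat g (sigma2 + s ^+ 2) 0| <= e6.
  have -> : r0 + s ^+ 2 = (sigma2 + s ^+ 2) + eta by rewrite /r0; ring.
  have p0 : 0 <= sigma2 + s ^+ 2 := addr_ge0 sigma2_ge0 (ltW ss0).
  have p1 : eta <= 1 by move: eta1; have := eta0; lra.
  apply: (le_trans (hC _ _ 0 p0 (ltW eta0) p1)).
  by move: Ceta; have := mulr_ge0 C0 (ltW eta0); lra.
have key n :
    `|heat g (r0 + s ^+ 2) 0 - \int[Pr]_w heat g r0 (tau n (tupleRV th n w))| <= e6 ->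
    fine (Pr [set w | eta <= `|n%:R^-1 *
      \sum_(0 <= k < n) step_var P D (th k w) (Xn k w) - sigma2|]) <= e6 / (4 * (B + 1)) ->
    fine (Pr [set w | b <= `|a_ n `^ q *
      \sum_(0 <= k < n) step_mom P D q (th k w) (Xn k w) - 0|]) <= e6 / (4 * (B + 1)) ->
    `|heat g (sigma2 + s ^+ 2) 0 - \int[Pr]_w g (Y n w)| <= e.
  move=> h3 PA1 PA2.
  have mlind := measurable_lind n r0 b cg gB.
  have Blind w : `|lind g n r0 b w| <= B.
    by apply: lindeberg_bounded => r x; exact: (heat_bounded r cg gB x).
  pose V w := n%:R^-1 * \sum_(0 <= k < n) step_var P D (th k w) (Xn k w).
  pose Mo w := a_ n `^ q * \sum_(0 <= k < n) step_mom P D q (th k w) (Xn k w).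
  pose A1 := [set w | eta <= `|V w - sigma2|].
  pose A2 := [set w | b <= `|Mo w - 0|].
  rewrite -/A1 in PA1; rewrite -/A2 in PA2.
  have h5 : `|\int[Pr]_w lind g n r0 b w - \int[Pr]_w heat g r0 (tau n (tupleRV th n w))| <=
      2 * e6.
    have hu : exists B : R, forall r x, `|heat g r x| <= B.
      by exists B => r x; exact: (heat_bounded r cg gB).
    have mDa : measurable_fun setT (fun z : Theta * X * X => Da (a_ n) z.1.1 z.1.2 z.2).
      exact: measurable_funM.
    have h := lindeberg_expectation (P := P) (nu := nu) P_measurable A5 (n := n)
      (D := Da (a_ n)) (q := q) (u := heat g) (tau := tau n) (V0 := r0) (eps := e6 / r0)
      (K := K) (r := r0) (b := b) (@mtau n) hu (measurable_heat cg) mDa (ltW eps0) K0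
      (hK _ (a0 n)) (ltW r00) (lexx _) (ltW b0).
    rewrite dk in h; apply: (le_trans h).
    by rewrite mulr_natl mulr2n lerD2l.
  have mA1 : measurable A1 := measurable_deviation _ _ (proj1 cvg_var n).
  have mA2 : measurable A2 := measurable_deviation _ _ (proj1 cvg_mom n).
  have h6 : `|\int[Pr]_w lind g n r0 b w - \int[Pr]_w g (Y n w)| <=
      e6 + 2 * B * fine (Pr (A1 `|` A2)).
    apply: expectation_close.
    - exact: mlind.
    - exact: (measurableT_comp (continuous_measurable_fun cg) (mY n)).
    - exact: measurableU.
    - by move=> w; exact: Blind.
    - by move=> w; exact: gB.
    - exact: ltW.
    (* Off the two events |V - sigma2| < eta, so the variance used stays below [r0] and leaves
       between 0 and [2 * eta]. *)
    move=> w; rewrite /A1 /A2 /= => /not_orP[/negP + /negP].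
    rewrite -!ltNge subr0 ltr_distl => /andP[v1 v2] m1.
    rewrite lind_good; last 2 first.
    - exact: (ltW v2).
    - exact: (le_trans (ler_norm _) (ltW m1)).
    rewrite -/(V w) -(heat0 g (Y n w)) -[r0 - V w]add0r.
    have p0 : 0 <= r0 - V w by rewrite subr_ge0 ltW.
    have p2 : r0 - V w <= 2 * eta by move: v1; rewrite /r0; lra.
    apply: (le_trans (hC _ _ (Y n w) (lexx 0) p0 (le_trans p2 eta1))).
    by apply: le_trans Ceta; rewrite ler_wpM2l.
  have h7 : 2 * B * fine (Pr (A1 `|` A2)) <= e6.
    have pU : fine (Pr (A1 `|` A2)) <= fine (Pr A1) + fine (Pr A2).
      have f1 := @fin_num_measure _ _ _ Pr _ mA1.
      have f2 := @fin_num_measure _ _ _ Pr _ mA2.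
      have f3 := @fin_num_measure _ _ _ Pr _ (measurableU _ _ mA1 mA2).
      rewrite -lee_fin EFinD (fineK f1) (fineK f2) (fineK f3).
      exact: measureU2.
    exact: (Bk _ (fine_ge0 (measure_ge0 _ _)) (le_trans pU (lerD PA1 PA2))).
  have -> : heat g (sigma2 + s ^+ 2) 0 - \int[Pr]_w g (Y n w) =
    - (heat g (r0 + s ^+ 2) 0 - heat g (sigma2 + s ^+ 2) 0) +
    (heat g (r0 + s ^+ 2) 0 - \int[Pr]_w heat g r0 (tau n (tupleRV th n w))) -
    (\int[Pr]_w lind g n r0 b w - \int[Pr]_w heat g r0 (tau n (tupleRV th n w))) +
    (\int[Pr]_w lind g n r0 b w - \int[Pr]_w g (Y n w)) by ring.
  apply: (le_trans (ler_norm4 _ _ _ _)).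
  rewrite eE; apply: lerD; last exact: (le_trans h6 (lerD (lexx _) h7)).
  by apply: lerD h5; exact: lerD.
have H1 := cvg_in_probability_fine cvg_var eta0 d0.
have H2 := cvg_in_probability_fine cvg_mom b0 d0.
have := cvg_in_distribution_Rintegral cvg_tau (unif_cont_continuous uc0) hB0.
rewrite N3 => /cvgrPdist_le/(_ _ e60) H3.
apply: filterS3 H3 H1 H2 => n; exact: key.
Qed.

End test_function_clt.

(** * Weak convergence from smooth test functions *)

Section smoothing.
Context {R : realType}.
Notation mu := (@lebesgue_measure R).

Lemma mean_value (f df : R -> R) : (forall x : R, is_derive x 1 f (df x)) ->
  forall x d, exists2 c, `|c - x| <= `|d| & f (x + d) - f x = df c * d.
Proof.
move=> fdf x d.
have cf : continuous f.
  move=> z; apply: differentiable_continuous; apply/derivable1_diffP.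
  exact: (@ex_derive _ _ _ _ _ _ _ (fdf z)).
have [d0|d0] := leP 0 d.
  have [||c cxd ->] := @MVT_segment R f df x (x + d).
  - by rewrite lerDl.
  - exact: continuous_subspaceT.
  exists c; last by congr (_ * _); ring.
  by move: cxd; rewrite in_itv /= => /andP[c1 c2]; rewrite !ger0_norm; lra.
have [||c cxd cE] := @MVT_segment R f df (x + d) x.
- by lra.
- exact: continuous_subspaceT.
exists c.
  by move: cxd; rewrite in_itv /= => /andP[c1 c2]; rewrite (ltr0_norm d0) ler0_norm; lra.
by rewrite -[LHS]opprB cE; ring.
Qed.

Lemma unif_cont_bounded_derive (f df : R -> R) (B : R) :
  (forall x : R, is_derive x 1 f (df x)) -> bounded_by df B -> unif_cont f.
Proof.
move=> fdf dB e e0; have B0 : 0 <= B by rewrite (le_trans _ (dB 0)).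
have B1 : 0 < B + 1 by lra.
exists (e / (B + 1)); first by rewrite divr_gt0.
move=> x d; rewrite ler_pdivlMr// => dd.
have [c _ ->] := mean_value fdf x d.
rewrite normrM (le_trans _ dd)// mulrC ler_wpM2l//.
by rewrite (le_trans (dB c))// lerDl.
Qed.

(** As [f] vanishes left of [a], the integral from minus infinity is one over a compact interval and
    the fundamental theorem applies. The primitive vanishes there too, so the construction can be
    repeated. *)
Lemma primitive_exists (f : R -> R) (a : R) : continuous f -> (forall x, x <= a -> f x = 0) ->
  exists2 F : R -> R, (forall x : R, is_derive x 1 F (f x)) & forall x, x <= a -> F x = 0.
Proof.
move=> cf f0.
have fE (x : R) : f \_ `]-oo, x] = f \_ `[a, x].
  apply/funext => t; rewrite !patchE; case: ifPn => [/set_mem|/negP tx].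
    rewrite /= in_itv /= => tx; have [ta|ta] := leP a t.
      by rewrite mem_set//= in_itv /= ta.
    rewrite memNset; first exact/f0/ltW.
    by rewrite /= in_itv /= leNgt ta.
  by rewrite memNset// /= in_itv /= => /andP[_ tx']; apply: tx; rewrite mem_set//= in_itv.
have intf (u : R) : mu.-integrable `]-oo, u] (EFin \o f).
  have h : mu.-integrable `[a, u] (EFin \o f).
    apply: continuous_compact_integrable; first exact: segment_compact.
    exact: continuous_subspaceT.
  have m1 : measurable (`]-oo, u]%classic : set (measurableTypeR R)) by exact: measurable_itv.
  have m2 : measurable (`[a, u]%classic : set (measurableTypeR R)) by exact: measurable_itv.
  apply: (proj2 (integrable_mkcond (mu := mu) (EFin \o f) m1)).
  rewrite restrict_EFin fE -restrict_EFin.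
  exact: (proj1 (integrable_mkcond (mu := mu) (EFin \o f) m2) h).
exists (fun x => \int[mu]_(t in `]-oo, x]) f t).
  move=> x; have [||dF FE] := @continuous_FTC1 R f -oo%O x (x + 1) _ (intf _) _ (cf x).
  - by rewrite ltrDl.
  - by rewrite ltNyr.
  by apply: DeriveDef; [exact: dF | rewrite -derive1E; exact: FE].
move=> x xa; rewrite (_ : \int[mu]_(t in `]-oo, x]) f t = \int[mu]_(t in `]-oo, x]) 0).
  by rewrite Rintegral_cst// mul0r.
apply: eq_Rintegral => t /set_mem; rewrite /= in_itv /= => tx; apply: f0.
exact: le_trans xa.
Qed.

(** Uniform continuity on a compact interval with a margin of 1 around the support; from outside it,
    steps of length at most 1 do not reach the support. *)
Lemma compact_support_unif_cont (g : R -> R) (A : R) : continuous g ->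
  (forall x, A <= `|x| -> g x = 0) -> unif_cont g.
Proof.
move=> cg g0 e e0.
have /compact_near_coveringP nc : compact `[- (A + 1), A + 1] by exact: segment_compact.
have cover (x : R) : `[- (A + 1), A + 1]%classic x ->
    \forall x' \near x & d' \near 0^'+, forall y, `|y - x'| <= d' -> `|g y - g x'| <= e.
  move=> _; have e20 : 0 < e / 2 by rewrite divr_gt0.
  have := cg x; move/cvgrPdist_le => /(_ _ e20) /nbhs_ballP [d /= d0 gd].
  have d20 : 0 < d / 2 by rewrite divr_gt0.
  near=> x' d' => y /= yx'.
  have xx' : `|x - x'| < d / 2.
    by near: x'; exact: nbhsx_ballx.
  have dd' : d' <= d / 2 by near: d'; exact: nbhs_right_le.
  have h1 : `|g x - g x'| <= e / 2.
    by apply: gd; rewrite /ball /=; move: xx'; lra.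
  have h2 : `|g x - g y| <= e / 2.
    apply: gd; rewrite /ball /= (_ : x - y = (x - x') - (y - x')); last by ring.
    by rewrite (le_lt_trans (ler_normB _ _))//; lra.
  rewrite (_ : g y - g x' = (g x - g x') - (g x - g y)); last by ring.
  by rewrite (le_trans (ler_normB _ _))//; lra.
have F0 : Filter (0:R)^'+ by exact: at_right_proper_filter.
have := nc R 0^'+ _ F0 cover => -[d /= d0 hd].
have m0 : 0 < Num.min 1 (d / 2) by rewrite lt_min ltr01 divr_gt0.
exists (Num.min 1 (d / 2)) => // x h.
rewrite le_min => /andP[h1 hd2].
have [xA|xA] := leP `|x| (A + 1).
  apply: (hd (d / 2)).
  - by rewrite /ball /= sub0r normrN gtr0_norm ?divr_gt0//; lra.
  - by rewrite divr_gt0.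
  - by rewrite /= in_itv /= -ler_norml.
  - by rewrite addrAC subrr add0r.
rewrite !g0 ?subrr ?normr0 ?(ltW e0)//; first by lra.
by have := ler_normB (x + h) h; rewrite addrK; lra.
Unshelve. all: by end_near. Qed.

End smoothing.

Section smooth_approximation.
Context {R : realType}.

(** The mean value theorem, twice: the modulus of continuity of [g] controls the remainder of [F],
    and this is the derivative, in the step, of the remainder of [H]. *)
Lemma second_primitive_taylor (g F H : R -> R) (eps delta : R) :
  (forall x : R, is_derive x 1 H (F x)) -> (forall x : R, is_derive x 1 F (g x)) ->
  (forall x d, `|d| <= delta -> `|g (x + d) - g x| <= eps) ->
  (forall x d, `|d| <= delta -> `|F (x + d) - (F x + g x * d)| <= eps * `|d|) /\
  (forall x d, `|d| <= delta ->
    `|H (x + d) - (H x + F x * d + g x * d ^+ 2 / 2)| <= eps * d ^+ 2).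
Proof.
move=> dH dF gd.
have h1 x d : `|d| <= delta -> `|F (x + d) - (F x + g x * d)| <= eps * `|d|.
  move=> dd; have [c cx cE] := mean_value dF x d.
  rewrite opprD addrA cE -mulrBl normrM ler_wpM2r//.
  have -> : g c = g (x + (c - x)) by congr g; ring.
  apply: gd.
  exact: le_trans dd.
split=> // x d dd.
pose phi h := H (x + h) - (H x + F x * h + g x * h ^+ 2 / 2).
have dphi (h : R) : is_derive h 1 phi (F (x + h) - (F x + g x * h)).
  have dHx : is_derive h 1 (fun h => H (x + h)) (F (x + h)).
    have dx : is_derive h (1 : R) (fun h : R => x + h) 1.
      by apply: is_derive_eq; ring.
    by have := @is_derive1_comp _ H (fun h : R => x + h) h _ _ (dH _) dx; rewrite mulr1.
  by apply: is_derive_eq; rewrite /GRing.scale /=; field.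
have [c cx cE] := mean_value dphi 0 d.
have phi0 : phi 0 = 0 by rewrite /phi addr0; ring.
move: cE; rewrite add0r phi0 subr0 => cE; rewrite -/(phi d) cE.
rewrite subr0 in cx.
rewrite normrM (le_trans (ler_wpM2r _ (h1 x c (le_trans cx dd))))//.
have e0 : 0 <= eps by rewrite (le_trans _ (gd x d dd)).
by rewrite -mulrA ler_wpM2l// -[d ^+ 2]ger0_norm ?sqr_ge0// normrX expr2 ler_wpM2r.
Qed.

(** [G] is the scaled second difference of a second primitive [H] of [g], that is, the average of
    [g] against a tent kernel on an interval of length [2 * dl]. Its derivatives are the second
    differences of [F] and of [g]. All three are bounded although [H] need not be: the first lies
    near [g], the second because [F] is Lipschitz, the third because [g] is bounded. *)
Lemma test_fun_approx (g : R -> R) (A B eps : R) : continuous g ->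
  (forall x, A <= `|x| -> g x = 0) -> bounded_by g B -> 0 < eps ->
  exists G G1 G2 C, test_fun G G1 G2 C /\ forall x, `|G x - g x| <= eps.
Proof.
move=> cg gA gB e0; have ug := compact_support_unif_cont cg gA.
have B0 : 0 <= B by rewrite (le_trans _ (gB 0)).
have gA' x : x <= - `|A| -> g x = 0.
  by move=> xA; apply: gA; have := ler_norm A; have := ler_norm (- x); rewrite normrN; lra.
have [F dF F0] := primitive_exists cg gA'.
have cF : continuous F.
  move=> z; apply: differentiable_continuous; apply/derivable1_diffP.
  exact: (@ex_derive _ _ _ _ _ _ _ (dF z)).
have [H dH _] := primitive_exists cF F0.
have e3 : 0 < eps / 3 by rewrite divr_gt0.
have [dl d0 gd] := ug _ e3.
have dn0 := lt0r_neq0 d0.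
have [_ HT] := second_primitive_taylor dH dF gd.
pose avg f x := (f (x + 2 * dl) - 2 * f (x + dl) + f x) / dl ^+ 2.
have davg (f df : R -> R) : (forall x : R, is_derive x 1 f (df x)) ->
    forall x : R, is_derive x 1 (avg f) (avg df x).
  move=> fdf x.
  have sh (a : R) : is_derive x 1 (fun x => f (x + a)) (df (x + a)).
    have dx : is_derive x (1 : R) (fun h : R => h + a) 1.
      by apply: is_derive_eq; ring.
    by have := @is_derive1_comp _ f (fun h : R => h + a) x _ _ (fdf _) dx; rewrite mulr1.
  have s1 := sh (2 * dl); have s2 := sh dl.
  by apply: is_derive_eq; rewrite /avg /GRing.scale /=; ring.
have gG x : `|avg H x - g x| <= eps.
  have t1 := HT (x + dl) dl; have t2 := HT (x + dl) (- dl).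
  rewrite normrN gtr0_norm// in t1 t2.
  have {}t1 := t1 (lexx _); have {}t2 := t2 (lexx _).
  have t3 := gd x dl; rewrite gtr0_norm// in t3; have {}t3 := t3 (lexx _).
  rewrite sqrrN addrK in t2.
  (* Expanded at the midpoint [x + dl]: the first order terms cancel and the second order ones add
     up to [g (x + dl)]. *)
  have -> : avg H x - g x =
      ((H (x + dl + dl) - (H (x + dl) + F (x + dl) * dl + g (x + dl) * dl ^+ 2 / 2)) +
       (H x - (H (x + dl) + F (x + dl) * - dl + g (x + dl) * dl ^+ 2 / 2))) / dl ^+ 2 +
      (g (x + dl) - g x).
    by rewrite /avg (_ : x + 2 * dl = x + dl + dl); [field | ring].
  rewrite (le_trans (ler_normD _ _))// (_ : eps = (eps / 3 + eps / 3) + eps / 3); last by field.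
  rewrite lerD// normrM normfV (ger0_norm (sqr_ge0 dl)) ler_pdivrMr ?exprn_gt0//.
  by rewrite (le_trans (ler_normD _ _))// mulrDl lerD.
have ucF : unif_cont F := unif_cont_bounded_derive dF gB.
have avgB f C : bounded_by f C -> bounded_by (avg f) (4 * C / dl ^+ 2).
  move=> fC x; rewrite /avg normrM normfV (ger0_norm (sqr_ge0 dl)) ler_wpM2r ?invr_ge0 ?sqr_ge0//.
  rewrite (le_trans (ler_normD _ _))// (le_trans (lerD (ler_normB _ _) (lexx _)))//.
  rewrite normrM (ger0_norm (_ : 0 <= 2))//.
  by have := fC (x + 2 * dl); have := fC (x + dl); have := fC x; lra.
have avgU f : unif_cont f -> unif_cont (avg f).
  (* The weights 1, 2, 1 of the second difference add up to 4. *)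
  move=> uf e1 e10; have e4 : 0 < e1 * dl ^+ 2 / 4 by rewrite divr_gt0// mulr_gt0// exprn_gt0.
  have [d1 d10 fd] := uf _ e4; exists d1 => // x d dd.
  rewrite (_ : avg f (x + d) - avg f x =
    ((f (x + 2 * dl + d) - f (x + 2 * dl)) - 2 * (f (x + dl + d) - f (x + dl)) +
     (f (x + d) - f x)) / dl ^+ 2); last first.
    by rewrite /avg !(addrAC x d); ring.
  rewrite normrM normfV (ger0_norm (sqr_ge0 dl)) ler_pdivrMr ?exprn_gt0//.
  rewrite (le_trans (ler_normD _ _))// (le_trans (lerD (ler_normB _ _) (lexx _)))//.
  rewrite normrM (ger0_norm (_ : 0 <= 2))//.
  by have := fd (x + 2 * dl) d dd; have := fd (x + dl) d dd; have := fd x d dd; lra.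
have FL x d : `|F (x + d) - F x| <= B * `|d|.
  by have [c _ ->] := mean_value dF x d; rewrite normrM ler_wpM2r.
have avgF : bounded_by (avg F) (2 * B / dl).
  move=> x; rewrite (_ : avg F x = ((F (x + dl + dl) - F (x + dl)) - (F (x + dl) - F x)) / dl ^+ 2).
    rewrite normrM normfV (ger0_norm (sqr_ge0 dl)) ler_pdivrMr ?exprn_gt0//.
    rewrite (le_trans (ler_normB _ _))// (le_trans (lerD (FL _ _) (FL _ _)))//.
    by rewrite (gtr0_norm d0) le_eqVlt; apply/orP; left; apply/eqP; field.
  by rewrite /avg (_ : x + 2 * dl = x + dl + dl); [field | ring].
pose C := Num.max (B + eps) (Num.max (2 * B / dl) (4 * B / dl ^+ 2)).
exists (avg H), (avg F), (avg g), C; split => //.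
have bC f c : bounded_by f c -> c <= C -> bounded_by f C.
  by move=> fc cC x; exact: le_trans cC.
constructor.
- exact: (unif_cont_bounded_derive (davg _ _ dH) avgF).
- exact: avgU.
- exact: avgU.
- apply: (bC _ (B + eps)); last by rewrite /C le_max lexx.
  move=> x; rewrite -[avg H x](subrK (g x)) addrC (le_trans (ler_normD _ _))//.
  by rewrite lerD.
- by apply: (bC _ _ avgF); rewrite /C !le_max lexx orbT.
- by apply: (bC _ _ (avgB _ _ gB)); rewrite /C !le_max lexx !orbT.
move=> e1 e10; have e4 : 0 < e1 * dl ^+ 2 / 4 by rewrite divr_gt0// mulr_gt0// exprn_gt0.
have [d1 d10 gd1] := ug _ e4; exists d1 => // x d dd.
have [_ HT1] := second_primitive_taylor dH dF gd1.
pose T y := H (y + d) - (H y + F y * d + g y * d ^+ 2 / 2).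
rewrite (_ : avg H (x + d) - (avg H x + avg F x * d + avg g x * d ^+ 2 / 2) =
  (T (x + 2 * dl) - 2 * T (x + dl) + T x) / dl ^+ 2); last first.
  by rewrite /avg /T !(addrAC x d); field.
rewrite normrM normfV (ger0_norm (sqr_ge0 dl)) ler_pdivrMr ?exprn_gt0//.
rewrite (le_trans (ler_normD _ _))// (le_trans (lerD (ler_normB _ _) (lexx _)))//.
rewrite normrM (ger0_norm (_ : 0 <= 2))//.
have T1 y : `|T y| <= e1 * dl ^+ 2 / 4 * d ^+ 2 by exact: HT1.
have := T1 (x + 2 * dl); have := T1 (x + dl); have := T1 x.
rewrite (_ : e1 * d ^+ 2 * dl ^+ 2 = 4 * (e1 * dl ^+ 2 / 4 * d ^+ 2)); last by field.
lra.
Qed.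

End smooth_approximation.

Section portmanteau.
Context dO (Omega : measurableType dO) (R : realType) (Pr : probability Omega R).
Variables (Y : nat -> Omega -> R) (m : probability (measurableTypeR R) R).
Hypothesis mY : forall n, measurable_fun setT (Y n).

Let cvg_uniform_approx (g : R -> R) :
  (forall e : R, 0 < e -> exists h : R -> R, [/\
      \int[Pr]_w h (Y n w) @[n --> \oo] --> \int[m]_x h x,
      `|\int[m]_x h x - \int[m]_x g x| <= e &
      \forall n \near \oo, `|\int[Pr]_w h (Y n w) - \int[Pr]_w g (Y n w)| <= e]) ->
  \int[Pr]_w g (Y n w) @[n --> \oo] --> \int[m]_x g x.
Proof.
move=> happrox; apply/cvgrPdist_le => e e0.
have e3 : 0 < e / 3 by rewrite divr_gt0.
have [h [cvh hm hn]] := happrox _ e3.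
move/cvgrPdist_le : cvh => /(_ _ e3); apply: filterS2 hn => n h1 h2.
rewrite (_ : _ - _ = - (\int[m]_x h x - \int[m]_x g x) +
  (\int[m]_x h x - \int[Pr]_w h (Y n w)) - 0 +
  (\int[Pr]_w h (Y n w) - \int[Pr]_w g (Y n w))); last by ring.
rewrite (le_trans (ler_normD _ _))// (le_trans (lerD (ler_normB _ _) (lexx _)))//.
rewrite normr0 addr0 (le_trans (lerD (ler_normD _ _) (lexx _)))// normrN.
have -> : e = e / 3 + e / 3 + e / 3 by field.
by rewrite lerD// lerD.
Qed.

Hypothesis cvg_test : forall (g g1 g2 : R -> R) (B : R), test_fun g g1 g2 B ->
  \int[Pr]_w g (Y n w) @[n --> \oo] --> \int[m]_x g x.

Let measurable_compY (g : R -> R) n : continuous g -> measurable_fun setT (fun w => g (Y n w)).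
Proof.
move=> cg; exact: (measurableT_comp (continuous_measurable_fun cg) (mY n)).
Qed.

Let integrableY (g : R -> R) B n : continuous g -> bounded_by g B ->
  Pr.-integrable setT (EFin \o (fun w => g (Y n w))).
Proof.
move=> cg gB; apply: (integrable_bounded (probability_setT Pr) (B := B)) => //.
exact: measurable_compY.
Qed.

Let integrablem (g : R -> R) B : continuous g -> bounded_by g B ->
  m.-integrable setT (EFin \o g).
Proof.
move=> cg gB; apply: (integrable_bounded (probability_setT m) (B := B)) => //.
exact: continuous_measurable_fun.
Qed.

Let cvg_compact_support (g : R -> R) (A B : R) : continuous g ->
  (forall x, A <= `|x| -> g x = 0) -> bounded_by g B ->
  \int[Pr]_w g (Y n w) @[n --> \oo] --> \int[m]_x g x.
Proof.
move=> cg gA gB; apply: cvg_uniform_approx => e e0.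
have [G [G1 [G2 [C [tG Gg]]]]] := test_fun_approx cg gA gB e0.
have cG := unif_cont_continuous (test_uc tG).
have GC := test_bound tG.
exists G; split.
- exact: cvg_test tG.
- apply: (Rintegral_le_bound (probability_setT m)) => //.
    exact: integrablem GC.
  exact: integrablem gB.
- apply: nearW => n; apply: (Rintegral_le_bound (probability_setT Pr)).
  + exact: integrableY GC.
  + exact: integrableY gB.
  + by move=> w; exact: Gg.
Qed.

Let bump (K : R) (x : R) : R := Num.max 0 (Num.min 1 (K + 1 - `|x|)).

Let bump01 K x : 0 <= bump K x <= 1.
Proof. by rewrite /bump le_max lexx /= ge_max ler01 ge_min lexx. Qed.

Let bump1 K x : `|x| <= K -> bump K x = 1.
Proof. by move=> xK; rewrite /bump min_l ?max_r//; lra. Qed.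

Let bump0 K x : K + 1 <= `|x| -> bump K x = 0.
Proof. by move=> xK; rewrite /bump max_l// ge_min; apply/orP; right; lra. Qed.

Let continuous_bump K : continuous (bump K).
Proof.
move=> x; have c1 : {for x, continuous (fun y : R => K + 1 - `|y| : R^o)}.
  by apply: cvgB; [exact: cvg_cst | exact: norm_continuous].
have k1 : {for x, continuous (cst 1 : R -> R^o)} by exact: cvg_cst.
have k0 : {for x, continuous (cst 0 : R -> R^o)} by exact: cvg_cst.
exact: (continuous_max k0 (continuous_min k1 c1)).
Qed.

(** No mass escapes to infinity: the cutoff [chi] has compact support, so its means converge, and
    they are eventually almost as close to 1 as under the limit law. Hence [g] and [g * chi] have
    close means on both sides, and the compactly supported case applies to [g * chi]. *)
Lemma portmanteau : cvg_in_distribution Pr Y m.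
Proof.
split=> // g cg bg; have [B gB] := (bounded_fun_ex g).2 bg.
suff : \int[Pr]_w g (Y n w) @[n --> \oo] --> \int[m]_x g x.
  move=> h.
  have hE : (\int[Pr]_w g (Y n w))%:E @[n --> \oo] --> (\int[m]_x g x)%:E.
    by apply: cvg_EFin; [exact: nearW | exact: h].
  have fm := integrable_fin_num measurableT (integrablem cg gB).
  rewrite -(fineK fm); apply: cvg_trans hE; apply: near_eq_cvg; apply: nearW => n.
  have fY := integrable_fin_num measurableT (integrableY n cg gB).
  by rewrite unlock -[RHS](fineK fY).
have B0 : 0 <= B by rewrite (le_trans _ (gB 0)).
apply: cvg_uniform_approx => e e0.
pose e4 := e / (4 * (B + 1)); have e40 : 0 < e4 by rewrite divr_gt0// mulr_gt0//; lra.
have Be4 : B * (2 * e4) <= e.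
  rewrite /e4 (_ : B * _ = e * (B / (2 * (B + 1)))); last by field; lra.
  by rewrite ler_piMr ?(ltW e0)// ler_pdivrMr; lra.
have bB K : bounded_by (bump K) 1.
  by move=> x; have /andP[h0 h1] := bump01 K x; rewrite ger0_norm.
have [K hK] : exists K : nat, 1 - \int[m]_x bump K%:R x <= e4.
  have /cvgrPdist_le/(_ _ e40)[N _ /(_ N (leqnn N)) hN] :
      \int[m]_x bump n%:R x @[n --> \oo] --> \int[m]_x (1 : R).
    apply: (bounded_convergence (probability_setT m) (B := 1)).
    - by move=> n; exact: continuous_measurable_fun.
    - by move=> n x; exact: bB.
    - move=> x; apply: cvg_near_cst; exists (Num.bound `|x|) => // n /= nx.
      by apply: bump1; rewrite ltW// (lt_le_trans (archi_boundP (normr_ge0 x)))// ler_nat.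
  exists N; move: hN; rewrite /= (Rintegral_cst1 (probability_setT m)).
  exact: le_trans (ler_norm _).
pose chi := bump K%:R.
have cchi : continuous chi by exact: continuous_bump.
pose h x := g x * chi x.
have ch : continuous h by move=> x; apply: cvgM; [exact: cg|exact: cchi].
have hB : bounded_by h B.
  move=> x; rewrite /h normrM -[leRHS]mulr1 ler_pM//; exact: bB.
have supp A x : K%:R + 1 <= `|x| -> A x * chi x = 0 :> R.
  by move=> xK; rewrite /chi bump0// mulr0.
(* The functions g chi and g differ by at most B (1 - chi). A general measure is used so as to cover
   both [Y n] under [Pr] and the identity map under [m]. *)
have tail d (T : measurableType d) (mu : {measure set T -> \bar R}) (Z : T -> R) (t : R) :
    mu setT = 1%E -> measurable_fun setT Z -> 1 - \int[mu]_x chi (Z x) <= t ->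
    `|\int[mu]_x h (Z x) - \int[mu]_x g (Z x)| <= B * t.
  move=> mu1 mZ ht.
  have mc (f : R -> R) : continuous f -> measurable_fun setT (fun x => f (Z x)).
    by move=> cf; exact: (measurableT_comp (continuous_measurable_fun cf) mZ).
  have ih := integrable_bounded mu1 (mc _ ch) (fun x => hB (Z x)).
  have ig := integrable_bounded mu1 (mc _ cg) (fun x => gB (Z x)).
  have ic := integrable_bounded mu1 (mc _ cchi) (fun x => bB _ (Z x)).
  have i1 : mu.-integrable setT (EFin \o (fun=> 1 : R)).
    by apply: (integrable_bounded mu1 (f := cst 1) (B := 1)) => // x; rewrite normr1.
  have i1c := integrableB measurableT i1 ic.
  rewrite -RintegralB//.
  apply: (@le_trans _ _ (\int[mu]_x (B * (1 - chi (Z x))))); last first.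
    rewrite RintegralZl// RintegralB// (Rintegral_cst1 mu1).
    by rewrite ler_wpM2l.
  apply: Rintegral_norm_le.
  - exact: (integrableB measurableT ih ig).
  - exact: (integrableZl measurableT B i1c).
  move=> x; rewrite /h (_ : _ - _ = - (g (Z x) * (1 - chi (Z x)))); last by ring.
  have /andP[c0 c1] := bump01 K%:R (Z x).
  by rewrite normrN normrM (ger0_norm (_ : 0 <= 1 - chi (Z x))) ?ler_wpM2r ?subr_ge0.
have eB t : t <= 2 * e4 -> B * t <= e.
  by move=> te; rewrite (le_trans _ Be4)// ler_wpM2l.
exists h; split.
- by apply: (cvg_compact_support ch _ hB) => x; exact: supp.
- apply: (le_trans (tail _ _ m id e4 (probability_setT m) _ hK)) => //.
  by apply: eB; lra.
have /cvgrPdist_le/(_ _ e40) : \int[Pr]_w chi (Y n w) @[n --> \oo] --> \int[m]_x chi x.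
  by apply: (cvg_compact_support cchi _ (bB _)) => x; exact: bump0.
apply: filterS => n hn.
(* One [e4] for the tail of [m], one for the convergence of the means of [chi]. *)
apply: (le_trans (tail _ _ Pr (Y n) (2 * e4) (probability_setT Pr) (mY n) _)).
  move: hn; rewrite ler_distl => /andP[_ +].
  by move: hK; rewrite -/chi; lra.
exact: eB.
Qed.

End portmanteau.

(** * Weighted norms and the Poisson equation *)

Section weights.
Context d (X : measurableType d) (R : realType).
Implicit Types (W f : X -> R) (c : R).

Lemma wnorm_leP W f c : (forall x, 0 < W x) ->
  (wnorm W f <= c%:E)%E <-> (forall x, `|f x| <= c * W x).
Proof.
move=> W0; split=> [h x|h].
  rewrite -ler_pdivrMr// -lee_fin; apply: le_trans h.
  by apply: ereal_sup_ubound; exists x.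
by apply: ge_ereal_sup => _ [x _ <-]; rewrite lee_fin ler_pdivrMr.
Qed.

Lemma wnorm_ge0 W f : (forall x, 0 < W x) -> (0 <= wnorm W f)%E.
Proof.
move=> W0; apply: (@le_trans _ _ (`|f point| / W point)%:E).
  by rewrite lee_fin divr_ge0// ltW.
by apply: ereal_sup_ubound; exists point.
Qed.

Lemma fine_wnorm_bound W f : (forall x, 0 < W x) -> (wnorm W f < +oo)%E ->
  forall x, `|f x| <= fine (wnorm W f) * W x.
Proof.
move=> W0 fW; apply/wnorm_leP => //; rewrite fineK//.
by rewrite ge0_fin_numE//; exact: wnorm_ge0.
Qed.

Lemma integrable_weighted (m : {measure set X -> \bar R}) W f c :
  m.-integrable setT (EFin \o W) -> measurable_fun setT f ->
  (forall x, `|f x| <= c * W x) -> m.-integrable setT (EFin \o f).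
Proof.
move=> iW mf fc; have icW := integrableZl measurableT c iW.
apply: le_integrable icW => //; first exact/measurable_EFinP.
by move=> x _; rewrite /= lee_fin (le_trans (fc x))// ler_norm.
Qed.

Lemma Rintegral_weighted (m : {measure set X -> \bar R}) W f c :
  m.-integrable setT (EFin \o W) -> measurable_fun setT f ->
  (forall x, `|f x| <= c * W x) -> `|\int[m]_x f x| <= c * \int[m]_x W x.
Proof.
move=> iW mf fc; rewrite -(RintegralZl _ measurableT iW).
apply: Rintegral_norm_le => //; first exact: integrable_weighted fc.
exact: (integrableZl measurableT c iW).
Qed.

(* Young's inequality [u^a <= a u + (1 - a)] at [u = V / m] with [m] the mean of [V]. *)
Lemma Rintegral_powR_le (m : {measure set X -> \bar R}) (V : X -> R) (a : R) :
  m setT = 1%E -> 0 < a -> a < 1 ->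
  measurable_fun setT V -> (forall x, 1 <= V x) -> m.-integrable setT (EFin \o V) ->
  \int[m]_x (V x `^ a) <= (\int[m]_x V x) `^ a.
Proof.
move=> m1 a0 a1 mV V1 iV; set v := \int[m]_x V x.
have V0 x : 0 < V x by rewrite (lt_le_trans _ (V1 x)).
have v1 : 1 <= v.
  rewrite -(Rintegral_cst1 m1 1).
  apply: le_Rintegral => //.
  by apply: (integrable_bounded (B := 1) m1) => // x; rewrite normr1.
have v0 : 0 < v by rewrite (lt_le_trans _ v1).
have va0 : 0 < v `^ a by rewrite powR_gt0.
have iVa : m.-integrable setT (EFin \o (fun x => V x `^ a)).
  apply: (@integrable_weighted _ V _ 1) => //; first exact: (measurableT_comp (@measurable_powR R a) mV).
  move=> x; rewrite mul1r ger0_norm ?powR_ge0//.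
  by rewrite -[leRHS]powRr1 ?(ltW (V0 x))// ler_powR// ltW.
have young u : 0 <= u -> u `^ a <= a * u + (1 - a).
  move=> u0; have h := @conjugate_powR R (u `^ a) 1 a^-1 (1 - a)^-1.
  have {}h := h (powR_ge0 _ _) ler01.
  rewrite !invr_gt0 subr_gt0 in h; have {}h := h a0 a1.
  rewrite !invrK mulr1 -powRrM divff ?gt_eqF// powRr1// powR1 mul1r in h.
  by rewrite mulrC; apply: h; ring.
have bound x : V x `^ a <= v `^ a * (1 - a) + (v `^ a * a / v) * V x.
  have u0 : 0 <= V x / v by rewrite divr_ge0// ltW.
  have -> : V x `^ a = v `^ a * (V x / v) `^ a.
    by rewrite -powRM ?(ltW v0)// mulrCA divff ?gt_eqF// mulr1.
  have -> : v `^ a * (1 - a) + v `^ a * a / v * V x = v `^ a * (a * (V x / v) + (1 - a)).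
    by ring.
  by rewrite ler_wpM2l ?powR_ge0// young.
have i1 : m.-integrable setT (EFin \o (fun x => v `^ a * (1 - a))).
  by apply: (integrable_bounded (B := `|v `^ a * (1 - a)|) m1).
have i2 : m.-integrable setT (EFin \o (fun x => (v `^ a * a / v) * V x)).
  exact: (integrableZl measurableT (v `^ a * a / v) iV).
have i12 : m.-integrable setT (EFin \o (fun x => v `^ a * (1 - a) + (v `^ a * a / v) * V x)).
  exact: (integrableD measurableT i1 i2).
have := le_Rintegral measurableT iVa i12 (fun x _ => bound x).
rewrite RintegralD// (Rintegral_cst1 m1) (RintegralZl _ measurableT iV) -/v.
move=> h; apply: (le_trans h); rewrite divfK ?gt_eqF//.
by rewrite -mulrDr subrK mulr1.
Qed.

End weights.

(** * Integrals against mixtures, for the iterates of a kernel and for invariant laws *)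

Section mixture.
Context dY dZ (Y : measurableType dY) (Z : measurableType dZ) (R : realType).
Variables (l : {measure set Y -> \bar R}) (k : R.-fker Y ~> Z) (m : {measure set Z -> \bar R}).
Hypothesis mE : forall A, measurable A -> m A = (\int[l]_y k y A)%E.
Local Open Scope ereal_scope.
Import HBNNSimple.

Let mixture_indic (E : set Z) : measurable E ->
  \int[m]_z (\1_E z)%:E = \int[l]_y \int[k y]_z (\1_E z)%:E.
Proof.
move=> hE; rewrite integral_indic// setIT mE//.
by apply: eq_integral => y _; rewrite integral_indic// setIT.
Qed.

Let measurable_indic_kernel (E : set Z) : measurable E ->
  measurable_fun setT (fun y => \int[k y]_z (\1_E z)%:E).
Proof.
move=> hE; under eq_fun do rewrite integral_indic// setIT.
exact: measurable_kernel.
Qed.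

Let measurable_kernel_ge0 (f : Z -> \bar R) : measurable_fun setT f -> (forall z, 0 <= f z) ->
  measurable_fun setT (fun y => \int[k y]_z f z).
Proof.
move=> mf f0.
exact: (measurable_fun_integral_finite_kernel (fun yz : Y * Z => f yz.2) k
  (fun yz => f0 yz.2) (measurableT_comp mf measurable_snd)).
Qed.

Let mixture_nnsfun (f : {nnsfun Z >-> R}) :
  \int[m]_z (f z)%:E = \int[l]_y \int[k y]_z (f z)%:E.
Proof.
have mI r : measurable_fun setT (fun z => (\1_(f @^-1` [set r]) z : R)%:E).
  by apply/measurable_EFinP; exact: measurable_indic.
have mrI r : measurable_fun setT (fun z => (r * \1_(f @^-1` [set r]) z)%:E).
  by apply/measurable_EFinP; apply: measurable_funM => //; exact: measurable_indic.
have r0 (r : R) z : 0 <= (r * \1_(f @^-1` [set r]) z)%:E.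
  by rewrite EFinM nnfun_muleindic_ge0.
have sumE (n : {measure set Z -> \bar R}) : \int[n]_z (f z)%:E =
    \sum_(r \in range f) \int[n]_z (r * \1_(f @^-1` [set r]) z)%:E.
  under eq_integral do rewrite fimfunE -fsumEFin//.
  by rewrite ge0_integral_fsum.
have pull (n : {measure set Z -> \bar R}) (r : R) : (0 <= r)%R ->
    \int[n]_z (r * \1_(f @^-1` [set r]) z)%:E = r%:E * \int[n]_z (\1_(f @^-1` [set r]) z)%:E.
  move=> r0'; under eq_integral do rewrite EFinM.
  by apply: ge0_integralZl => // z _; rewrite lee_fin.
rewrite sumE; under [RHS]eq_integral do rewrite sumE.
rewrite ge0_integral_fsum//; last 2 first.
- by move=> r; apply: measurable_kernel_ge0.
- by move=> r y _; apply: integral_ge0.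
apply: eq_fsbigr => r _.
have [rge0|rlt0] := leP 0%R r; last first.
  have Z0 (n : {measure set Z -> \bar R}) : \int[n]_z (r * \1_(f @^-1` [set r]) z)%:E = 0.
    by rewrite integral0_eq// => z _; rewrite preimage_nnfun0// indic0 mulr0.
  by rewrite Z0 integral0_eq.
rewrite pull// mixture_indic// -ge0_integralZl//.
- by apply: eq_integral => y _; rewrite pull.
- exact: measurable_indic_kernel.
- by move=> y _; apply: integral_ge0 => z _; rewrite lee_fin.
Qed.

Lemma ge0_integral_mixture (f : Z -> \bar R) : measurable_fun setT f -> (forall z, 0 <= f z) ->
  \int[m]_z f z = \int[l]_y \int[k y]_z f z.
Proof.
move=> mf f0; pose f_ := nnsfun_approx measurableT mf.
have cf z : (f_ n z)%:E @[n --> \oo] --> f z by exact: cvg_nnsfun_approx.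
have mf_ n : measurable_fun setT (fun z => (f_ n z)%:E).
  exact/measurable_EFinP/measurable_funTS.
have nd z : {homo (fun n => (f_ n z)%:E) : a b / (a <= b)%N >-> a <= b}.
  by move=> a b ab; rewrite lee_fin; exact/lefP/nd_nnsfun_approx.
have mc (n : {measure set Z -> \bar R}) :
    \int[n]_z f z = lim (\int[n]_z (f_ i z)%:E @[i --> \oo]).
  rewrite -monotone_convergence//=.
  - by apply: eq_integral => z _; apply/esym/cvg_lim.
  - by move=> i z _; rewrite lee_fin.
rewrite mc; under [X in lim (X @ _)]funext => i do rewrite mixture_nnsfun.
rewrite -monotone_convergence//=.
- by apply: eq_integral => y _; rewrite mc.
- by move=> i; apply: measurable_kernel_ge0 => // z; rewrite lee_fin.
- by move=> i y _; apply: integral_ge0 => z _; rewrite lee_fin.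
- move=> y _ a b ab; apply: ge0_le_integral => //.
  + by move=> z _; rewrite lee_fin.
  + by move=> z _; exact: nd.
Qed.

Variable V : Z -> R.
Hypotheses (mV : measurable_fun setT V) (V0 : forall z, (0 <= V z)%R).
Hypothesis intV : m.-integrable setT (EFin \o V).
Hypothesis intkV : forall y, (k y).-integrable setT (EFin \o V).

(** A signed [g] dominated by [c * V] becomes nonnegative when [c * V] is added; the identity for
    nonnegative functions applies to the sum and to [V], and the finite integral of [c * V] is
    subtracted. *)
Lemma Rintegral_mixture (g : Z -> R) (c : R) : measurable_fun setT g ->
  (forall z, `|g z| <= c * V z)%R ->
  l.-integrable setT (EFin \o (fun y => \int[k y]_z g z)%R) /\
  (\int[m]_z g z = \int[l]_y (\int[k y]_z g z))%R.
Proof.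
have VE (n : {measure set Z -> \bar R}) : n.-integrable setT (EFin \o V) ->
    (\int[n]_z V z)%:E = \int[n]_z (V z)%:E.
  by move=> iV; rewrite fineK//; exact: integrable_fin_num.
have mkV : measurable_fun setT (fun y => \int[k y]_z V z)%R.
  exact: (measurable_Rintegral_kernel (k := V \o snd) k (measurableT_comp mV measurable_snd)).
have ikV : l.-integrable setT (EFin \o (fun y => \int[k y]_z V z)%R).
  apply/integrableP; split; first exact/measurable_EFinP.
  under eq_integral => y _.
    rewrite /= ger0_norm; last by apply: Rintegral_ge0.
    rewrite VE//; over.
  rewrite /= -(@ge0_integral_mixture (EFin \o V)); last 2 first.
  - exact/measurable_EFinP.
  - by move=> z; rewrite lee_fin.
  have := integrable_fin_num measurableT intV.
  by rewrite ge0_fin_numE//; apply: integral_ge0 => z _; rewrite lee_fin.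
move=> mg gc.
have mkg : measurable_fun setT (fun y => \int[k y]_z g z)%R.
  exact: (measurable_Rintegral_kernel (k := g \o snd) k (measurableT_comp mg measurable_snd)).
have ikg : l.-integrable setT (EFin \o (fun y => \int[k y]_z g z)%R).
  have ickV := integrableZl measurableT c ikV.
  apply: le_integrable ickV => //; first exact/measurable_EFinP.
  move=> y _; rewrite /= lee_fin (le_trans _ (ler_norm _))//.
  rewrite -(RintegralZl _ measurableT (intkV y)).
  apply: Rintegral_norm_le => //; first exact: integrable_weighted gc.
  exact: (integrableZl measurableT c (intkV y)).
split => //.
have mcV : measurable_fun setT (fun z => c * V z)%R by exact: measurable_funM.
have mgV : measurable_fun setT (fun z => g z + c * V z)%R by exact: measurable_funD.
have gV0 z : (0 <= g z + c * V z)%R.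
  by have := gc z; rewrite ler_norml => /andP[+ _]; rewrite -lerBlDr sub0r.
have key (n : {measure set Z -> \bar R}) : n.-integrable setT (EFin \o V) ->
    \int[n]_z (g z + c * V z)%:E = ((\int[n]_z g z)%R + c * (\int[n]_z V z)%R)%:E.
  move=> iV; have ig := integrable_weighted iV mg gc.
  have icV := integrableZl measurableT c iV.
  under eq_integral do rewrite EFinD EFinM.
  rewrite integralD// integralZl// EFinD EFinM VE// fineK//.
  exact: integrable_fin_num.
have h1 := @ge0_integral_mixture (fun z => (g z + c * V z)%:E).
have {}h1 : \int[m]_z (g z + c * V z)%:E = \int[l]_y \int[k y]_z (g z + c * V z)%:E.
  by apply: h1 => [|z]; [exact/measurable_EFinP | rewrite lee_fin].
have h2 : \int[m]_z (V z)%:E = \int[l]_y \int[k y]_z (V z)%:E.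
  apply: (@ge0_integral_mixture (EFin \o V)) => [|z]; first exact/measurable_EFinP.
  by rewrite lee_fin.
have h3 : (\int[m]_z V z = \int[l]_y (\int[k y]_z V z))%R.
  rewrite {1}/Rintegral h2; congr fine; apply: eq_integral => y _.
  by rewrite VE.
move: h1; rewrite (key _ intV).
under [X in _ = X -> _]eq_integral => y _ do rewrite key//.
have ickV := integrableZl measurableT c ikV.
under [X in _ = X -> _]eq_integral do rewrite EFinD EFinM.
rewrite integralD// integralZl// => /(congr1 fine).
have fg := integrable_fin_num measurableT ikg.
have fV := integrable_fin_num measurableT ikV.
by rewrite fineD//; [rewrite fineM// h3 => /addIr | exact: fin_numM].
Qed.

End mixture.

Section ergodic_kernel.
Context d (X : measurableType d) (R : realType).
Variables (V : X -> R) (alpha : R).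
Hypotheses (mV : measurable_fun setT V) (V1 : forall x, 1 <= V x).
Hypotheses (alpha_gt0 : 0 < alpha) (alpha_lt : alpha < 2^-1).
Local Notation W := (wpow V alpha).

(** Gathers what (A2) and P[alpha] give for a single kernel. The drift bound is kept in extended
    real form, so that it also yields integrability of [V] under every [K x]. *)
Record ergodic_kernel (K : R.-pker X ~> X) (p : probability X R) (C r : R) : Prop := {
  ek_r0 : 0 < r;
  ek_r1 : r < 1;
  ek_drift : exists b : R, forall x, (\int[K x]_y (V y)%:E <= (b * V x)%:E)%E;
  ek_invariant : invariant_probability K p;
  ek_cvg : forall (n : nat) (gam : R), alpha <= gam -> gam <= 1 ->
    (kdist (wpow V gam) (kpow K n) (fun=> p) <= (C * r ^+ n)%:E)%E }.

Let V0 x : 0 < V x. Proof. exact: lt_le_trans (V1 x). Qed.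
Let V0' x : 0 <= V x. Proof. exact: ltW. Qed.

Lemma alpha_lt1 : alpha < 1.
Proof. by move: alpha_lt; lra. Qed.

Lemma wpow_gt0 a x : 0 < wpow V a x. Proof. exact: powR_gt0. Qed.

Lemma wpow_le x : W x <= V x.
Proof.
by rewrite -[leRHS]powRr1//; apply: ler_powR => //; apply: ltW; exact: alpha_lt1.
Qed.

Lemma sqr_wpow_le x : W x ^+ 2 <= V x.
Proof.
rewrite /wpow -powR_mulrn ?powR_ge0// -powRrM -[leRHS]powRr1//.
by apply: ler_powR => //; move: alpha_lt; lra.
Qed.

Lemma measurable_wpow : measurable_fun setT W.
Proof. exact: (measurableT_comp (@measurable_powR R alpha) mV). Qed.

Lemma le_wpow_le (f : X -> R) c : (forall x, `|f x| <= c * W x) -> forall x, `|f x| <= c * V x.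
Proof.
move=> fc x; apply: (le_trans (fc x)); rewrite ler_wpM2l ?wpow_le//.
by rewrite -(pmulr_lge0 _ (wpow_gt0 alpha x)) (le_trans _ (fc x)).
Qed.

Lemma weight_cst_ge0 (f : X -> R) c : (forall x, `|f x| <= c * W x) -> 0 <= c.
Proof. by move=> fc; rewrite -(pmulr_lge0 _ (wpow_gt0 alpha point)) (le_trans _ (fc point)). Qed.

Variables (K : R.-pker X ~> X) (p : probability X R) (C r : R).
Hypothesis ek : ergodic_kernel K p C r.

Let r0 := ek_r0 ek.
Let r1 := ek_r1 ek.

Lemma wdist_kpow gam n x : alpha <= gam -> gam <= 1 ->
  (wdist (wpow V gam) (kpow K n x) p <= (C * r ^+ n * wpow V gam x)%:E)%E.
Proof.
move=> h1 h2; rewrite EFinM -lee_pdivrMr ?wpow_gt0//.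
apply: le_trans (ek_cvg ek n h1 h2); apply: ereal_sup_ubound; exists x => //.
by rewrite muleC.
Qed.

Lemma ek_C_ge0 : 0 <= C.
Proof.
have h := @wdist_kpow 1 0 point (ltW alpha_lt1) (lexx 1).
rewrite expr0 mulr1 in h; rewrite -(pmulr_lge0 _ (wpow_gt0 1 point)) -lee_fin.
apply: le_trans h.
apply: le_trans
  (_ : 0 <= `|\int[kpow K 0 point]_y (0 : R)%:E - \int[p]_y (0 : R)%:E|)%E _ => //.
apply: ereal_sup_ubound; exists (cst 0) => //; split => //.
by apply/wnorm_leP => [x|x]; rewrite ?wpow_gt0// normr0 mul1r ltW// wpow_gt0.
Qed.

Let kernel_integral_dist n x :
  (`|\int[kpow K n x]_y (V y)%:E - \int[p]_y (V y)%:E| <= (C * r ^+ n * V x)%:E)%E.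
Proof.
have := @wdist_kpow 1 n x (ltW alpha_lt1) (lexx 1).
have -> : wpow V 1 x = V x by rewrite /wpow powRr1.
apply: le_trans; apply: ereal_sup_ubound; exists V => //; split => //.
apply/wnorm_leP => [y|y]; first exact: wpow_gt0.
by rewrite mul1r /wpow powRr1// ger0_norm.
Qed.

Let VE0 (m : {measure set X -> \bar R}) : (0 <= \int[m]_y (V y)%:E)%E.
Proof. by apply: integral_ge0 => y _; rewrite lee_fin. Qed.

Let integrable_V (m : {measure set X -> \bar R}) : (\int[m]_y (V y)%:E < +oo)%E ->
  m.-integrable setT (EFin \o V).
Proof.
move=> h; apply/integrableP; split; first exact/measurable_EFinP.
by under eq_integral => y _ do rewrite /= ger0_norm//.
Qed.

(** [kpow K 0] is a Dirac mass, for which [V] has a finite integral; as the distance is an extended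
    real, an infinite integral of [V] under [p] would contradict [ek_cvg] at n = 0. *)
Lemma ek_integrable_pi : p.-integrable setT (EFin \o V).
Proof.
apply: integrable_V; rewrite ltNge leye_eq; apply/negP => /eqP pV.
have := kernel_integral_dist 0 point.
rewrite pV [X in `|X - _|%E](_ : _ = (V point)%:E) ?leye_eq//.
rewrite integral_dirac//; last exact/measurable_EFinP.
by rewrite diracT mul1e.
Qed.

Lemma ek_integrable_kpow n x : (kpow K n x).-integrable setT (EFin \o V).
Proof.
apply: integrable_V; rewrite ltNge leye_eq; apply/negP => /eqP pV.
have := kernel_integral_dist n x; rewrite pV.
by rewrite -(fineK (integrable_fin_num measurableT ek_integrable_pi)) leye_eq.
Qed.

Lemma ek_integrable x : (K x).-integrable setT (EFin \o V).
Proof.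
apply: integrable_V; have [b hb] := ek_drift ek.
exact: le_lt_trans (hb x) (ltry _).
Qed.

Lemma ek_drift_kop : exists2 b : R, 1 <= b & forall x, kop K V x <= b * V x.
Proof.
have [b hb] := ek_drift ek; exists (Num.max 1 b); first by rewrite le_max lexx.
move=> x; rewrite -lee_fin /kop fineK; last exact: (integrable_fin_num measurableT (ek_integrable x)).
by apply: le_trans (hb x) _; rewrite lee_fin ler_wpM2r// le_max lexx orbT.
Qed.

Lemma kop_kpow_cvg (g : X -> R) c n x : measurable_fun setT g ->
  (forall y, `|g y| <= c * W y) ->
  `|kop (kpow K n) g x - \int[p]_y g y| <= c * C * r ^+ n * W x.
Proof.
move=> mg gc; have c0 := weight_cst_ge0 gc.
have gV := le_wpow_le gc.
have ik := integrable_weighted (ek_integrable_kpow n x) mg gV.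
have ip := integrable_weighted ek_integrable_pi mg gV.
(* If c = 0 the function vanishes; otherwise g / c is an admissible test function in [wdist]. *)
have [c_eq0|cN0] := eqVneq c 0.
  have g0 : g = cst 0.
    by apply/funext => y; apply/eqP; have := gc y; rewrite c_eq0 mul0r normr_le0.
  by rewrite c_eq0 !mul0r g0 /kop !Rintegral_cst//= !mul0r subrr normr0.
have cp : 0 < c by rewrite lt_def cN0.
have h : (`|\int[kpow K n x]_y (c^-1 * g y)%:E - \int[p]_y (c^-1 * g y)%:E| <=
    (C * r ^+ n * W x)%:E)%E.
  apply: le_trans (wdist_kpow n x (lexx alpha) (ltW alpha_lt1)).
  apply: ereal_sup_ubound; exists (fun y => c^-1 * g y) => //; split.
    exact: measurable_funM.
  apply/wnorm_leP => [y|y]; first exact: wpow_gt0.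
  by rewrite normrM ger0_norm ?invr_ge0// mul1r ler_pdivrMl.
have pull (m : {measure set X -> \bar R}) : m.-integrable setT (EFin \o g) ->
    (\int[m]_y (c^-1 * g y)%:E = (c^-1 * \int[m]_y g y)%:E)%E.
  move=> ig; under eq_integral do rewrite EFinM.
  rewrite integralZl// EFinM fineK//; exact: (integrable_fin_num measurableT ig).
move: h; rewrite !pull// -EFinB abse_EFin lee_fin -mulrBr normrM ger0_norm ?invr_ge0//.
by rewrite ler_pdivrMl// !mulrA.
Qed.

Lemma kop0 (g : X -> R) x : measurable_fun setT g -> kop (kpow K 0) g x = g x.
Proof.
move=> mg; rewrite /kop /Rintegral integral_dirac//; last exact/measurable_EFinP.
by rewrite diracT mul1e.
Qed.

Lemma kopS (g : X -> R) c n x : measurable_fun setT g -> (forall y, `|g y| <= c * V y) ->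
  (K x).-integrable setT (EFin \o kop (kpow K n) g) /\
  kop (kpow K n.+1) g x = kop K (kop (kpow K n) g) x.
Proof.
move=> mg gc.
apply: (Rintegral_mixture (l := K x) (k := kpow K n) (m := kpow K n.+1 x) _ mV V0'
  (ek_integrable_kpow n.+1 x) (ek_integrable_kpow n) mg gc) => //.
Qed.

Lemma invariant_Rintegral (g : X -> R) c : measurable_fun setT g ->
  (forall y, `|g y| <= c * V y) ->
  p.-integrable setT (EFin \o kop K g) /\ \int[p]_x kop K g x = \int[p]_x g x.
Proof.
move=> mg gc.
have mE A : measurable A -> p A = (\int[p]_x K x A)%E by move=> mA; rewrite (ek_invariant ek).
have [ig gE] := Rintegral_mixture (l := p) (k := K) (m := p) mE mV V0' ek_integrable_pi
  ek_integrable mg gc.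
by split.
Qed.

Lemma kop_wpow_le x : kop K W x <= (kop K V x) `^ alpha.
Proof.
exact: (Rintegral_powR_le (m := K x) (prob_kernel x) alpha_gt0 alpha_lt1 mV V1 (ek_integrable x)).
Qed.

Lemma integrable_wpow x : (K x).-integrable setT (EFin \o W).
Proof.
apply: (integrable_weighted (c := 1) (ek_integrable x) measurable_wpow) => y.
by rewrite mul1r ger0_norm ?wpow_le// ltW// wpow_gt0.
Qed.

(** Concavity of the power alpha. The bound stays in terms of [kop K V] rather than [V], since this
    is the quantity that (A3b) controls. *)
Lemma kop_weighted (g : X -> R) c x : measurable_fun setT g -> (forall y, `|g y| <= c * W y) ->
  `|kop K g x| <= c * (kop K V x) `^ alpha.
Proof.
move=> mg gc; apply: (le_trans (Rintegral_weighted (integrable_wpow x) mg gc)).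
by rewrite ler_wpM2l ?kop_wpow_le// (weight_cst_ge0 gc).
Qed.

Lemma kop_Lweight (g : X -> R) c : measurable_fun setT g -> (forall y, `|g y| <= c * W y) ->
  exists c', forall x, `|kop K g x| <= c' * W x.
Proof.
move=> mg gc; have [b b1 hb] := ek_drift_kop; have b0 : 0 <= b by rewrite (le_trans _ b1).
exists (c * b `^ alpha) => x; apply: (le_trans (kop_weighted x mg gc)).
rewrite -mulrA ler_wpM2l ?(weight_cst_ge0 gc)// /wpow -powRM//.
rewrite ge0_ler_powR ?(ltW alpha_gt0)// ?nnegrE//; first exact: Rintegral_ge0.
by rewrite mulr_ge0.
Qed.

Lemma kop_V_ge1 x : 1 <= kop K V x.
Proof.
rewrite -(Rintegral_cst1 (prob_kernel (s := K) x) 1); apply: le_Rintegral => //; last exact: ek_integrable.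
by apply: (integrable_bounded (B := 1) (prob_kernel x)) => // y; rewrite normr1.
Qed.

Lemma measurable_kop (k : R.-fker X ~> X) (g : X -> R) : measurable_fun setT g ->
  measurable_fun setT (kop k g).
Proof.
move=> mg.
exact: (measurable_Rintegral_kernel (k := g \o snd) k (measurableT_comp mg measurable_snd)).
Qed.

End ergodic_kernel.

Section poisson.
Context d (X : measurableType d) (R : realType).
Variables (V : X -> R) (alpha : R).
Hypotheses (mV : measurable_fun setT V) (V1 : forall x, 1 <= V x).
Hypotheses (alpha_gt0 : 0 < alpha) (alpha_lt : alpha < 2^-1).
Local Notation W := (wpow V alpha).
Variables (K : R.-pker X ~> X) (p : probability X R) (C r : R).
Hypothesis ek : ergodic_kernel V alpha K p C r.
Variables (f : X -> R) (c : R).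
Hypotheses (mf : measurable_fun setT f) (fc : forall x, `|f x| <= c * W x).
Local Notation La := (Lambda K p f).

Let r0 := ek_r0 ek.
Let r1 := ek_r1 ek.
Let W0 := wpow_gt0 V1 alpha.
Let c0 : 0 <= c := weight_cst_ge0 V1 fc.
Let C0 : 0 <= C := ek_C_ge0 V1 alpha_lt ek.
Let fV := le_wpow_le V1 alpha_lt fc.
Let r1' : 0 < 1 - r. Proof. by rewrite subr_gt0. Qed.

Let a n x : R := kop (kpow K n) f x - \int[p]_y f y.

Let a_bound n x : `|a n x| <= geometric (c * C * W x) r n.
Proof.
have := kop_kpow_cvg mV V1 alpha_lt ek n x mf fc.
by rewrite /geometric /= mulrAC.
Qed.

Let geom_bound n (z : R) : 0 <= z -> series (geometric z r) n <= z / (1 - r).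
Proof.
move=> z0; rewrite geometric_seriesE ?lt_eqF// ler_wpM2r ?invr_ge0 ?(ltW r1')//.
by rewrite ler_piMr// gerBl exprn_ge0// ltW.
Qed.

Let c_W_ge0 x : 0 <= c * C * W x.
Proof. by rewrite !mulr_ge0// ltW. Qed.

Let norm_series_bound n x : series (fun k => `|a k x|) n <= c * C / (1 - r) * W x.
Proof.
apply: le_trans (_ : series (geometric (c * C * W x) r) n <= _).
  by apply: ler_sum => i _; exact: a_bound.
by apply: le_trans (geom_bound n (c_W_ge0 x)) _; rewrite mulrAC.
Qed.

Let series_bound n x : `|series (a ^~ x) n| <= c * C / (1 - r) * W x.
Proof. exact: le_trans (ler_norm_sum _ _ _) (norm_series_bound n x). Qed.

Lemma Lambda_cvg x :
  series (fun n => kop (kpow K n) f x - \int[p]_y f y) n @[n --> \oo] --> La x.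
Proof.
apply: normed_cvg; apply: (@series_le_cvg _ _ (geometric (c * C * W x) r)).
- by move=> n /=.
- by move=> n /=; rewrite mulr_ge0// exprn_ge0// ltW.
- by move=> n /=; exact: a_bound.
- by apply: is_cvg_geometric_series; rewrite ger0_norm// ltW.
Qed.

Lemma Lambda_bound x : `|La x| <= c * C / (1 - r) * W x.
Proof.
have h : `|series (a ^~ x) n| @[n --> \oo] --> `|La x| by apply: cvg_norm; exact: Lambda_cvg.
rewrite -(cvg_lim _ h)//; apply: limr_le; first by apply/cvg_ex; exists `|La x|.
by apply: nearW => n; exact: series_bound.
Qed.

Let ma n : measurable_fun setT (a n).
Proof. by apply: measurable_funB => //; exact: measurable_kop. Qed.

Let mseries n : measurable_fun setT (fun x => series (a ^~ x) n).
Proof. exact: measurable_sum. Qed.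

Lemma measurable_Lambda : measurable_fun setT La.
Proof. by apply: (measurable_fun_cvg mseries) => x _; exact: Lambda_cvg. Qed.

Let kop_a n x : kop K (a n) x = a n.+1 x /\ (K x).-integrable setT (EFin \o a n).
Proof.
have [ik kE] := kopS mV V1 alpha_lt ek n x mf fV.
have i1 : (K x).-integrable setT (EFin \o (fun=> \int[p]_y f y)).
  by apply: (integrable_bounded (B := `|\int[p]_y f y|) (prob_kernel x)).
split; first by rewrite /a kE {1}/kop (RintegralB measurableT ik i1) (Rintegral_cst1 (prob_kernel x)).
exact: (integrableB measurableT ik i1).
Qed.

Let kop_series n x : kop K (fun y => series (a ^~ y) n) x = series (a ^~ x) n.+1 - a 0 x.
Proof.
have iS m : (K x).-integrable setT (EFin \o (fun y => series (a ^~ y) m)).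
  exact: (integrable_weighted (integrable_wpow mV V1 alpha_lt ek x) (mseries m) (series_bound m)).
elim: n => [|n IHn].
  rewrite /series /= big_nat1 subrr /kop; under eq_Rintegral do rewrite big_geq//.
  by rewrite (Rintegral_cst1 (prob_kernel x)).
have [kE ia] := kop_a n x.
rewrite seriesSr addrAC -IHn -kE /kop -RintegralD//.
by apply: eq_Rintegral => y _; rewrite seriesSr.
Qed.

(** Applying [K] to a partial sum shifts its index and drops the first term, [f] minus its mean; the
    uniform bound by a multiple of [W] lets the limit pass under the integral. *)
Lemma poisson_equation x : kop K La x = La x - (f x - \int[p]_y f y).
Proof.
have iW := integrableZl measurableT (c * C / (1 - r)) (integrable_wpow mV V1 alpha_lt ek x).
have [||||| iL _ cvf] := @dominated_convergence _ _ _ (K x) setT measurableT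
  (fun n y => (series (a ^~ y) n)%:E) (EFin \o La) (fun y => (c * C / (1 - r))%:E * (W y)%:E)%E.
- by move=> n; exact/measurable_EFinP.
- exact/measurable_EFinP/measurable_Lambda.
- by apply: aeW => y _; apply: cvg_EFin; [exact: nearW | exact: Lambda_cvg].
- exact: iW.
- by apply: aeW => y n _; rewrite /= lee_fin; exact: series_bound.
have h1 : kop K (fun y => series (a ^~ y) n) x @[n --> \oo] --> kop K La x.
  rewrite /kop /Rintegral; apply: fine_cvg.
  by rewrite fineK//; exact: (integrable_fin_num measurableT iL).
have h2 : kop K (fun y => series (a ^~ y) n) x @[n --> \oo] --> La x - a 0 x.
  under eq_fun do rewrite kop_series.
  apply: cvgB; last exact: cvg_cst.
  by rewrite (cvg_shiftS (series (a ^~ x))); exact: Lambda_cvg.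
by rewrite (cvg_unique _ h1 h2)// /a kop0.
Qed.

Lemma kop_Lambda_bound x : `|kop K La x| <= c * C / (1 - r) * (kop K V x) `^ alpha.
Proof. exact: (kop_weighted mV V1 alpha_gt0 alpha_lt ek x measurable_Lambda Lambda_bound). Qed.

(** A constant equals its own [K]-average, and this one is [f - a 0], a function bounded by c (1 +
    C) W. The mean thus gets a bound in terms of [kop K V x], which (A3b) can absorb. *)
Lemma pi_bound x : `|\int[p]_y f y| <= c * (1 + C) * (kop K V x) `^ alpha.
Proof.
have -> : \int[p]_y f y = kop K (fun y => f y - a 0 y) x.
  rewrite /kop -[LHS](Rintegral_cst1 (prob_kernel (s := K) x)).
  by apply: eq_Rintegral => y _; rewrite /a kop0// opprB addrC subrK.
apply: (kop_weighted mV V1 alpha_gt0 alpha_lt ek) => [|y]; first exact: measurable_funB.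
rewrite (le_trans (ler_normB _ _))// mulrDr mulr1 mulrDl lerD//.
by have := a_bound 0 y; rewrite /geometric /= mulr1.
Qed.

Let k := c * C / (1 - r).
Let k0 : 0 <= k. Proof. by rewrite !mulr_ge0 ?invr_ge0 ?(ltW r1'). Qed.

Definition mg_increment (x y : X) := La y - kop K La x.

Let iLa x : (K x).-integrable setT (EFin \o La).
Proof.
exact: (integrable_weighted (integrable_wpow mV V1 alpha_lt ek x) measurable_Lambda Lambda_bound).
Qed.

Let iLa2 x : (K x).-integrable setT (EFin \o (fun y => La y ^+ 2)).
Proof.
apply: (integrable_weighted (c := k ^+ 2) (ek_integrable mV V1 ek x)).
  exact: measurable_funX measurable_Lambda.
move=> y; rewrite ger0_norm ?sqr_ge0// -real_normK ?num_real//.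
apply: le_trans (_ : (k * W y) ^+ 2 <= _).
  by rewrite ler_sqr ?nnegrE ?Lambda_bound// mulr_ge0// ltW.
by rewrite exprMn ler_wpM2l ?sqr_ge0// sqr_wpow_le.
Qed.

Let icst x (u : R) : (K x).-integrable setT (EFin \o (fun=> u)).
Proof. by apply: (integrable_bounded (B := `|u|) (prob_kernel x)). Qed.

Lemma integrable_mg_increment x : (K x).-integrable setT (EFin \o mg_increment x).
Proof. exact: (integrableB measurableT (iLa x) (icst x _)). Qed.

Lemma mg_increment_mean x : \int[K x]_y mg_increment x y = 0.
Proof. by rewrite RintegralB// (Rintegral_cst1 (prob_kernel x)) subrr. Qed.

Let sqrE x y : mg_increment x y ^+ 2 =
  La y ^+ 2 + (- 2 * kop K La x * La y + kop K La x ^+ 2).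
Proof. by rewrite /mg_increment; ring. Qed.

Let iZLa x (u : R) : (K x).-integrable setT (EFin \o (fun y => u * La y)).
Proof. exact: (integrableZl measurableT u (iLa x)). Qed.

Let iZD x (u v : R) : (K x).-integrable setT (EFin \o (fun y => u * La y + v)).
Proof. exact: (integrableD measurableT (iZLa x u) (icst x v)). Qed.

Lemma integrable_mg_increment2 x :
  (K x).-integrable setT (EFin \o (fun y => mg_increment x y ^+ 2)).
Proof.
rewrite (_ : (fun y => _) = (fun y => La y ^+ 2 + (- 2 * kop K La x * La y + kop K La x ^+ 2))).
  exact: (integrableD measurableT (iLa2 x) (iZD x _ _)).
by apply/funext => y; rewrite sqrE.
Qed.

(** The right side is the summand [F] of (A4), so the averaged conditional variances of the
    increments converge. *)
Lemma mg_increment_var x : \int[K x]_y mg_increment x y ^+ 2 =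
  kop K (fun y => La y ^+ 2) x - kop K La x ^+ 2.
Proof.
under eq_Rintegral do rewrite sqrE.
rewrite (RintegralD measurableT (iLa2 x) (iZD x _ _)) (RintegralD measurableT (iZLa x _) (icst x _)).
rewrite (RintegralZl _ measurableT (iLa x)) (Rintegral_cst1 (prob_kernel x)).
by rewrite -/(kop K La x) /kop; ring.
Qed.

(** Both parts of the increment are at most [k] times (V y + K V x)^alpha, and the exponent 1 /
    alpha undoes the power. Averaging over [y] then leaves a multiple of K V x. *)
Let incr_bound x y :
  `|mg_increment x y| `^ alpha^-1 <= (2 * k) `^ alpha^-1 * (V y + kop K V x).
Proof.
have V0 z : 0 < V z by rewrite (lt_le_trans _ (V1 z)).
have m0 : 0 < kop K V x by rewrite (lt_le_trans _ (kop_V_ge1 mV V1 ek x)).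
have s0 : 0 < V y + kop K V x by rewrite addr_gt0.
have h : `|mg_increment x y| <= 2 * k * (V y + kop K V x) `^ alpha.
  rewrite /mg_increment (le_trans (ler_normB _ _))// -mulrA mulrDl mul1r lerD//.
    apply: le_trans (Lambda_bound y) _; rewrite ler_wpM2l// ge0_ler_powR ?nnegrE//; try exact: ltW.
    by rewrite lerDl ltW.
  apply: le_trans (kop_Lambda_bound x) _; rewrite ler_wpM2l// ge0_ler_powR ?nnegrE//; try exact: ltW.
  by rewrite lerDr ltW.
have sE : V y + kop K V x = ((V y + kop K V x) `^ alpha) `^ alpha^-1.
  by rewrite -powRrM divff ?gt_eqF// powRr1// ltW.
rewrite [X in _ * X]sE -powRM ?powR_ge0//.
  have i0 : 0 <= alpha^-1 by rewrite invr_ge0 ltW.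
  have k2 : 0 <= 2 * k * (V y + kop K V x) `^ alpha by rewrite mulr_ge0 ?powR_ge0// mulr_ge0.
  exact: (ge0_ler_powR i0 (normr_ge0 _) k2 h).
by rewrite mulr_ge0.
Qed.

Lemma integrable_mg_increment_powR x :
  (K x).-integrable setT (EFin \o (fun y => `|mg_increment x y| `^ alpha^-1)) /\
  \int[K x]_y (`|mg_increment x y| `^ alpha^-1) <= 2 * (2 * k) `^ alpha^-1 * kop K V x.
Proof.
have iV := ek_integrable mV V1 ek x.
have mD : measurable_fun setT (mg_increment x).
  by apply: measurable_funB => //; exact: measurable_Lambda.
have ib : (K x).-integrable setT (EFin \o (fun y => (2 * k) `^ alpha^-1 * (V y + kop K V x))).
  exact: (integrableZl measurableT ((2 * k) `^ alpha^-1) (integrableD measurableT iV (icst x _))).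
have iq : (K x).-integrable setT (EFin \o (fun y => `|mg_increment x y| `^ alpha^-1)).
  apply: le_integrable ib => //.
    apply/measurable_EFinP; apply: (measurableT_comp (@measurable_powR R alpha^-1)).
    exact: (measurableT_comp (@normr_measurable R setT) mD).
  move=> y _; rewrite /= lee_fin ger0_norm ?powR_ge0// (le_trans (incr_bound x y))//.
  exact: ler_norm.
split => //; apply: le_trans (le_Rintegral measurableT iq ib (fun y _ => incr_bound x y)) _.
rewrite (RintegralZl _ measurableT (integrableD measurableT iV (icst x (kop K V x)))).
rewrite (RintegralD measurableT iV (icst x _)) (Rintegral_cst1 (prob_kernel x)).
rewrite -/(kop K V x) (_ : _ * (_ + _) = 2 * (2 * k) `^ alpha^-1 * kop K V x)//.
by ring.
Qed.

End poisson.

(** * Comparison of two invariant laws through the Poisson equation *)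

Section two_kernels.
Context d (X : measurableType d) (R : realType).
Variables (V : X -> R) (alpha : R).
Hypotheses (mV : measurable_fun setT V) (V1 : forall x, 1 <= V x).
Hypotheses (alpha_gt0 : 0 < alpha) (alpha_lt : alpha < 2^-1).
Local Notation W := (wpow V alpha).
Variables (K K' : R.-pker X ~> X) (p p' : probability X R) (C C' r r' : R).
Hypothesis ek : ergodic_kernel V alpha K p C r.
Hypothesis ek' : ergodic_kernel V alpha K' p' C' r'.

Section one_function.
Variables (f : X -> R) (c : R).
Hypotheses (mf : measurable_fun setT f) (fc : forall x, `|f x| <= c * W x).
Let g := kop_sub K K' (Lambda K' p' f).

Let mLa := measurable_Lambda mV V1 alpha_lt ek' mf fc.
Let Lab := Lambda_bound mV V1 alpha_lt ek' mf fc.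

Lemma measurable_kop_sub_Lambda : measurable_fun setT g.
Proof. by apply: measurable_funB; exact: measurable_kop. Qed.

Lemma kop_sub_Lambda_bound : exists c', forall x, `|g x| <= c' * W x.
Proof.
have [c1 h1] := kop_Lweight mV V1 alpha_gt0 alpha_lt ek mLa Lab.
have [c2 h2] := kop_Lweight mV V1 alpha_gt0 alpha_lt ek' mLa Lab.
exists (c1 + c2) => x; rewrite mulrDl (le_trans (ler_normB _ _))//.
by rewrite lerD.
Qed.

(** With h the Poisson solution for [K'], the function [g] is K h - h plus [f] minus its mean under
    [p']; the difference K h - h has [p]-mean zero by invariance. *)
Lemma Rintegral_kop_sub_Lambda : \int[p]_x g x = \int[p]_x f x - \int[p']_x f x.
Proof.
have LV := le_wpow_le V1 alpha_lt Lab; have fV := le_wpow_le V1 alpha_lt fc.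
have ipV := ek_integrable_pi mV V1 alpha_lt ek.
have [i1 E1] := invariant_Rintegral mV V1 alpha_lt ek mLa LV.
have i2 := integrable_weighted ipV mLa LV.
have i3 := integrable_weighted ipV mf fV.
have i4 : p.-integrable setT (EFin \o (fun=> \int[p']_x f x)).
  by apply: (integrable_bounded (B := `|\int[p']_x f x|) (probability_setT p)).
have i34 : p.-integrable setT (EFin \o (fun x => f x - \int[p']_x f x)).
  exact: (integrableB measurableT i3 i4).
have i12 : p.-integrable setT (EFin \o (fun x => kop K (Lambda K' p' f) x - Lambda K' p' f x)).
  exact: (integrableB measurableT i1 i2).
have gE x : g x = (kop K (Lambda K' p' f) x - Lambda K' p' f x) + (f x - \int[p']_x f x).
  by rewrite /g /kop_sub (poisson_equation mV V1 alpha_lt ek' mf fc); ring.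
under eq_Rintegral do rewrite gE.
rewrite (RintegralD measurableT i12 i34) (RintegralB measurableT i1 i2) E1 subrr add0r.
by rewrite (RintegralB measurableT i3 i4) (Rintegral_cst1 (probability_setT p)).
Qed.

End one_function.

(** The previous identity for [f] gives the [p]-mean of [g]; applied once more, to [g], it trades
    [p] for [p'] in that mean. With [K'] and [p'] at the reference parameter, the two terms are the
    summands of (A6a) and (A6b). *)
Lemma invariant_expansion (f : X -> R) c : measurable_fun setT f ->
  (forall x, `|f x| <= c * W x) ->
  let g := kop_sub K K' (Lambda K' p' f) in
  \int[p]_x f x - \int[p']_x f x =
  \int[p']_x g x + \int[p]_x kop_sub K K' (Lambda K' p' g) x.
Proof.
move=> mf fc g; have mg := measurable_kop_sub_Lambda mf fc.
have [c' gc] := kop_sub_Lambda_bound mf fc.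
by rewrite (Rintegral_kop_sub_Lambda mg gc) (Rintegral_kop_sub_Lambda mf fc) [RHS]addrC subrK.
Qed.

End two_kernels.

Section joint_measurability.
Context dX dT (X : measurableType dX) (Theta : measurableType dT) (R : realType).
Variables (P : Theta -> R.-pker X ~> X) (pi_ : Theta -> probability X R) (C rho : Theta -> R).
Hypothesis P_measurable : forall A : set X, measurable A ->
  measurable_fun [set: X * Theta] (fun z => P z.2 z.1 A).
Variables (V : X -> R) (alpha : R).
Hypotheses (mV : measurable_fun setT V) (V1 : forall x, 1 <= V x) (alpha_lt : alpha < 2^-1).
Hypothesis ek : forall t, ergodic_kernel V alpha (P t) (pi_ t) (C t) (rho t).

Lemma measurable_kop_param (h : Theta * X -> R) : measurable_fun setT h ->
  measurable_fun setT (fun z : Theta * X => kop (P z.1) (fun y => h (z.1, y)) z.2).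
Proof.
move=> mh; apply: (measurable_Rintegral_param P_measurable measurable_fst measurable_snd
  (k := fun z : Theta * X * X => h (z.1.1, z.2))).
exact: (measurableT_comp mh (measurable_fun_pair
  (measurableT_comp measurable_fst measurable_fst) measurable_snd)).
Qed.

Lemma measurable_Rintegral_cst (p : probability X R) (h : Theta * X -> R) :
  measurable_fun setT h -> measurable_fun setT (fun t => \int[p]_x h (t, x)).
Proof.
move=> mh.
have mp : measurable_fun setT (fun _ : Theta => p : pprobability X R) by [].
exact: (measurable_Rintegral_kernel (kprobability mp) mh).
Qed.

Variables (f : X -> R) (c : R).
Hypotheses (mf : measurable_fun setT f) (fc : forall x, `|f x| <= c * wpow V alpha x).

Lemma measurable_kpow_param n :
  measurable_fun setT (fun z : Theta * X => kop (kpow (P z.1) n) f z.2).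
Proof.
have fV := le_wpow_le V1 alpha_lt fc.
elim: n => [|n IHn].
  under eq_fun do rewrite kop0//.
  exact: (measurableT_comp mf measurable_snd).
rewrite (_ : (fun z => _) =
    fun z : Theta * X => kop (P z.1) (fun y => kop (kpow (P z.1) n) f y) z.2).
  exact: measurable_kop_param IHn.
by apply/funext => z; have [_ ->] := kopS mV V1 alpha_lt (ek z.1) n z.2 mf fV.
Qed.

(** The mean under [pi_ t] is the limit of P_t^n f at a fixed state, and these iterates depend
    measurably on [t]. *)
Lemma measurable_pi_param : measurable_fun setT (fun t => \int[pi_ t]_x f x).
Proof.
apply: (measurable_fun_cvg (h := fun n t => kop (kpow (P t) n) f point)).
  move=> n; exact: (measurableT_comp (measurable_kpow_param n)
    (measurable_fun_pair (@measurable_id _ Theta setT) (measurable_cst point))).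
move=> t _; apply/cvgrPdist_le => e e0.
have r1 : `|rho t| < 1 by rewrite ger0_norm ?(ek_r1 (ek t))// ltW// (ek_r0 (ek t)).
have := @cvg_geometric R (c * C t * wpow V alpha point) _ r1.
move=> /cvgr0_norm_le /(_ _ e0); apply: filterS => n /=.
rewrite distrC => h; apply: le_trans (kop_kpow_cvg mV V1 alpha_lt (ek t) n point mf fc) _.
by rewrite mulrAC (le_trans (ler_norm _)).
Qed.

Lemma measurable_Lambda_param :
  measurable_fun setT (fun z : Theta * X => Lambda (P z.1) (pi_ z.1) f z.2).
Proof.
apply: (measurable_fun_cvg (h := fun N (z : Theta * X) => series (fun n =>
    kop (kpow (P z.1) n) f z.2 - \int[pi_ z.1]_y f y) N)).
  move=> N; apply: measurable_sum => n; apply: measurable_funB.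
    exact: measurable_kpow_param.
  exact: (measurableT_comp measurable_pi_param measurable_fst).
by move=> z _; exact: (Lambda_cvg mV V1 alpha_lt (ek z.1) mf fc).
Qed.

Lemma measurable_kop_Lambda_param :
  measurable_fun setT (fun z : Theta * X => kop (P z.1) (Lambda (P z.1) (pi_ z.1) f) z.2).
Proof. exact: (measurable_kop_param measurable_Lambda_param). Qed.

Lemma measurable_mg_increment : measurable_fun setT
  (fun z : Theta * X * X => mg_increment (P z.1.1) (pi_ z.1.1) f z.1.2 z.2).
Proof.
apply: measurable_funB; last exact: (measurableT_comp measurable_kop_Lambda_param measurable_fst).
exact: (measurableT_comp measurable_Lambda_param (measurable_fun_pair
  (measurableT_comp measurable_fst measurable_fst) measurable_snd)).
Qed.

End joint_measurability.

(** * The remainder and the limit theorem *)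

Section vanishing_remainders.
Context dO (Omega : measurableType dO) (R : realType) (Pr : probability Omega R).

(** Deviation events of [B] are contained in deviation events of [A]; a threshold [delta], instead
    of a pointwise inequality, covers constant multiples and powers alike. *)
Lemma cvg_in_probability0_le (A B : nat -> Omega -> R) :
  (forall n, measurable_fun setT (B n)) -> cvg_in_probability Pr A 0 ->
  (forall eps : R, 0 < eps -> exists2 delta : R, 0 < delta &
    forall n w, eps <= `|B n w| -> delta <= `|A n w|) ->
  cvg_in_probability Pr B 0.
Proof.
move=> mB [mA cA] hAB; split=> // eps eps0; have [delta d0 hd] := hAB _ eps0.
apply: (squeeze_cvge _ (cvg_cst 0%E) (cA _ d0)); apply: nearW => n.
rewrite measure_ge0 /=; apply: le_measure.
- exact/mem_set/(measurable_deviation 0 eps (mB n)).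
- exact/mem_set/(measurable_deviation 0 delta (mA n)).
by move=> w /=; rewrite !subr0; exact: hd.
Qed.

Lemma cvg_in_probability0D (A B : nat -> Omega -> R) :
  cvg_in_probability Pr A 0 -> cvg_in_probability Pr B 0 ->
  cvg_in_probability Pr (fun n w => A n w + B n w) 0.
Proof.
move=> [mA cA] [mB cB]; have mAB n : measurable_fun setT (fun w => A n w + B n w).
  by apply: measurable_funD.
split=> // eps eps0; have e2 : 0 < eps / 2 by rewrite divr_gt0.
have cAB : (Pr [set w | (eps / 2 <= `|A n w - 0|)%R] + Pr [set w | (eps / 2 <= `|B n w - 0|)%R])%E
    @[n --> \oo] --> 0%E.
  by rewrite -(adde0 0%E); apply: cvgeD (cA _ e2) (cB _ e2).
apply: (squeeze_cvge _ (cvg_cst 0%E) cAB); apply: nearW => n; rewrite measure_ge0 /=.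
have mdA := measurable_deviation 0 (eps / 2) (mA n).
have mdB := measurable_deviation 0 (eps / 2) (mB n).
apply: le_trans (measureU2 _ mdA mdB); apply: le_measure.
- exact/mem_set/(measurable_deviation 0 eps (mAB n)).
- exact/mem_set/measurableU.
move=> w /=; rewrite !subr0 => h.
have [hA|hA] := leP (eps / 2) `|A n w|; [by left | right].
rewrite leNgt; apply/negP => hB; move: h; rewrite leNgt => /negP; apply.
by rewrite (le_lt_trans (ler_normD _ _))// [ltRHS](splitr eps) ltrD.
Qed.

Lemma cvg_in_probability0_norm (A : nat -> Omega -> R) :
  cvg_in_probability Pr A 0 -> cvg_in_probability Pr (fun n w => `|A n w|) 0.
Proof.
move=> cA; apply: (cvg_in_probability0_le _ cA).
  by move=> n; apply: (measurableT_comp (@normr_measurable R setT)); exact: (cA.1 n).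
by move=> eps eps0; exists eps => // n w; rewrite normr_id.
Qed.

Lemma cvg_in_probability0_powR (A : nat -> Omega -> R) (a k : R) : 0 < a -> 0 < k ->
  (forall n w, 0 <= A n w) -> cvg_in_probability Pr A 0 ->
  cvg_in_probability Pr (fun n w => k * A n w `^ a) 0.
Proof.
move=> a0 k0 A0 cA; apply: (cvg_in_probability0_le _ cA).
  move=> n; apply: measurable_funM => //.
  exact: (measurableT_comp (@measurable_powR R a) (cA.1 n)).
move=> eps eps0; have ek0 : 0 < eps / k by rewrite divr_gt0.
exists ((eps / k) `^ a^-1); first exact: powR_gt0.
move=> n w; rewrite !ger0_norm// ?mulr_ge0 ?powR_ge0// ?(ltW k0)//.
rewrite mulrC -ler_pdivrMr// => h.
have ai0 : 0 <= a^-1 by rewrite invr_ge0 ltW.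
have -> : A n w = (A n w `^ a) `^ a^-1 by rewrite -powRrM divff ?gt_eqF// powRr1.
by apply: (ge0_ler_powR ai0 _ _ h); rewrite nnegrE ?powR_ge0// ltW.
Qed.

Lemma cvg_in_probability_shift (A : nat -> Omega -> R) (c : R) :
  cvg_in_probability Pr A c -> cvg_in_probability Pr (fun n => A n.+1) c.
Proof.
move=> [mA cA]; split=> [n|eps e0]; first exact: mA.
by have := cA eps e0; rewrite -(cvg_shiftS (fun n => Pr [set w | eps <= `|A n w - c|])).
Qed.

(** Slutsky's argument, carried out on test functions because they are uniformly continuous;
    [portmanteau] then extends the convergence. Accordingly [Y] is assumed to converge in the form
    that [test_function_clt] delivers. *)
Lemma cvg_in_distribution_perturb (Y Y' B : nat -> Omega -> R)
    (m : probability (measurableTypeR R) R) :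
  (forall n, measurable_fun setT (Y n)) -> (forall n, measurable_fun setT (Y' n)) ->
  cvg_in_probability Pr B 0 -> (forall n w, `|Y' n w - Y n w| <= B n w) ->
  (forall (g g1 g2 : R -> R) (b : R), test_fun g g1 g2 b ->
    \int[Pr]_w g (Y n w) @[n --> \oo] --> \int[m]_x g x) ->
  cvg_in_distribution Pr Y' m.
Proof.
move=> mY mY' cB YB cvgY; apply: (portmanteau mY') => g g1 g2 b tg.
have gb := test_bound tg; have b0 : 0 <= b by rewrite (le_trans _ (gb 0)).
have mg : measurable_fun setT g.
  by apply: continuous_measurable_fun; exact: (unif_cont_continuous (test_uc tg)).
apply/cvgrPdist_le => e e0; have e3 : 0 < e / 3 by rewrite divr_gt0.
have [delta d0 hd] := test_uc tg e3.
have p0 : 0 < e / 3 / (2 * b + 1) by rewrite divr_gt0// ltr_wpDl// mulr_ge0.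
have hB := cvg_in_probability_fine cB d0 p0.
have /cvgrPdist_le/(_ _ e3) hY := cvgY _ _ _ _ tg.
apply: filterS2 hB hY => n hB hY.
have close : `|\int[Pr]_w g (Y n w) - \int[Pr]_w g (Y' n w)| <=
    e / 3 + 2 * b * fine (Pr [set w | delta <= `|B n w - 0|]).
  apply: expectation_close.
  - exact: (measurableT_comp mg (mY n)).
  - exact: (measurableT_comp mg (mY' n)).
  - exact: (measurable_deviation 0 delta (cB.1 n)).
  - by move=> w; exact: gb.
  - by move=> w; exact: gb.
  - exact: ltW.
  - move=> w /= /negP; rewrite -ltNge subr0 => Bd.
    have := hd (Y' n w) (Y n w - Y' n w); rewrite (addrC (Y' n w)) subrK; apply.
    by rewrite distrC (le_trans (YB n w))// (le_trans (ler_norm _))// ltW.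
have hb : 2 * b * fine (Pr [set w | delta <= `|B n w - 0|]) <= e / 3.
  have b20 : 0 <= 2 * b by rewrite mulr_ge0.
  apply: le_trans (ler_wpM2l b20 hB) _.
  rewrite mulrA ler_pdivrMr ?ltr_wpDl// mulrC ler_wpM2l ?(ltW e3)//.
  by rewrite lerDl.
rewrite -[leLHS]/(`|\int[m]_x g x - \int[Pr]_w g (Y' n w)|).
rewrite -(subrKA (\int[Pr]_w g (Y n w))) (le_trans (ler_normD _ _))//.
by move: hY close hb; lra.
Qed.

End vanishing_remainders.

(** * Decomposition of the centred sum and bound on its remainder *)

Section adaptive_chain.
Context dX dT (X : measurableType dX) (Theta : measurableType dT) (R : realType).
Variables (P : Theta -> R.-pker X ~> X) (pi_ : Theta -> probability X R) (C rho : Theta -> R).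
Variables (V : X -> R) (alpha : R).
Hypotheses (mV : measurable_fun setT V) (V1 : forall x, 1 <= V x).
Hypotheses (alpha_gt0 : 0 < alpha) (alpha_lt : alpha < 2^-1).
Hypothesis ek : forall t, ergodic_kernel V alpha (P t) (pi_ t) (C t) (rho t).
Variables (f : X -> R) (c : R).
Hypotheses (mf : measurable_fun setT f) (fc : forall x, `|f x| <= c * wpow V alpha x).

Let c0 : 0 <= c := weight_cst_ge0 V1 fc.
Let L t := Num.max (C t) (1 - rho t)^-1.
(** The summand of (A3b). Its power alpha is L^2 (P_t V)^alpha, a common bound, up to constants, for
    [U] and for the mean of [f]. *)
Let G t x := L t `^ (2 / alpha) * kop (P t) V x.
Local Notation D t := (mg_increment (P t) (pi_ t) f).
Local Notation U t := (kop (P t) (Lambda (P t) (pi_ t) f)).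

Let L_ge1 t : 1 <= L t.
Proof.
have r1 : 0 < 1 - rho t by rewrite subr_gt0 (ek_r1 (ek t)).
by rewrite le_max invf_ge1// gerBl (ltW (ek_r0 (ek t))) orbT.
Qed.

Let L_ge0 t : 0 <= L t. Proof. exact: le_trans (L_ge1 t). Qed.

Let C_ge0 t : 0 <= C t := ek_C_ge0 V1 alpha_lt (ek t).

Let C_le t : C t <= L t. Proof. by rewrite le_max lexx. Qed.

Let PV_ge0 t x : 0 <= kop (P t) V x.
Proof. exact: le_trans (kop_V_ge1 mV V1 (ek t) x). Qed.

Let G_ge0 t x : 0 <= G t x. Proof. by rewrite mulr_ge0// powR_ge0. Qed.

(** [L] dominates both [C] and 1 / (1 - rho); their product is the origin of the square, hence of
    the exponent 2 / alpha in (A3b). *)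
Let coef_le t : c * C t / (1 - rho t) <= c * L t ^+ 2.
Proof.
have r1 : 0 < 1 - rho t by rewrite subr_gt0 (ek_r1 (ek t)).
rewrite -mulrA ler_wpM2l// expr2 ler_pM ?invr_ge0 ?(ltW r1)//.
by rewrite le_max lexx orbT.
Qed.

Let G_powR t x : G t x `^ alpha = L t ^+ 2 * kop (P t) V x `^ alpha.
Proof.
by rewrite powRM ?powR_ge0// -powRrM mulfVK ?gt_eqF// -powR_mulrn.
Qed.

Let U_le t x : `|U t x| <= c * G t x `^ alpha.
Proof.
apply: le_trans (kop_Lambda_bound mV V1 alpha_gt0 alpha_lt (ek t) mf fc x) _.
by rewrite G_powR mulrA ler_wpM2r ?powR_ge0.
Qed.

Let pi_le t x : `|\int[pi_ t]_y f y| <= 2 * c * G t x `^ alpha.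
Proof.
apply: le_trans (pi_bound mV V1 alpha_gt0 alpha_lt (ek t) mf fc x) _.
rewrite G_powR mulrA ler_wpM2r ?powR_ge0// [2 * c]mulrC -mulrA ler_wpM2l//.
rewrite mulr_natl mulr2n lerD//; first by rewrite exprn_ege1.
by rewrite (le_trans (C_le t))// expr2 ler_peMl.
Qed.

(** The moment bound carries the constant (2 k)^(1 / alpha) with k <= c L^2, and (L^2)^(1 / alpha)
    is the weight in [G]. *)
Lemma step_mom_le t x : step_mom P (fun t => D t) alpha^-1 t x <=
  2 * (2 * c) `^ alpha^-1 * G t x.
Proof.
have [_ h] := integrable_mg_increment_powR mV V1 alpha_gt0 alpha_lt (ek t) mf fc x.
apply: le_trans h _; rewrite /G [leRHS]mulrA ler_wpM2r// -[leRHS]mulrA ler_wpM2l//.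
have -> : L t `^ (2 / alpha) = (L t ^+ 2) `^ alpha^-1 by rewrite powRrM powR_mulrn.
rewrite -powRM ?mulr_ge0 ?sqr_ge0//.
have ai0 : 0 <= alpha^-1 by rewrite invr_ge0 ltW.
have r1 : 0 < 1 - rho t by rewrite subr_gt0 (ek_r1 (ek t)).
apply: (ge0_ler_powR ai0); rewrite ?nnegrE ?mulr_ge0 ?invr_ge0 ?sqr_ge0 ?(ltW r1)//.
by rewrite -[leRHS]mulrA ler_wpM2l.
Qed.

Variable tstar : Theta.
Let pistar := \int[pi_ tstar]_x f x.
Variables (tk : nat -> Theta) (xk : nat -> X).

(** At the state [xk k.+1] the Poisson equation is used with the earlier parameter [tk k], whereas
    the other two sums pair [xk k] with [tk k], as (A3a) and (A6) do. This reindexing leaves the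
    boundary terms in [U] and in the means. *)
Let decomposition n :
  \sum_(1 <= k < n.+1) (f (xk k) - pistar) =
  \sum_(0 <= k < n) D (tk k) (xk k) (xk k.+1)
  + \sum_(1 <= k < n.+1) (U (tk k) (xk k) - U (tk k.-1) (xk k))
  + \sum_(1 <= k < n.+1) (\int[pi_ (tk k)]_y f y - pistar)
  + (U (tk 0%N) (xk 0%N) - U (tk n) (xk n)
     + (\int[pi_ (tk 0%N)]_y f y - \int[pi_ (tk n)]_y f y)).
Proof.
elim: n => [|n IHn]; first by rewrite !big_geq//; ring.
rewrite !(@big_nat_recr _ _ _ n.+1 1)// (@big_nat_recr _ _ _ n 0)//= IHn.
have := poisson_equation mV V1 alpha_lt (ek (tk n)) mf fc (xk n.+1).
by rewrite /mg_increment => ->; ring.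
Qed.

(** [fine] sends an infinite norm to 0, so the inequality rests on the norm being finite, which the
    drift condition ensures. *)
Let wnorm_step t t' x : `|U t x - U t' x| <=
  fine (wnorm (wpow V alpha) (fun y => U t y - U t' y)) * wpow V alpha x.
Proof.
have W0 := wpow_gt0 V1 alpha.
apply: (fine_wnorm_bound (f := fun y => U t y - U t' y) W0).
have Ub s : exists c', forall y, `|U s y| <= c' * wpow V alpha y.
  exact: (kop_Lweight mV V1 alpha_gt0 alpha_lt (ek s)
    (measurable_Lambda mV V1 alpha_lt (ek s) mf fc) (Lambda_bound mV V1 alpha_lt (ek s) mf fc)).
have [c1 h1] := Ub t; have [c2 h2] := Ub t'.
apply: (@le_lt_trans _ _ (c1 + c2)%:E); last exact: ltry.
apply/wnorm_leP => // y; rewrite mulrDl (le_trans (ler_normB _ _))//.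
by rewrite lerD.
Qed.

(** Each of the two values of [G] is at most the sum [S] containing it, and 6 = 1 + 1 + 2 + 2
    collects the two Poisson terms and the two means. The sum includes index [n], where the last
    boundary terms sit. *)
Let boundary_le n (S := \sum_(0 <= k < n.+1) G (tk k) (xk k)) :
  `|U (tk 0%N) (xk 0%N) - U (tk n) (xk n)
     + (\int[pi_ (tk 0%N)]_y f y - \int[pi_ (tk n)]_y f y)| <= 6 * c * S `^ alpha.
Proof.
have GS k : (k <= n)%N -> G (tk k) (xk k) `^ alpha <= S `^ alpha.
  move=> kn; have S0 : 0 <= S by rewrite sumr_ge0.
  apply: ge0_ler_powR; rewrite ?nnegrE ?(ltW alpha_gt0)//.
  rewrite /S big_mkord (bigD1 (Ordinal (kn : (k < n.+1)%N)))//= lerDl.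
  by rewrite sumr_ge0.
have h0 := GS 0%N isT; have hn := GS n (leqnn n).
have b0 := le_trans (U_le (tk 0%N) (xk 0%N)) (ler_wpM2l c0 h0).
have bn := le_trans (U_le (tk n) (xk n)) (ler_wpM2l c0 hn).
have c20 : 0 <= 2 * c by rewrite mulr_ge0.
have p0 := le_trans (pi_le (tk 0%N) (xk 0%N)) (ler_wpM2l c20 h0).
have pn := le_trans (pi_le (tk n) (xk n)) (ler_wpM2l c20 hn).
rewrite (le_trans (ler_normD _ _))// (le_trans (lerD (ler_normB _ _) (ler_normB _ _)))//.
have -> : 6 * c * S `^ alpha = (c * S `^ alpha + c * S `^ alpha) +
  (2 * c * S `^ alpha + 2 * c * S `^ alpha) by ring.
by rewrite !lerD.
Qed.

Let invariant_sum n : \sum_(1 <= k < n.+1) (\int[pi_ (tk k)]_y f y - pistar) =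
  \sum_(1 <= k < n.+1) \int[pi_ tstar]_x kop_sub (P (tk k)) (P tstar)
      (Lambda (P tstar) (pi_ tstar) f) x
  + \sum_(1 <= k < n.+1) \int[pi_ (tk k)]_x kop_sub (P (tk k)) (P tstar)
      (Lambda (P tstar) (pi_ tstar) (kop_sub (P (tk k)) (P tstar)
        (Lambda (P tstar) (pi_ tstar) f))) x.
Proof.
rewrite -big_split/=; apply: eq_bigr => k _.
exact: (invariant_expansion mV V1 alpha_gt0 alpha_lt (ek (tk k)) (ek tstar) mf fc).
Qed.

(** The power alpha turns the normalisation of (A3b) into (n + 1)^(-1/2), and sqrt (n + 1) <= 2 sqrt
    n for n >= 1. At n = 0 the left side is 0, since the inverse of 0 is 0. *)
Let scale_le n (S : R) : 0 <= S ->
  (Num.sqrt n%:R)^-1 * S `^ alpha <= 2 * (n.+1%:R `^ (- (2 * alpha)^-1) * S) `^ alpha.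
Proof.
move=> S0; rewrite powRM ?powR_ge0// -powRrM mulrA ler_wpM2r ?powR_ge0//.
have -> : - (2 * alpha)^-1 * alpha = - 2^-1 by field; exact: lt0r_neq0.
rewrite powRN powR12_sqrt//; case: n => [|n].
  by rewrite sqrtr0 invr0 mulr_ge0// invr_ge0 sqrtr_ge0.
rewrite -ler_pdivrMl// -invfM lef_pV2 ?posrE ?mulr_gt0 ?sqrtr_gt0//.
rewrite -[2 in leRHS](@ger0_norm R 2)// -sqrtr_sqr -sqrtrM ?sqr_ge0// ler_sqrt ?mulr_ge0//.
by rewrite -natrX -natrM ler_nat; lia.
Qed.

Lemma remainder_le n :
  `|(Num.sqrt n%:R)^-1 * \sum_(1 <= k < n.+1) (f (xk k) - pistar) -
    ((Num.sqrt n%:R)^-1 * \sum_(0 <= k < n) D (tk k) (xk k) (xk k.+1)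
     + (Num.sqrt n%:R)^-1 * \sum_(1 <= k < n.+1) \int[pi_ tstar]_x
         kop_sub (P (tk k)) (P tstar) (Lambda (P tstar) (pi_ tstar) f) x)| <=
  (Num.sqrt n%:R)^-1 * \sum_(1 <= k < n.+1)
      fine (wnorm (wpow V alpha) (fun x => U (tk k) x - U (tk k.-1) x)) * wpow V alpha (xk k)
  + `|(Num.sqrt n%:R)^-1 * \sum_(1 <= k < n.+1) \int[pi_ (tk k)]_x
       kop_sub (P (tk k)) (P tstar) (Lambda (P tstar) (pi_ tstar)
         (kop_sub (P (tk k)) (P tstar) (Lambda (P tstar) (pi_ tstar) f))) x|
  + (12 * c + 1) *
    (n.+1%:R `^ (- (2 * alpha)^-1) * \sum_(0 <= k < n.+1) G (tk k) (xk k)) `^ alpha.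
Proof.
have alg (a s1 s2 s3 s4 s5 b2 b5 b : R) : 0 <= a -> `|s2| <= b2 -> `|s5| <= b5 -> a * b5 <= b ->
    `|a * (s1 + s2 + (s3 + s4) + s5) - (a * s1 + a * s3)| <= a * b2 + `|a * s4| + b.
  move=> a0 h2 h5 hb.
  have -> : a * (s1 + s2 + (s3 + s4) + s5) - (a * s1 + a * s3) = a * s2 + a * s4 + a * s5.
    by ring.
  rewrite (le_trans (ler_normD _ _))// lerD ?(le_trans (ler_normD _ _))//.
    by rewrite lerD2r normrM (ger0_norm a0) ler_wpM2l.
  by rewrite normrM (ger0_norm a0) (le_trans (ler_wpM2l a0 h5)).
rewrite decomposition invariant_sum; apply: alg.
- by rewrite invr_ge0 sqrtr_ge0.
- apply: (le_trans (ler_norm_sum _ _ _)).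
  by apply: ler_sum => k _; exact: wnorm_step.
- exact: boundary_le.
have S0 : 0 <= \sum_(0 <= k < n.+1) G (tk k) (xk k) by rewrite sumr_ge0.
have c60 : 0 <= 6 * c by rewrite mulr_ge0.
rewrite mulrCA; apply: (le_trans (ler_wpM2l c60 (scale_le n S0))).
rewrite mulrA ler_wpM2r ?powR_ge0//.
(* The factor 12 combines [boundary_le] and [scale_le]; the added 1 keeps the constant positive when
   c = 0. *)
by have -> : 6 * c * 2 = 12 * c by [ring]; rewrite lerDl.
Qed.

End adaptive_chain.

Theorem theorem2p3 (R : realType)
    (dX dT dO : measure_display)
    (X : measurableType dX) (Theta : measurableType dT)
    (Omega : measurableType dO) (Pr : probability Omega R)
    (P : Theta -> R.-pker X ~> X)
    (P_measurable : forall A : set X, measurable A ->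
       measurable_fun [set: X * Theta] (fun z => P z.2 z.1 A))
    (thstar : Theta)
    (Xn : nat -> {RV Pr >-> X}) (th : nat -> {RV Pr >-> Theta})
    (V : X -> R)
    (V_measurable : measurable_fun setT V)
    (V_ge1 : forall x, 1 <= V x)
    (A2_irreducible : forall t, phi_irreducible (P t))
    (A2_aperiodic : forall t, aperiodic (P t))
    (A2_drift : forall t, exists b lambda : R,
       [/\ 1 < b, 0 < lambda, lambda < 1 &
           forall x, (\int[P t x]_y (V y)%:E <= (lambda * V x + b)%:E)%E])
    (A2_small : forall t (l : R), 1 <= l -> small1 (P t) [set x | V x <= l])
    (pi_ : Theta -> probability X R)
    (pi_invariant : forall t, invariant_probability (P t) (pi_ t))
    (alpha : R) (alpha_gt0 : 0 < alpha) (alpha_lt : alpha < 2^-1)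
    (C rho : Theta -> R)
    (rho_gt0 : forall t, 0 < rho t) (rho_lt1 : forall t, rho t < 1)
    (P_alpha : forall t (n : nat) (gam : R), alpha <= gam -> gam <= 1 ->
       (kdist (wpow V gam) (kpow (P t) n) (fun=> pi_ t)
          <= (C t * rho t ^+ n)%:E)%E)
    (M : set (X -> R))
    (M_sub : M `<=` Lweight (wpow V alpha))
    (A3a : forall f, M f ->
       cvg_in_probability Pr (fun n w => (Num.sqrt n%:R)^-1 *
         \sum_(1 <= k < n.+1)
           fine (wnorm (wpow V alpha) (fun x =>
             kop (P (th k w)) (Lambda (P (th k w)) (pi_ (th k w)) f) x
             - kop (P (th k.-1 w)) (Lambda (P (th k.-1 w)) (pi_ (th k.-1 w)) f) x))
           * wpow V alpha (Xn k w)) 0)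
    (A3b : let L := fun t => Num.max (C t) (1 - rho t)^-1 in
       cvg_in_probability Pr (fun n w => n%:R `^ (- (2 * alpha)^-1) *
         \sum_(0 <= k < n)
           L (th k w) `^ (2 / alpha) * kop (P (th k w)) V (Xn k w)) 0)
    (sigma2 : (X -> R) -> R)
    (A4 : let F := fun f t x =>
            kop (P t) (fun y => Lambda (P t) (pi_ t) f y ^+ 2) x
            - kop (P t) (Lambda (P t) (pi_ t) f) x ^+ 2 in
       forall f, M f ->
         cvg_in_probability Pr (fun n w => n%:R^-1 *
           \sum_(0 <= k < n) F f (th k w) (Xn k w)) (sigma2 f))
    (nu : probability X R)
    (A5 : forall (n : nat) (h : n.+1.-tuple X -> R),
       measurable_fun setT h -> bounded_fun h ->
       is_cond_expectation Pr (g_sigma_preimage (fun i : 'I_n.+1 => th i))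
         (fun w => h [tuple Xn i w | i < n.+1])
         (fun w => path_int P nu (fun k => th k w) h))
    (gamma2 : (X -> R) -> R)
    (gamma2_gt0 : forall f, M f -> 0 < gamma2 f)
    (A6a : forall f, M f ->
       cvg_in_distribution Pr (fun n w => (Num.sqrt n%:R)^-1 *
         \sum_(1 <= k < n.+1)
           \int[pi_ thstar]_x
             kop_sub (P (th k w)) (P thstar)
               (Lambda (P thstar) (pi_ thstar) f) x)
         (normal_prob 0 (Num.sqrt (gamma2 f))))
    (A6b : forall f, M f ->
       cvg_in_probability Pr (fun n w => (Num.sqrt n%:R)^-1 *
         \sum_(1 <= k < n.+1)
           \int[pi_ (th k w)]_x
             kop_sub (P (th k w)) (P thstar)
               (Lambda (P thstar) (pi_ thstar)
                 (kop_sub (P (th k w)) (P thstar)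
                   (Lambda (P thstar) (pi_ thstar) f))) x) 0) :
  forall f, M f ->
    cvg_in_distribution Pr (fun n w => (Num.sqrt n%:R)^-1 *
      \sum_(1 <= k < n.+1) (f (Xn k w) - \int[pi_ thstar]_x f x))
      (normal_prob 0 (Num.sqrt (sigma2 f + gamma2 f))).
Proof.
move=> f Mf; have [mf fW] := M_sub f Mf.
have V0 x : 0 <= V x by rewrite (le_trans _ (V_ge1 x)).
have fc := fine_wnorm_bound (wpow_gt0 V_ge1 alpha) fW.
set c := fine (wnorm (wpow V alpha) f) in fc.
have ek t : ergodic_kernel V alpha (P t) (pi_ t) (C t) (rho t).
  split => //; last by move=> n gam; exact: P_alpha.
  (* Since V >= 1, the additive constant is absorbed into the multiple of [V]. *)
  have [b [l [b1 l0 l1 h]]] := A2_drift t; exists (l + b) => x.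
  apply: le_trans (h x) _; rewrite lee_fin mulrDl lerD2l ler_peMr//.
  by rewrite ltW// (lt_trans ltr01).
have c0 : 0 <= c := weight_cst_ge0 V_ge1 fc.
have mD := measurable_mg_increment P_measurable V_measurable V_ge1 alpha_lt ek mf fc.
pose D t := mg_increment (P t) (pi_ t) f.
pose tail t := \int[pi_ thstar]_x kop_sub (P t) (P thstar) (Lambda (P thstar) (pi_ thstar) f) x.
have mtail : measurable_fun setT tail.
  have mL := measurable_Lambda V_measurable V_ge1 alpha_lt (ek thstar) mf fc.
  apply: (measurable_Rintegral_cst (pi_ thstar)
    (h := fun z => kop_sub (P z.1) (P thstar) (Lambda (P thstar) (pi_ thstar) f) z.2)).
  apply: measurable_funB; last first.
    exact: (measurableT_comp (measurable_kop (P thstar) mL) measurable_snd).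
  exact: (measurable_kop_param P_measurable (measurableT_comp mL measurable_snd)).
(* The sum of (A6a) as a function of the parameter tuple, the form in which it can be frozen along a
   path. *)
pose tau n (tp : n.+1.-tuple Theta) :=
  (Num.sqrt n%:R)^-1 * \sum_(1 <= k < n.+1) tail (tnth tp (inord k)).
have mtau n : measurable_fun setT (tau n).
  apply: measurable_funM => //; apply: measurable_sum => k.
  exact: (measurableT_comp mtail (measurable_tnth _)).
have tauE n w : tau n (tupleRV th n w) =
    (Num.sqrt n%:R)^-1 * \sum_(1 <= k < n.+1) tail (th k w).
  congr (_ * _); apply: eq_big_nat => k /andP[_ kn].
  by rewrite tnth_mktuple inordK.
have g0 := gamma2_gt0 f Mf.
have s0 : 0 < Num.sqrt (gamma2 f) by rewrite sqrtr_gt0.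
have q2 : 2 < alpha^-1 by rewrite -[2]invrK ltf_pV2// posrE.
have cvg_tau : cvg_in_distribution Pr (fun n w => tau n (tupleRV th n w))
    (normal_prob 0 (Num.sqrt (gamma2 f))).
  have -> : (fun n w => tau n (tupleRV th n w)) = (fun n w =>
    (Num.sqrt n%:R)^-1 * \sum_(1 <= k < n.+1) tail (th k w)).
    by apply/funext => n; apply/funext => w; exact: tauE.
  exact: A6a.
have cvg_var : cvg_in_probability Pr (fun n w =>
    n%:R^-1 * \sum_(0 <= k < n) step_var P D (th k w) (Xn k w)) (sigma2 f).
  have -> : (fun n w => n%:R^-1 * \sum_(0 <= k < n) step_var P D (th k w) (Xn k w)) =
    (fun (n : nat) w => n%:R^-1 * \sum_(0 <= k < n)
      (kop (P (th k w)) (fun y => Lambda (P (th k w)) (pi_ (th k w)) f y ^+ 2) (Xn k w)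
       - kop (P (th k w)) (Lambda (P (th k w)) (pi_ (th k w)) f) (Xn k w) ^+ 2)).
    apply/funext => n; apply/funext => w; congr (_ * _); apply: eq_bigr => k _.
    exact: (mg_increment_var V_measurable V_ge1 alpha_lt (ek _) mf fc).
  exact: A4.
pose S n w := \sum_(0 <= k < n) (Num.max (C (th k w)) (1 - rho (th k w))^-1) `^ (2 / alpha)
  * kop (P (th k w)) V (Xn k w).
pose A n w := n%:R `^ (- (2 * alpha)^-1) * S n w.
have cvgA : cvg_in_probability Pr A 0 by exact: A3b.
have A0 n w : 0 <= A n w.
  rewrite mulr_ge0 ?powR_ge0// sumr_ge0// => k _.
  by rewrite mulr_ge0 ?powR_ge0//; apply: Rintegral_ge0.
have mmom k : measurable_fun setT (fun w => step_mom P D alpha^-1 (th k w) (Xn k w)).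
  exact: (measurable_step_mom P_measurable alpha^-1 mD (measurable_funP (th k))
    (measurable_funP (Xn k))).
pose kq := 2 * (2 * c) `^ alpha^-1.
have kq0 : 0 <= kq by rewrite mulr_ge0 ?powR_ge0.
have mom0 t x : 0 <= step_mom P D alpha^-1 t x.
  by apply: Rintegral_ge0 => y _; exact: powR_ge0.
have cvg_mom : cvg_in_probability Pr (fun n w => (Num.sqrt n%:R)^-1 `^ alpha^-1 *
    \sum_(0 <= k < n) step_mom P D alpha^-1 (th k w) (Xn k w)) 0.
  apply: (cvg_in_probability0_le _ cvgA).
    by move=> n; apply: measurable_funM => //; exact: measurable_sum.
  (* The added 1 covers [kq = 0], which occurs when c = 0. *)
  move=> eps e0; exists (eps / (kq + 1)); first by rewrite divr_gt0// ltr_wpDl.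
  move=> n w; rewrite (ger0_norm (A0 n w)) ger0_norm; last first.
    by rewrite mulr_ge0 ?powR_ge0// sumr_ge0.
  rewrite ler_pdivrMr ?ltr_wpDl// => h; apply: (le_trans h).
  (* (1 / sqrt n)^(1 / alpha) = n^(-1 / (2 alpha)), the normalisation of (A3b). *)
  rewrite -powR12_sqrt// -powRN -powRrM mulNr -invfM /A -mulrA ler_wpM2l ?powR_ge0//.
  rewrite mulr_suml; apply: ler_sum => k _.
  apply: le_trans (step_mom_le V_measurable V_ge1 alpha_gt0 alpha_lt ek mf fc _ _) _.
  rewrite -/kq mulrC ler_wpM2l ?lerDl// mulr_ge0 ?powR_ge0//.
  exact: Rintegral_ge0.
pose Y n w := (Num.sqrt n%:R)^-1 * \sum_(0 <= k < n) D (th k w) (Xn k w) (Xn k.+1 w)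
  + tau n (tupleRV th n w).
have mY n : measurable_fun setT (Y n).
  apply: measurable_funD; last exact: (cvg_tau.1 n).
  apply: measurable_funM => //; apply: measurable_sum => k.
  exact: (measurableT_comp mD (measurable_fun_pair (measurable_fun_pair
    (measurable_funP (th k)) (measurable_funP (Xn k))) (measurable_funP (Xn k.+1)))).
have s2E : Num.sqrt (gamma2 f) ^+ 2 = gamma2 f by rewrite sqr_sqrtr// ltW.
rewrite -[X in sigma2 f + X]s2E.
have mY' n : measurable_fun setT (fun w => (Num.sqrt n%:R)^-1 *
    \sum_(1 <= k < n.+1) (f (Xn k w) - \int[pi_ thstar]_x f x)).
  apply: measurable_funM => //; apply: measurable_sum => k; apply: measurable_funB => //.
  exact: (measurableT_comp mf (measurable_funP (Xn k))).
have c120 : 0 < 12 * c + 1 by rewrite ltr_wpDl// mulr_ge0.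
(* The three remainder terms, controlled by (A3a), (A6b) and (A3b); the last is taken at [n.+1]
   because the boundary bound sums up to index [n]. *)
have cvgB := cvg_in_probability0D (cvg_in_probability0D (A3a f Mf)
    (cvg_in_probability0_norm (A6b f Mf)))
  (cvg_in_probability0_powR alpha_gt0 c120 (fun n w => A0 n.+1 w) (cvg_in_probability_shift cvgA)).
apply: (cvg_in_distribution_perturb mY mY' cvgB) => [n w|g g1 g2 b tg].
  rewrite /Y tauE.
  exact: (remainder_le V_measurable V_ge1 alpha_gt0 alpha_lt ek mf fc thstar
    (fun k => th k w) (fun k => Xn k w) n).
apply: (test_function_clt P_measurable A5 q2 mD _ _ _ _ s0 mtau cvg_var cvg_mom cvg_tau tg).
- exact: (fun t => integrable_mg_increment V_measurable V_ge1 alpha_lt (ek t) mf fc).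
- exact: (fun t => integrable_mg_increment2 V_measurable V_ge1 alpha_lt (ek t) mf fc).
- move=> t x.
  by have [] := integrable_mg_increment_powR V_measurable V_ge1 alpha_gt0 alpha_lt (ek t) mf fc x.
- exact: (fun t => mg_increment_mean V_measurable V_ge1 alpha_lt (ek t) mf fc).
Qed.
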